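(* Let $\Omega\subset\mathbb{C}^n$ be a domain and let $p\in\partial\Omega$ be a spherically-extreme boundary point of $\Omega$. Then $\displaystyle\lim_{\Omega\ni q\to p}\sigma_\Omega(q)=1$.
   Context: For $q\in\mathbb{C}^n$ and $r>0$ let $\mathbb{B}^n(q;r)=\{z\in\mathbb{C}^n:\|z-q\|<r\}$ (Euclidean norm) and $\mathbb{B}^n=\mathbb{B}^n(0;1)$. For a complex manifold $\Omega$ of dimension $n$ and $p\in\Omega$, let $\mathcal{F}(p,\Omega)$ be the set of injective holomorphic maps $f:\Omega\to\mathbb{B}^n$ with $f(p)=0$. The squeezing function is $\sigma_\Omega(p)=\sup\{r>0:\ \mathbb{B}^n(0;r)\subset f(\Omega)\text{ for some }f\in\mathcal{F}(p,\Omega)\}$. A boundary point $p\in\partial\Omega$ of a domain $\Omega\subset\mathbb{C}^n$ is called spherically-extreme if (1) $\partial\Omega$ is $\mathcal{C}^2$-smooth in an open neighborhood of $p$, and (2) there is a ball $\mathbb{B}^n(c;R)$ with $\Omega\subset\mathbb{B}^n(c;R)$ and $p\in\partial\Omega\cap\partial\mathbb{B}^n(c;R)$. *)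

(* Defs.v *)
From Stdlib Require Import Reals ClassicalEpsilon.
From mathcomp Require Import all_boot.
Open Scope R_scope.

Definition C := (R * R)%type.
Definition Cn (n : nat) := 'I_n -> C.

Definition cadd (a b : C) : C := (fst a + fst b, snd a + snd b).
Definition cmul (a b : C) : C :=
  (fst a * fst b - snd a * snd b, fst a * snd b + snd a * fst b).
Definition c0 : C := (0, 0).

Definition vadd {n} (z w : Cn n) : Cn n := fun i => cadd (z i) (w i).
Definition vsub {n} (z w : Cn n) : Cn n :=
  fun i => (fst (z i) - fst (w i), snd (z i) - snd (w i)).
Definition vscal {n} (t : R) (z : Cn n) : Cn n :=
  fun i => (t * fst (z i), t * snd (z i)).
Definition vzero (n : nat) : Cn n := fun _ => c0.

Definition vnorm {n} (z : Cn n) : R :=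
  sqrt (\big[Rplus/0]_(i < n) (fst (z i) * fst (z i) + snd (z i) * snd (z i))).

Definition ball {n} (c : Cn n) (r : R) : Cn n -> Prop :=
  fun z => vnorm (vsub z c) < r.

Definition is_open {n} (U : Cn n -> Prop) : Prop :=
  forall z, U z -> exists e, e > 0 /\ forall w, vnorm (vsub w z) < e -> U w.

Definition is_connected {n} (U : Cn n -> Prop) : Prop :=
  forall A B : Cn n -> Prop, is_open A -> is_open B ->
    (forall z, U z -> A z \/ B z) ->
    (forall z, U z -> A z -> B z -> False) ->
    (forall z, U z -> A z) \/ (forall z, U z -> B z).

Definition is_domain {n} (D : Cn n -> Prop) : Prop :=
  is_open D /\ (exists z, D z) /\ is_connected D.

Definition in_closure {n} (D : Cn n -> Prop) (p : Cn n) : Prop :=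
  forall e, e > 0 -> exists z, D z /\ vnorm (vsub z p) < e.

(* boundary of an open set: closure minus the set *)
Definition boundary_pt {n} (D : Cn n -> Prop) (p : Cn n) : Prop :=
  in_closure D p /\ ~ D p.

Definition cmatvec {n} (A : 'I_n -> 'I_n -> C) (h : Cn n) : Cn n :=
  fun i => \big[cadd/c0]_(j < n) cmul (A i j) (h j).

Definition holomorphic_on {n} (U : Cn n -> Prop) (f : Cn n -> Cn n) : Prop :=
  forall z, U z -> exists A : 'I_n -> 'I_n -> C,
    forall eps, eps > 0 -> exists delta, delta > 0 /\
      forall h, vnorm h < delta -> U (vadd z h) ->
        vnorm (vsub (vsub (f (vadd z h)) (f z)) (cmatvec A h)) <= eps * vnorm h.

Definition in_family {n} (q : Cn n) (D : Cn n -> Prop) (f : Cn n -> Cn n) : Prop :=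
  holomorphic_on D f /\
  (forall z, D z -> ball (vzero n) 1 (f z)) /\
  (forall z w, D z -> D w -> f z = f w -> z = w) /\
  f q = vzero n.

Definition squeeze_radii {n} (D : Cn n -> Prop) (q : Cn n) : R -> Prop :=
  fun r => r > 0 /\ exists f, in_family q D f /\
    forall w, ball (vzero n) r w -> exists z, D z /\ f z = w.

Definition Rsup (E : R -> Prop) : R :=
  epsilon (inhabits 0) (fun s => is_lub E s).

Definition squeezing {n} (D : Cn n -> Prop) (q : Cn n) : R :=
  Rsup (squeeze_radii D q).

(* real coordinate directions of C^n = R^{2n}: (i, true) = Re z_i, (i, false) = Im z_i *)
Definition dir (n : nat) := ('I_n * bool)%type.
Definition basis {n} (k : dir n) : Cn n :=
  fun i => if i == k.1 then (if k.2 then (1, 0) else (0, 1)) else c0.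

Definition has_partial {n} (g : Cn n -> R) (z : Cn n) (k : dir n) (l : R) : Prop :=
  derivable_pt_lim (fun t => g (vadd z (vscal t (basis k)))) 0 l.

Definition continuous_on {n} (U : Cn n -> Prop) (g : Cn n -> R) : Prop :=
  forall z, U z -> forall eps, eps > 0 -> exists d, d > 0 /\
    forall w, U w -> vnorm (vsub w z) < d -> Rabs (g w - g z) < eps.

Definition C1_on {n} (U : Cn n -> Prop) (g : Cn n -> R) : Prop :=
  exists Dg : dir n -> Cn n -> R,
    (forall z k, U z -> has_partial g z k (Dg k z)) /\
    (forall k, continuous_on U (Dg k)).

Definition C2_boundary_near {n} (D : Cn n -> Prop) (p : Cn n) : Prop :=
  exists (U : Cn n -> Prop) (rho : Cn n -> R) (Drho : dir n -> Cn n -> R),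
    is_open U /\ U p /\
    (forall z k, U z -> has_partial rho z k (Drho k z)) /\
    (forall k, C1_on U (Drho k)) /\
    (forall z, U z -> (D z <-> rho z < 0)) /\
    (forall z, U z -> rho z = 0 -> exists k, Drho k z <> 0).

Definition spherically_extreme {n} (D : Cn n -> Prop) (p : Cn n) : Prop :=
  boundary_pt D p /\
  C2_boundary_near D p /\
  exists (c : Cn n) (Rad : R), Rad > 0 /\
    (forall z, D z -> ball c Rad z) /\ vnorm (vsub p c) = Rad.

(* Main.v *)
(** Fix a boundary point [p'] near [p], put [h = z - p'], and let [w] be the
    complex-linear form in [h] whose real part is minus the differential of the
    defining function at [p'].  To second order the domain is
    [Re w > H h + Re S h], where [H] (Hermitian) and [S] (holomorphic quadratic)
    are the two parts of the second-order term of the boundary at [p], restricted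
    to the complex tangent space.  The enclosing ball gives [|S| <= (1 - c) H] and,
    uniformly in [p'], [Re w >= c |h|^2] on the whole domain.

    With [u = 1 + M w] the projective map [(w/u, h/u)], for [M] large, squeezes the
    domain into a small neighbourhood of [0], so that the shear
    [P = w/u - S(h)/u^2], which removes the pluriharmonic term, has no zero on the
    closed domain other than [p'].  The Cayley transform
    [((P - l)/(P + l), 2 sqrt l h/(u (P + l)))] followed by a linear map turning
    [H] into the Euclidean norm sends the domain into the ball of radius
    [sqrt (1 + eps)]: points away from [p'] go near one boundary point of the ball as
    [l] tends to [0], and points close to [p'] satisfy [Re P >= (1 - 2 d) H/|u|^2].
    All these maps have explicit inverses, which shows that the image contains the
    ball of radius [1 - eps].  A point [q] near [p] is [p' + l e] for a boundary point
    [p'] and a fixed transversal direction [e]; its image is then [eps]-close to [0],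
    and translating and rescaling gives a competitor for the squeezing function
    at [q]. *)
Require Import Defs.
From Stdlib Require Import Reals Lra FunctionalExtensionality Classical ClassicalEpsilon.
From HB Require Import structures.
From mathcomp Require Import all_boot.
From Coquelicot Require Import Complex.
Open Scope R_scope.

(** * Vectors and norms *)

(** Near [p'] the domain is only known up to a sandwich: its points satisfy
    [Re w >= (1 - d) H + Re S - Cq |w|^2], and [Re w > (1 + d) H + Re S + Cq |w|^2] suffices for
    membership. The loss [d] pays for mere C^2 smoothness and for freezing [H] and [S] at [p] while
    [p'] moves. The loss [Cq |w|^2] contains [(Im w)^2], which [Re w] does not control to the
    required order. Absorbing it is a second task of the projective map:
    [Re (w * conj u) = Re w + M |w|^2], so [M >= Cq] is enough. Constants are fixed in the order
    [eps], [d], then [Cq] and [r], then [M], and last a threshold for [l]. The value of [l] itself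
    is not free, being the depth of [q] along [e], so every estimate has to hold for all small [l]
    and all boundary points [p'] near [p]. The enclosing ball enters twice. Its curvature bounds the
    second-order term below on the tangent space, which yields the gap between [|S|] and [H]; and it
    gives an inequality on the whole domain, so that the map can be written down globally, with no
    localization. *)

Lemma RplusA : associative Rplus.
Proof. move=> x y z; ring. Qed.
Lemma RplusC : commutative Rplus.
Proof. move=> x y; ring. Qed.
Lemma Rplus0x : left_id 0 Rplus.
Proof. move=> x; ring. Qed.
HB.instance Definition _ := Monoid.isComLaw.Build R 0 Rplus RplusA RplusC Rplus0x.

Lemma CplusA : associative Cplus.
Proof. move=> x y z; ring. Qed.
Lemma CplusC : commutative Cplus.
Proof. move=> x y; ring. Qed.
Lemma Cplus0x : left_id (RtoC 0) Cplus.
Proof. move=> x; ring. Qed.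
HB.instance Definition _ :=
  Monoid.isComLaw.Build Complex.C (RtoC 0) Cplus CplusA CplusC Cplus0x.

Lemma rsum_le (I : finType) (F G : I -> R) :
  (forall i, F i <= G i) ->
  \big[Rplus/0]_(i : I) F i <= \big[Rplus/0]_(i : I) G i.
Proof.
move=> FG; apply: (big_ind2 Rle) => [|a b c d ? ?|i _]; [lra|lra|exact: FG].
Qed.

Lemma rsum_ge0 (I : finType) (F : I -> R) :
  (forall i, 0 <= F i) -> 0 <= \big[Rplus/0]_(i : I) F i.
Proof. move=> F0; apply: (big_ind (Rle 0)) => [|a b ? ?|i _]; [lra|lra|exact: F0]. Qed.

Lemma rsum_mull (I : finType) c (F : I -> R) :
  c * \big[Rplus/0]_(i : I) F i = \big[Rplus/0]_(i : I) (c * F i).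
Proof. apply: (big_morph (Rmult c)) => [x y|]; ring. Qed.

Lemma rsum_mulr (I : finType) c (F : I -> R) :
  (\big[Rplus/0]_(i : I) F i) * c = \big[Rplus/0]_(i : I) (F i * c).
Proof. apply: (big_morph (Rmult^~ c)) => [x y|]; ring. Qed.

Lemma rsum_add (I : finType) (F G : I -> R) :
  \big[Rplus/0]_(i : I) (F i + G i) =
  \big[Rplus/0]_(i : I) F i + \big[Rplus/0]_(i : I) G i.
Proof. exact: big_split. Qed.

Lemma rsum_ge_term (I : finType) (F : I -> R) i0 :
  (forall i, 0 <= F i) -> F i0 <= \big[Rplus/0]_(i : I) F i.
Proof.
move=> F0; rewrite (bigD1 i0) //=.
suff : 0 <= \big[Rplus/0]_(i | i != i0) F i by lra.
by apply: (big_ind (Rle 0)) => [|a b ? ?|i _]; [lra|lra|exact: F0].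
Qed.

Lemma rsum_const (I : finType) c :
  \big[Rplus/0]_(i : I) c = INR #|I| * c.
Proof.
rewrite big_const; elim: #|I| => [|m IH]; first by rewrite /=; ring.
by rewrite iterS IH S_INR; ring.
Qed.

Lemma rsum_abs (I : finType) (F : I -> R) :
  Rabs (\big[Rplus/0]_(i : I) F i) <= \big[Rplus/0]_(i : I) Rabs (F i).
Proof.
apply: (big_ind2 (fun x y => Rabs x <= y)) => [|a b c d ? ?|i _].
- rewrite Rabs_R0; lra.
- have := Rabs_triang a c; lra.
- lra.
Qed.

Lemma rsum_cauchy_schwarz (I : finType) (a b : I -> R) :
  \big[Rplus/0]_(i : I) (a i * b i) <=
  sqrt (\big[Rplus/0]_(i : I) (a i * a i)) * sqrt (\big[Rplus/0]_(i : I) (b i * b i)).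
Proof.
have sq0 (f : I -> R) : 0 <= \big[Rplus/0]_(i : I) (f i * f i).
  by apply: rsum_ge0 => i; nra.
set A := sqrt (\big[Rplus/0]_(i : I) (a i * a i)).
set B := sqrt (\big[Rplus/0]_(i : I) (b i * b i)).
have A2 : A * A = \big[Rplus/0]_(i : I) (a i * a i) by apply: sqrt_sqrt.
have B2 : B * B = \big[Rplus/0]_(i : I) (b i * b i) by apply: sqrt_sqrt.
have A0 : 0 <= A by apply: sqrt_pos.
have B0 : 0 <= B by apply: sqrt_pos.
have zero (f g : I -> R) : \big[Rplus/0]_(i : I) (f i * f i) = 0 ->
    \big[Rplus/0]_(i : I) (f i * g i) = 0.
  move=> f0; apply: big1 => i _.
  have fi : f i * f i <= 0.
    by rewrite -f0; apply: (rsum_ge_term _ (fun i => f i * f i)) => j; nra.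
  have -> : f i = 0 by nra.
  ring.
have [A0'|Ap] : A = 0 \/ 0 < A by lra.
  by rewrite zero; [nra|rewrite -A2 A0'; ring].
have [B0'|Bp] : B = 0 \/ 0 < B by lra.
  rewrite (eq_bigr (fun i => b i * a i)); last by move=> i _; ring.
  by rewrite zero; [nra|rewrite -B2 B0'; ring].
(* Expanding the sum of [(B a_i - A b_i)^2 >= 0] gives [2 A B (A B - sum a_i b_i) >= 0]; the cases
   [A = 0] and [B = 0] are already gone, so [A B] can be cancelled. *)
have := sq0 (fun i => B * a i + (- A) * b i).
rewrite (eq_bigr (fun i => (B * B) * (a i * a i) +
  ((- 2 * A * B) * (a i * b i) + (A * A) * (b i * b i)))); last by move=> i _; ring.
rewrite !rsum_add -!rsum_mull -A2 -B2 => sq.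
by have AB : 0 < A * B by [nra]; nra.
Qed.

Definition cscal {n} (c : Complex.C) (z : Cn n) : Cn n := fun i => Cmult c (z i).

Ltac to_complex :=
  repeat match goal with |- context [?t] =>
    lazymatch type of t with Defs.C =>
      let x := fresh "x" in generalize t; intro x; change Complex.C in x end end;
  match goal with
  | |- @eq _ ?a ?b => change (@eq Complex.C a b)
  | _ => idtac
  end.
Ltac cring := to_complex; ring.

Section Vectors.
Context {n : nat}.
Implicit Types (z w h : Cn n) (c : Complex.C).

Lemma vaddE z w i : vadd z w i = Cplus (z i) (w i).
Proof. by []. Qed.
Lemma vsubE z w i : vsub z w i = Cminus (z i) (w i).
Proof. by []. Qed.

Lemma vzeroE i : vzero n i = RtoC 0 :> Complex.C.
Proof. by []. Qed.

Lemma vscalE t z : vscal t z = cscal (RtoC t) z.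
Proof. by apply: functional_extensionality => i; rewrite /vscal /cscal /Cmult /RtoC; apply: injective_projections => /=; ring. Qed.

Lemma vsub_add z w : vsub z w = vadd z (cscal (Copp (RtoC 1)) w).
Proof. by apply: functional_extensionality => i; rewrite vsubE vaddE /cscal; cring. Qed.

Lemma vaddC z w : vadd z w = vadd w z.
Proof. by apply: functional_extensionality => i; rewrite !vaddE; cring. Qed.
Lemma vaddA z w h : vadd z (vadd w h) = vadd (vadd z w) h.
Proof. by apply: functional_extensionality => i; rewrite !vaddE; cring. Qed.
Lemma vadd0 z : vadd (vzero n) z = z.
Proof. by apply: functional_extensionality => i; rewrite vaddE vzeroE; cring. Qed.
Lemma vsub0 z : vsub z (vzero n) = z.
Proof. by apply: functional_extensionality => i; rewrite vsubE vzeroE; cring. Qed.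
Lemma vsub_self z : vsub z z = vzero n.
Proof. by apply: functional_extensionality => i; rewrite vsubE vzeroE; cring. Qed.
Lemma vsubK z w : vadd w (vsub z w) = z.
Proof. by apply: functional_extensionality => i; rewrite !vaddE vsubE; cring. Qed.
Lemma vaddK z w : vsub (vadd z w) z = w.
Proof. by apply: functional_extensionality => i; rewrite vsubE !vaddE; cring. Qed.

Lemma cscal1 z : cscal (RtoC 1) z = z.
Proof. by apply: functional_extensionality => i; rewrite /cscal; cring. Qed.
Lemma cscal0 z : cscal (RtoC 0) z = vzero n.
Proof. by apply: functional_extensionality => i; rewrite /cscal vzeroE; cring. Qed.
Lemma cscalA c d z : cscal c (cscal d z) = cscal (Cmult c d) z.
Proof. by apply: functional_extensionality => i; rewrite /cscal; cring. Qed.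
Lemma cscalDl c d z : cscal (Cplus c d) z = vadd (cscal c z) (cscal d z).
Proof. by apply: functional_extensionality => i; rewrite vaddE /cscal; cring. Qed.
Lemma cscalDr c z w : cscal c (vadd z w) = vadd (cscal c z) (cscal c w).
Proof. by apply: functional_extensionality => i; rewrite /cscal !vaddE; cring. Qed.

Lemma vnormE z : vnorm z = sqrt (\big[Rplus/0]_(i < n) (Cmod (z i) * Cmod (z i))).
Proof.
congr sqrt; apply: eq_bigr => i _; rewrite /Cmod sqrt_sqrt /=; last by nra.
ring.
Qed.

Lemma vnorm_sq z : vnorm z * vnorm z = \big[Rplus/0]_(i < n) (Cmod (z i) * Cmod (z i)).
Proof. by rewrite vnormE sqrt_sqrt //; apply: rsum_ge0 => i; nra. Qed.

Lemma vnorm_ge0 z : 0 <= vnorm z.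
Proof. exact: sqrt_pos. Qed.

Lemma Cmod_le_vnorm z i : Cmod (z i) <= vnorm z.
Proof.
have := vnorm_ge0 z; have := Cmod_ge_0 (z i); have := vnorm_sq z.
have := rsum_ge_term _ (fun i => Cmod (z i) * Cmod (z i)) i.
move=> H; have {}H := H (fun j => Rle_0_sqr (Cmod (z j))); move: H => /=; nra.
Qed.

Lemma vnorm_triangle z w : vnorm (vadd z w) <= vnorm z + vnorm w.
Proof.
have := vnorm_ge0 z; have := vnorm_ge0 w; have := vnorm_ge0 (vadd z w).
have zw : vnorm (vadd z w) * vnorm (vadd z w) <=
    (vnorm z + vnorm w) * (vnorm z + vnorm w); last by nra.
have cs := rsum_cauchy_schwarz _ (fun i => Cmod (z i)) (fun i => Cmod (w i)).
rewrite -!vnormE in cs.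
have -> : (vnorm z + vnorm w) * (vnorm z + vnorm w) =
  vnorm z * vnorm z + (2 * (vnorm z * vnorm w) + vnorm w * vnorm w) by ring.
rewrite !vnorm_sq.
apply: Rle_trans (_ : \big[Rplus/0]_(i < n) (Cmod (z i) * Cmod (z i) +
  (2 * (Cmod (z i) * Cmod (w i)) + Cmod (w i) * Cmod (w i))) <= _).
  apply: rsum_le => i; have := Cmod_triangle (z i) (w i).
  have := Cmod_ge_0 (vadd z w i); rewrite vaddE; nra.
by rewrite !rsum_add -(rsum_mull _ 2) /=; move: cs => /=; lra.
Qed.

Lemma vnorm_cscal c z : vnorm (cscal c z) = Cmod c * vnorm z.
Proof.
have c0 := Cmod_ge_0 c; have z0 := vnorm_ge0 z.
have e : vnorm (cscal c z) * vnorm (cscal c z) = (Cmod c * vnorm z) * (Cmod c * vnorm z).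
  have -> : (Cmod c * vnorm z) * (Cmod c * vnorm z) =
    (Cmod c * Cmod c) * (vnorm z * vnorm z) by ring.
  rewrite !vnorm_sq rsum_mull; apply: eq_bigr => i _.
  by rewrite /cscal Cmod_mult; ring.
apply: Rsqr_inj e; [exact: vnorm_ge0|nra].
Qed.

Lemma vnorm0 : vnorm (vzero n) = 0.
Proof. by rewrite -(cscal0 (vzero n)) vnorm_cscal Cmod_0; ring. Qed.

Lemma vnorm_vscal t z : vnorm (vscal t z) = Rabs t * vnorm z.
Proof. by rewrite vscalE vnorm_cscal Cmod_R. Qed.

Lemma vnorm_subC z w : vnorm (vsub z w) = vnorm (vsub w z).
Proof.
have -> : vsub z w = cscal (Copp (RtoC 1)) (vsub w z).
  by apply: functional_extensionality => i; rewrite /cscal !vsubE; cring.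
by rewrite vnorm_cscal Cmod_opp Cmod_1; ring.
Qed.

Lemma vnorm_sub_triangle w z h : vnorm (vsub z h) <= vnorm (vsub z w) + vnorm (vsub w h).
Proof.
have -> : vsub z h = vadd (vsub z w) (vsub w h); last exact: vnorm_triangle.
by apply: functional_extensionality => i; rewrite vaddE !vsubE; cring.
Qed.

Lemma vnorm_eq0 z : vnorm z = 0 -> z = vzero n.
Proof.
move=> z0; apply: functional_extensionality => i; apply: Cmod_eq_0.
by have := Cmod_le_vnorm z i; have := Cmod_ge_0 (z i); lra.
Qed.

Lemma vnorm_le_const z M : (forall i, Cmod (z i) <= M) -> vnorm z <= INR n * M.
Proof.
move=> zM; have z0 := vnorm_ge0 z.
(* In dimension 0 the hypothesis is vacuous and [M] may be negative, hence a separate case. *)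
have [n0|n1] : INR n = 0 \/ 1 <= INR n.
  by case: (n) => [|m]; [left|right; rewrite S_INR; have := pos_INR m; lra].
  have := vnorm_sq z; rewrite (_ : \big[Rplus/0]_(i < n) _ = 0); first by rewrite n0; nra.
  have {}n0 : n = 0%N by apply: INR_eq; rewrite n0.
  by apply: big1 => i _; exfalso; have := ltn_ord i; rewrite [X in (_ < X)%N]n0.
have M0 : 0 <= M.
  case: (n) z zM n1 {z0} => [|m] z zM n1; first by move: n1 => /=; lra.
  by have := zM ord0; have := Cmod_ge_0 (z ord0); lra.
have : vnorm z * vnorm z <= INR n * (M * M).
  rewrite vnorm_sq -[X in INR X](card_ord n) -(rsum_const 'I_n).
  by apply: rsum_le => i; have := zM i; have := Cmod_ge_0 (z i); nra.
have : 0 <= INR n * M by nra.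
nra.
Qed.

HB.instance Definition _ :=
  Monoid.isComLaw.Build (Cn n) (vzero n) vadd vaddA vaddC vadd0.

(** * Coordinates and complex-linear forms *)

Definition ebasis (j : 'I_n) : Cn n := fun i => if i == j then RtoC 1 else RtoC 0.

Lemma ebasis_eq j : ebasis j j = RtoC 1.
Proof. by rewrite /ebasis eqxx. Qed.

Lemma vec_decomp z : z = \big[vadd/vzero n]_(i < n) cscal (z i) (ebasis i).
Proof.
apply: functional_extensionality => k.
rewrite (big_morph (fun v : Cn n => v k : Complex.C) (id1 := RtoC 0) (op1 := Cplus)) //.
rewrite (bigD1 k) //= big1 => [|i ik].
  by rewrite /cscal ebasis_eq; cring.
by rewrite /cscal /ebasis eq_sym (negbTE ik); cring.
Qed.

Definition linear_form (L : Cn n -> Complex.C) :=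
  (forall z w, L (vadd z w) = Cplus (L z) (L w)) /\
  (forall c z, L (cscal c z) = Cmult c (L z)).

Lemma linear_form0 L : linear_form L -> L (vzero n) = RtoC 0.
Proof. by case=> _ LZ; rewrite -(cscal0 (vzero n)) LZ; cring. Qed.

Lemma linear_formB L z w : linear_form L -> L (vsub z w) = Cminus (L z) (L w).
Proof. by case=> LD LZ; rewrite vsub_add LD LZ; cring. Qed.

Lemma linear_formE L z : linear_form L ->
  L z = \big[Cplus/RtoC 0]_(i < n) Cmult (L (ebasis i)) (z i).
Proof.
move=> Llin; have [LD LZ] := Llin; rewrite {1}(vec_decomp z).
rewrite (big_morph L (id1 := RtoC 0) (op1 := Cplus)) //; last exact: linear_form0.
by apply: eq_bigr => i _; rewrite LZ; cring.
Qed.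

Lemma csum_mod (I : finType) (F : I -> Complex.C) :
  Cmod (\big[Cplus/RtoC 0]_(i : I) F i) <= \big[Rplus/0]_(i : I) Cmod (F i).
Proof.
apply: (big_ind2 (fun x y => Cmod x <= y)) => [|a b c d ? ?|i _].
- rewrite Cmod_0; lra.
- have := Cmod_triangle a c; lra.
- lra.
Qed.

Lemma linear_form_bound L : linear_form L ->
  exists K, 0 < K /\ forall z, Cmod (L z) <= K * vnorm z.
Proof.
move=> Llin; exists (\big[Rplus/0]_(i < n) Cmod (L (ebasis i)) + 1); split.
  have : 0 <= \big[Rplus/0]_(i < n) Cmod (L (ebasis i)).
    by apply: rsum_ge0 => i; exact: Cmod_ge_0.
  lra.
move=> z; rewrite linear_formE //.
apply: Rle_trans (csum_mod _ _) _; rewrite Rmult_plus_distr_r rsum_mulr.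
apply: Rle_trans (_ : \big[Rplus/0]_(i < n) (Cmod (L (ebasis i)) * vnorm z) <= _).
  apply: rsum_le => i; rewrite Cmod_mult; apply: Rmult_le_compat_l.
    exact: Cmod_ge_0.
  exact: Cmod_le_vnorm.
by have := vnorm_ge0 z => /=; lra.
Qed.

End Vectors.

Ltac nonneg := repeat match goal with
  | |- 0 <= ?x * ?x => exact (Rle_0_sqr x)
  | |- 0 <= _ * _ => apply Rmult_le_pos
  | |- 0 <= _ + _ => apply Rplus_le_le_0_compat
  | |- 0 <= / _ => apply Rlt_le, Rinv_0_lt_compat
  | |- 0 <= vnorm _ => apply vnorm_ge0
  | |- 0 <= Rabs _ => apply Rabs_pos
  | |- 0 <= Cmod _ => apply Cmod_ge_0
  | |- 0 <= _ => solve [assumption | lra]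
  end.

(** * Differentiability from continuous partial derivatives *)

Lemma finite_common_radius (I : finType) (P : I -> R -> Prop) :
  (forall i d d', 0 < d' <= d -> P i d -> P i d') ->
  (forall i, exists d, 0 < d /\ P i d) -> exists d, 0 < d /\ forall i, P i d.
Proof.
move=> Pmono Pex.
suff [d [d0 Pd]] : exists d, 0 < d /\ forall i, i \in enum I -> P i d.
  by exists d; split=> // i; apply: Pd; rewrite mem_enum.
elim: (enum I) => [|i s [d [d0 Pd]]]; first by exists 1; split; [lra|].
have [d' [d'0 Pd']] := Pex i.
have dm : 0 < Rmin d d' by apply: Rmin_glb_lt.
exists (Rmin d d'); split=> // j; rewrite inE => /orP [/eqP ->|js].
  by apply: Pmono Pd'; split=> //; exact: Rmin_r.
by apply: Pmono (Pd _ js); split=> //; exact: Rmin_l.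
Qed.

(** The mean value theorem for [f s - m s]. Hypotheses are on the symmetric interval because [a], a
    coordinate of an increment, may have either sign. *)
Lemma mvt_linear_bound (f f' : R -> R) (a m d : R) :
  (forall s, Rabs s <= Rabs a -> derivable_pt_lim f s (f' s)) ->
  (forall s, Rabs s <= Rabs a -> Rabs (f' s - m) <= d) ->
  Rabs (f a - f 0 - m * a) <= d * Rabs a.
Proof.
move=> df bf; case: (Rtotal_order a 0) => [a0|[->|a0]].
- have [c [e [c1 c2]]] := MVT_cor2 f f' a 0 a0
    (fun c cc => df c ltac:(rewrite !Rabs_left1; lra)).
  have -> : f a - f 0 - m * a = (f' c - m) * a by lra.
  rewrite Rabs_mult; apply: Rmult_le_compat_r; first exact: Rabs_pos.
  by apply: bf; rewrite !Rabs_left1; lra.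
- rewrite (_ : f 0 - f 0 - m * 0 = 0); last by ring.
  by rewrite Rabs_R0; lra.
- have [c [e [c1 c2]]] := MVT_cor2 f f' 0 a a0
    (fun c cc => df c ltac:(rewrite !Rabs_right; lra)).
  have -> : f a - f 0 - m * a = (f' c - m) * a by lra.
  rewrite Rabs_mult; apply: Rmult_le_compat_r; first exact: Rabs_pos.
  by apply: bf; rewrite !Rabs_right; lra.
Qed.

Section Calculus.
Context {n : nat}.
Implicit Types (z w h p : Cn n) (k : dir n) (U : Cn n -> Prop).

Definition rcoord k h : R := if k.2 then fst (h k.1) else snd (h k.1).
(** The length of the path from [0] to [h] that changes one real coordinate at a time, hence a
    radius containing all its intermediate points. *)
Definition norm1 h : R := \big[Rplus/0]_(k : dir n) Rabs (rcoord k h).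

Lemma norm1_ge0 h : 0 <= norm1 h.
Proof. by apply: rsum_ge0 => k; exact: Rabs_pos. Qed.

Lemma rcoord_le k h : Rabs (rcoord k h) <= vnorm h.
Proof.
apply: Rle_trans (Cmod_le_vnorm h k.1).
have := Rmax_Cmod (h k.1); have := Rmax_l (Rabs (h k.1).1) (Rabs (h k.1).2).
have := Rmax_r (Rabs (h k.1).1) (Rabs (h k.1).2).
by rewrite /rcoord; case: (k.2); lra.
Qed.

Lemma norm1_le h : norm1 h <= INR #|{: dir n}| * vnorm h.
Proof. by rewrite -rsum_const; apply: rsum_le => k; exact: rcoord_le. Qed.

Lemma rcoord_vadd k h w : rcoord k (vadd h w) = rcoord k h + rcoord k w.
Proof. by rewrite /rcoord; case: (k.2). Qed.

Lemma rcoord_vscal k t h : rcoord k (vscal t h) = t * rcoord k h.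
Proof. by rewrite /rcoord; case: (k.2). Qed.

Lemma norm1_vscal t h : norm1 (vscal t h) = Rabs t * norm1 h.
Proof.
rewrite /norm1 rsum_mull; apply: eq_bigr => k _.
by rewrite rcoord_vscal Rabs_mult.
Qed.

Lemma vnorm_ebasis (j : 'I_n) : vnorm (ebasis j) = 1.
Proof.
have e : vnorm (ebasis j) * vnorm (ebasis j) = 1.
  rewrite vnorm_sq (bigD1 j) //= big1 => [|i ij].
    by rewrite ebasis_eq Cmod_1; ring.
  by rewrite /ebasis (negbTE ij) Cmod_0; ring.
by have := vnorm_ge0 (ebasis j); nra.
Qed.

Lemma basisE k : basis k = cscal (if k.2 then RtoC 1 else Ci) (ebasis k.1).
Proof.
apply: functional_extensionality => i; rewrite /basis /cscal /ebasis.
by case: eqP => _; case: (k.2); apply: injective_projections => /=; ring.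
Qed.

Lemma vnorm_basis k : vnorm (basis k) = 1.
Proof. by rewrite basisE vnorm_cscal vnorm_ebasis; case: k.2; rewrite ?Cmod_1 ?Cmod_Ci; ring. Qed.

Lemma rcoord_decomp h : h = \big[vadd/vzero n]_(k : dir n) vscal (rcoord k h) (basis k).
Proof.
rewrite {1}(vec_decomp h).
rewrite -(pair_bigA _ (fun i b => vscal (rcoord (i, b) h) (basis (i, b)))) /=.
apply: eq_bigr => i _; rewrite big_bool /= !basisE !vscalE /= !cscalA -cscalDl.
congr cscal; rewrite /rcoord /=.
by case: (h i) => x y; apply: injective_projections => /=; ring.
Qed.

Lemma vadd_vscalD z s t h : vadd z (vscal (s + t) h) = vadd (vadd z (vscal s h)) (vscal t h).
Proof.
by rewrite -vaddA !vscalE -cscalDl; congr vadd; congr cscal; rewrite RtoC_plus.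
Qed.

Lemma line_derivative (g : Cn n -> R) z w s l :
  derivable_pt_lim (fun t => g (vadd (vadd z (vscal s w)) (vscal t w))) 0 l ->
  derivable_pt_lim (fun t => g (vadd z (vscal t w))) s l.
Proof.
move=> dg eps e0; have [d Hd] := dg eps e0; exists d => t t0 td.
have := Hd t t0 td; rewrite Rplus_0_l -vadd_vscalD.
rewrite (_ : vadd _ (vscal 0 w) = vadd z (vscal s w)) //.
by rewrite -vadd_vscalD Rplus_0_r.
Qed.

(** Moving from [z] to [z + h] one real coordinate at a time, the mean value theorem applies on each
    leg. The reference slopes [m] are arbitrary: they are the partials at [z] when differentiability
    is proved, but the second partials at the fixed point [p] in the Taylor expansion around
    [p']. *)
Lemma partial_increment U (g : Cn n -> R) (G : dir n -> Cn n -> R) z h (m : dir n -> R) (d : R) :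
  (forall y k, U y -> has_partial g y k (G k y)) ->
  (forall y, vnorm (vsub y z) <= norm1 h -> U y /\ forall k, Rabs (G k y - m k) <= d) ->
  Rabs (g (vadd z h) - g z - \big[Rplus/0]_(k : dir n) (m k * rcoord k h)) <= d * norm1 h.
Proof.
move=> gG near; rewrite {1}(rcoord_decomp h) /norm1.
pose hs (s : seq (dir n)) := \big[vadd/vzero n]_(k <- s) vscal (rcoord k h) (basis k).
pose ns (s : seq (dir n)) := \big[Rplus/0]_(k <- s) Rabs (rcoord k h).
have ns0 s : 0 <= ns s.
  by apply: (big_ind (Rle 0)) => [|a b ? ?|k _]; [lra|lra|exact: Rabs_pos].
have hns s : vnorm (hs s) <= ns s.
  apply: (big_ind2 (fun x y => vnorm x <= y)) => [|a b c e ? ?|k _].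
  - rewrite vnorm0; lra.
  - have := vnorm_triangle a c; lra.
  - rewrite vnorm_vscal vnorm_basis; lra.
suff main s : ns s <= norm1 h ->
    Rabs (g (vadd z (hs s)) - g z - \big[Rplus/0]_(k <- s) (m k * rcoord k h)) <= d * ns s.
  by apply: main; apply: Rle_refl.
elim: s => [|k s IH].
  rewrite /hs /ns !big_nil vaddC vadd0 (_ : g z - g z - 0 = 0); last by ring.
  by rewrite Rabs_R0; lra.
rewrite /hs /ns !big_cons -/(hs s) -/(ns s) => le.
have a0 := Rabs_pos (rcoord k h).
have {}IH := IH ltac:(lra).
set a := rcoord k h in a0 le *.
have in_ball t : Rabs t <= Rabs a ->
    vnorm (vsub (vadd (vadd z (hs s)) (vscal t (basis k))) z) <= norm1 h.
  move=> ta; rewrite -vaddA vaddK.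
  apply: Rle_trans (vnorm_triangle _ _) _; rewrite vnorm_vscal vnorm_basis.
  by have := hns s; lra.
have := mvt_linear_bound (fun t => g (vadd (vadd z (hs s)) (vscal t (basis k))))
  (fun t => G k (vadd (vadd z (hs s)) (vscal t (basis k)))) a (m k) d
  (fun t ta => line_derivative _ _ _ _ _ (gG _ _ (proj1 (near _ (in_ball t ta)))))
  (fun t ta => proj2 (near _ (in_ball t ta)) k).
rewrite [vscal 0 _]vscalE cscal0 [vadd _ (vzero n)]vaddC vadd0 -vaddA => incr.
rewrite [vadd (vscal a (basis k)) (hs s)]vaddC.
set A := g _ in incr *; set B := g _ in incr IH *.
have := Rabs_triang (A - B - m k * a)
  (B - g z - \big[Rplus/0]_(j <- s) (m j * rcoord j h)).
rewrite (_ : A - B - m k * a + (B - g z - \big[Rplus/0]_(j <- s) (m j * rcoord j h)) =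
  A - g z - (m k * a + \big[Rplus/0]_(j <- s) (m j * rcoord j h))); last by ring.
lra.
Qed.

Lemma C1_differentiable U (g : Cn n -> R) (G : dir n -> Cn n -> R) z eps :
  is_open U -> (forall y k, U y -> has_partial g y k (G k y)) ->
  (forall k, continuous_on U (G k)) -> U z -> 0 < eps ->
  exists d, 0 < d /\ forall h, vnorm h < d -> U (vadd z h) /\
    Rabs (g (vadd z h) - g z - \big[Rplus/0]_(k : dir n) (G k z * rcoord k h))
      <= eps * vnorm h.
Proof.
move=> Uo gG Gc Uz eps0.
pose N := INR #|{: dir n}| + 1.
have N0 : 0 < N by have := pos_INR #|{: dir n}|; rewrite /N; lra.
have nN h : norm1 h <= N * vnorm h.
  by have := norm1_le h; have := vnorm_ge0 h; rewrite /N; nra.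
have eN : 0 < eps / N by apply: Rdiv_lt_0_compat.
have [r [r0 Ur]] := Uo z Uz.
have [d [d0 Gd]] : exists d, 0 < d /\ forall k, forall w, U w -> vnorm (vsub w z) < d ->
    Rabs (G k w - G k z) < eps / N.
  apply: finite_common_radius => [k d d' d'd H w Uw wz|k]; first by apply: H => //; lra.
  by have [d [d0 H]] := Gc k z Uz _ eN; exists d.
have rd : 0 < Rmin r d by apply: Rmin_glb_lt.
have rl := Rmin_l r d; have rr := Rmin_r r d.
exists (Rmin (Rmin r d) (Rmin r d / N)); split.
  by apply: Rmin_glb_lt => //; apply: Rdiv_lt_0_compat.
move=> h hd.
have h1 : vnorm h < Rmin r d by apply: Rlt_le_trans hd (Rmin_l _ _).
have h2 : N * vnorm h < Rmin r d.
  have hd' : vnorm h < Rmin r d / N by apply: Rlt_le_trans hd (Rmin_r _ _).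
  have : N * vnorm h < N * (Rmin r d / N) by apply: Rmult_lt_compat_l.
  by rewrite (_ : N * (Rmin r d / N) = Rmin r d); last by field; lra.
split; first by apply: Ur; rewrite vaddK; lra.
apply: Rle_trans (_ : eps / N * norm1 h <= _).
  apply: (partial_increment U g G) => // y yz.
  have Uy : U y by apply: Ur; have := nN h; lra.
  by split=> // k; apply/Rlt_le/Gd => //; have := nN h; lra.
have : eps / N * norm1 h <= eps / N * (N * vnorm h) by apply: Rmult_le_compat_l (nN h); lra.
by rewrite (_ : eps / N * (N * vnorm h) = eps * vnorm h); last by field; lra.
Qed.

Lemma C1_continuous U (g : Cn n -> R) : is_open U -> C1_on U g -> continuous_on U g.
Proof.
move=> Uo [G [gG Gc]] z Uz eps eps0.
have [d [d0 Hd]] := C1_differentiable U g G z 1 Uo gG Gc Uz Rlt_0_1.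
pose K := \big[Rplus/0]_(k : dir n) Rabs (G k z) + 1.
have K0 : 1 <= K.
  have : 0 <= \big[Rplus/0]_(k : dir n) Rabs (G k z).
    by apply: rsum_ge0 => k; exact: Rabs_pos.
  by rewrite /K; lra.
exists (Rmin d (eps / K)); split.
  by apply: Rmin_glb_lt => //; apply: Rdiv_lt_0_compat; lra.
move=> w Uw wz.
have w1 : vnorm (vsub w z) < d by apply: Rlt_le_trans wz (Rmin_l _ _).
have w2 : vnorm (vsub w z) < eps / K by apply: Rlt_le_trans wz (Rmin_r _ _).
have [_] := Hd _ w1; rewrite vsubK.
set S := \big[Rplus/0]_(k : dir n) _ => gS.
have SK : Rabs S <= (K - 1) * vnorm (vsub w z).
  rewrite /K; have -> : forall x, x + 1 - 1 = x by move=> x; ring.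
  rewrite rsum_mulr; apply: Rle_trans (rsum_abs _ _) _; apply: rsum_le => k.
  rewrite Rabs_mult; apply: Rmult_le_compat_l; [exact: Rabs_pos|exact: rcoord_le].
have := Rabs_triang (g w - g z - S) S.
rewrite (_ : g w - g z - S + S = g w - g z); last by ring.
have : K * vnorm (vsub w z) < K * (eps / K) by apply: Rmult_lt_compat_l; lra.
rewrite (_ : K * (eps / K) = eps); last by field; lra.
lra.
Qed.

Lemma C1_line_derivative U (g : Cn n -> R) (G : dir n -> Cn n -> R) z h t :
  is_open U -> (forall y k, U y -> has_partial g y k (G k y)) ->
  (forall k, continuous_on U (G k)) -> U (vadd z (vscal t h)) ->
  derivable_pt_lim (fun s => g (vadd z (vscal s h))) t
    (\big[Rplus/0]_(k : dir n) (G k (vadd z (vscal t h)) * rcoord k h)).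
Proof.
move=> Uo gG Gc Uz; apply: line_derivative => eps eps0.
set y := vadd z _ in Uz *.
pose K := vnorm h + 1; have K0 : 0 < K by have := vnorm_ge0 h; rewrite /K; lra.
have eK : 0 < eps / (2 * K) by apply: Rdiv_lt_0_compat; lra.
have [d [d0 Hd]] := C1_differentiable U g G y _ Uo gG Gc Uz eK.
have dK : 0 < d / K by apply: Rdiv_lt_0_compat.
exists (mkposreal _ dK) => s s0 /= sd.
have as0 : 0 < Rabs s by apply: Rabs_pos_lt.
have hK : Rabs s * vnorm h <= Rabs s * K by apply: Rmult_le_compat_l; rewrite /K; lra.
have sK : Rabs s * K < d.
  have : Rabs s * K < d / K * K by apply: Rmult_lt_compat_r.
  by rewrite (_ : d / K * K = d); last by field; lra.
have [_] := Hd (vscal s h) ltac:(rewrite vnorm_vscal; lra).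
rewrite vnorm_vscal Rplus_0_l.
rewrite (_ : vadd y (vscal 0 h) = y); last by rewrite vscalE cscal0 vaddC vadd0.
rewrite (eq_bigr (fun k => s * (G k y * rcoord k h))); last first.
  by move=> k _; rewrite rcoord_vscal; ring.
rewrite -rsum_mull; set S := \big[Rplus/0]_(k : dir n) _ => H.
have -> : (g (vadd y (vscal s h)) - g y) / s - S = (g (vadd y (vscal s h)) - g y - s * S) * / s.
  by field.
rewrite Rabs_mult Rabs_inv.
apply: Rle_lt_trans (_ : eps / (2 * K) * (Rabs s * K) * / Rabs s < _).
  apply: Rmult_le_compat_r; first by apply/Rlt_le/Rinv_0_lt_compat.
  by apply: Rle_trans H _; apply: Rmult_le_compat_l; lra.
by rewrite (_ : eps / (2 * K) * (Rabs s * K) * / Rabs s = eps / 2); [lra|field; lra].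
Qed.

End Calculus.

(** * Scalar estimates *)

Lemma Rabs_le_between (x y : R) : Rabs x <= y -> - y <= x <= y.
Proof. by have := Rle_abs x; have := Rle_abs (- x); rewrite Rabs_Ropp; lra. Qed.

Section Scalar.
Implicit Types (z w g u S s a : Complex.C).

Lemma Cmod_sqr z : Cmod z * Cmod z = Re z * Re z + Im z * Im z.
Proof. by rewrite /Cmod sqrt_sqrt; rewrite /Re /Im; nra. Qed.

Lemma Re_abs_le z : Rabs (Re z) <= Cmod z.
Proof. exact: re_le_Cmod. Qed.

Lemma Re_le z : Re z <= Cmod z.
Proof. by have := Re_abs_le z; have := Rle_abs (Re z); lra. Qed.

Lemma Cmod_pos_neq0 z : z <> RtoC 0 -> 0 < Cmod z.
Proof. exact: (proj1 (Cmod_gt_0 z)). Qed.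

Lemma Re_ge_neq0 z : 0 < Re z -> z <> RtoC 0.
Proof. by move=> + z0; rewrite z0 /=; lra. Qed.

Lemma Cmod_sub_ge z w : Cmod z - Cmod w <= Cmod (z - w)%C.
Proof.
have := Cmod_triangle (z - w)%C w.
by rewrite (_ : (z - w + w)%C = z); [lra|cring].
Qed.

Lemma Cmod_sub_le z w : Cmod (z - w)%C <= Cmod z + Cmod w.
Proof. by have := Cmod_triangle z (- w)%C; rewrite Cmod_opp. Qed.

Lemma Re_div_mod g z : g <> RtoC 0 ->
  Cmod g * Cmod g * Re (z / g)%C = Re (z * Cconj g)%C.
Proof.
move=> g0; have := Cmod_pos_neq0 _ g0; have := Cmod_sqr g.
case: g g0 => x y _; case: z => p q; rewrite /Re /Im /= => -> g2.
field; have := Cmod_sqr (x, y); rewrite /Re /Im /=; nra.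
Qed.

(** [conj g / g - 1] is [-2 i Im g / g]. So for nearly real [g], dividing by [g^2] differs little
    from dividing by [|g|^2]; this is how the holomorphic factor [1/u^2] on [S] is compared with
    [1/|u|^2] on [H]. *)
Lemma conj_quot g z : g <> RtoC 0 ->
  Rabs (Re (z * (Cconj g / g))%C - Re z) <= Cmod z * (2 * Rabs (Im g) / Cmod g).
Proof.
move=> g0; have gp := Cmod_pos_neq0 _ g0.
have -> : Re (z * (Cconj g / g))%C - Re z = Re (z * ((Cconj g - g) / g))%C.
  rewrite (_ : (z * ((Cconj g - g) / g) = z * (Cconj g / g) - z)%C).
    by case: (z * (Cconj g / g))%C => ? ?; case: (z) => ? ?; rewrite /Re /=; ring.
  by field.
apply: Rle_trans (Re_abs_le _) _; rewrite Cmod_mult Cmod_div //.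
suff -> : Cmod (Cconj g - g)%C = 2 * Rabs (Im g) by lra.
rewrite (_ : (Cconj g - g)%C = (RtoC 2 * (Ci * RtoC (- Im g)))%C).
  by rewrite !Cmod_mult !Cmod_R Cmod_Ci Rabs_Ropp (Rabs_right 2); lra.
by apply: injective_projections; case: (g) => ? ?; rewrite /Im /=; ring.
Qed.

Lemma Re_div_sqr g z : g <> RtoC 0 ->
  Cmod g * Cmod g * Re (z / (g * g))%C = Re (z * (Cconj g / g))%C.
Proof.
move=> g0; rewrite (_ : (z / (g * g) = (z / g) / g)%C); last by field.
rewrite Re_div_mod //; congr Re; field; exact: g0.
Qed.

(* [sqrt (1 + t^2) >= t + 1 / (1 + 2 t)] *)
Lemma Cmod_one_plus (M : R) w : 0 <= M -> 0 <= Re w ->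
  1 <= Cmod (1 + M * w)%C /\
  M * Cmod w + / (1 + 2 * (M * Cmod w)) <= Cmod (1 + M * w)%C.
Proof.
move=> M0 w0.
have e : Cmod (1 + M * w)%C * Cmod (1 + M * w)%C =
    1 + 2 * M * Re w + (M * Cmod w) * (M * Cmod w).
  rewrite Cmod_sqr (_ : M * Cmod w * (M * Cmod w) = M * M * (Cmod w * Cmod w)); last by ring.
  by rewrite Cmod_sqr; case: (w) => x y; rewrite /Re /Im /=; ring.
set t := M * Cmod w in e *.
have t0 : 0 <= t by apply: Rmult_le_pos => //; exact: Cmod_ge_0.
have mp := Cmod_ge_0 (1 + M * w)%C.
have Mw : 0 <= M * Re w by apply: Rmult_le_pos.
split; first by nra.
have i0 : 0 < / (1 + 2 * t) by apply: Rinv_0_lt_compat; lra.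
have i1 : (1 + 2 * t) * / (1 + 2 * t) = 1 by field; lra.
set q := / (1 + 2 * t) in i0 i1 *.
have : (t + q) * (t + q) <= Cmod (1 + M * w)%C * Cmod (1 + M * w)%C.
  rewrite e; have : q * q <= q by nra.
  nra.
nra.
Qed.

Lemma Im_one_plus (M : R) w : 0 <= M -> Rabs (Im (1 + M * w)%C) <= M * Cmod w.
Proof.
move=> M0; have -> : Im (1 + M * w)%C = M * Im w.
  by case: (w) => x y; rewrite /Im /=; ring.
rewrite Rabs_mult (Rabs_right M); last by lra.
apply: Rmult_le_compat_l => //.
have := Cmod_sqr w; have := Cmod_ge_0 w; have := Rabs_pos (Im w).
by have := Rsqr_abs (Im w); rewrite /Rsqr; nra.
Qed.

(** Quantitative form of: the numerator of [P] vanishes only where [w] does. If [|w| >= r], then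
    [|w u| >= M |w|^2 >= K |w|], while [|S| <= H <= (K / 2) |w|]. If [|w| < r], put [N = |w u - S|]:
    the real part of [w u - S] and the boundary inequality give [|S| <= (M + Cq) |w|^2 + N], so
    [|w u| <= (M + Cq) |w|^2 + 2 N]. Since [|u|] exceeds [M |w|] by at least [1 / (1 + 2 K)], the
    terms [M |w|^2] cancel and the excess bounds [N] below. *)
Lemma shear_lower_bound (c2 Cq r d H M : R) w S : let K := 2 / c2 in
  M = K / r ->
  0 < c2 -> 0 <= Cq -> 0 < r -> Cq * r <= / (2 * (1 + 2 * K)) ->
  Cmod S <= (1 - d) * H -> Cmod S <= H -> 0 <= H -> c2 * H <= Re w ->
  (Cmod w < r -> (1 - d) * H + Re S - Cq * (Cmod w * Cmod w) <= Re w) ->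
  Rmin (K / 2) (/ (4 * (1 + 2 * K))) * Cmod w <= Cmod (w * (1 + M * w) - S)%C.
Proof.
move=> K eM c20 Cq0 r0 Cr Sd SH H0 Hw near.
have K0 : 0 < K by apply: Rdiv_lt_0_compat; lra.
have Kc : K * c2 = 2 by rewrite /K; field; lra.
have w0 : 0 <= Re w by nra.
have M0 : 0 <= M by rewrite eM; apply: Rlt_le; apply: Rdiv_lt_0_compat.
have Mr : M * r = K by rewrite eM; field; lra.
have [u1 u2] := Cmod_one_plus M w M0 w0.
set u := (1 + M * w)%C in u1 u2 *.
have wp := Cmod_ge_0 w; have Np := Cmod_ge_0 (w * u - S)%C.
set p := Cmod w in wp u2 near *.
have kmin1 := Rmin_l (K / 2) (/ (4 * (1 + 2 * K))).
have kmin2 := Rmin_r (K / 2) (/ (4 * (1 + 2 * K))).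
have [wr|wr] := Rlt_or_le p r; last first.
  apply: Rle_trans (_ : K / 2 * p <= _); first by apply: Rmult_le_compat_r.
  have := Cmod_sub_ge (w * u)%C S; rewrite Cmod_mult -/p => NS.
  have : 0 < / (1 + 2 * (M * p)) by apply: Rinv_0_lt_compat; nra.
  have := Re_le w; rewrite -/p => wRe i0.
  have SHp : Cmod S <= K / 2 * p by nra.
  have Kp : K <= M * p by nra.
  have : p * K <= p * Cmod u by apply: Rmult_le_compat_l => //; lra.
  lra.
apply: Rle_trans (_ : / (4 * (1 + 2 * K)) * p <= _); first by apply: Rmult_le_compat_r.
have {}near := near wr.
have Nre := Re_le (w * u - S)%C.
have eRe : Re (w * u - S)%C = Re w + M * (Re w * Re w - Im w * Im w) - Re S.
  by rewrite /u; case: (w) => x y; case: (S) => ? ?; rewrite /Re /Im /=; ring.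
have p2 : p * p = Re w * Re w + Im w * Im w by exact: Cmod_sqr.
have H1 : (1 - d) * H <= (Cq + M) * (p * p) + Cmod (w * u - S)%C.
  by have : 0 <= M * (Re w * Re w) by [nra]; rewrite eRe in Nre; nra.
have pu : p * Cmod u <= Cmod S + Cmod (w * u - S)%C.
  by rewrite -Cmod_mult; have := Cmod_sub_ge (w * u)%C S; lra.
have Mp : M * p <= K by nra.
have i1 : / (1 + 2 * K) <= / (1 + 2 * (M * p)).
  by apply: Rinv_le_contravar; nra.
have e4 : / (4 * (1 + 2 * K)) = / (1 + 2 * K) / 4 by field; lra.
have e2 : / (2 * (1 + 2 * K)) = / (1 + 2 * K) / 2 by field; lra.
rewrite e4; rewrite e2 in Cr; set q := / (1 + 2 * K) in i1 Cr *.
have : p * (M * p + q) <= p * Cmod u by apply: Rmult_le_compat_l => //; lra.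
have : p * (Cq * p) <= p * (q / 2) by apply: Rmult_le_compat_l => //; nra.
nra.
Qed.

(** After multiplication by [|u|^2], the term [w / u] gains [M |w|^2], which absorbs the error
    [Cq |w|^2], and [S / u^2] differs from [S / |u|^2] in real part by at most [d H / |u|^2]. This
    is the second loss of [d]. *)
Lemma shear_near (M Cq d H : R) w S : let u := (1 + M * w)%C in
  0 <= M -> Cq <= M -> 0 <= Re w -> 0 <= H -> Cmod S <= H ->
  2 * M * Cmod w <= d ->
  (1 - d) * H + Re S - Cq * (Cmod w * Cmod w) <= Re w ->
  (1 - 2 * d) * (H / (Cmod u * Cmod u)) <= Re ((w * u - S) / (u * u))%C.
Proof.
move=> u M0 CM w0 H0 SH Md near.
have [u1 _] := Cmod_one_plus M w M0 w0; rewrite -/u in u1.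
have u0 : u <> RtoC 0 by apply/Cmod_gt_0; lra.
have -> : ((w * u - S) / (u * u) = w / u - S / (u * u))%C by field.
have -> : Re (w / u - S / (u * u))%C = Re (w / u)%C - Re (S / (u * u))%C.
  by rewrite /Re /=; ring.
have e1 := Re_div_mod u w u0; have e2 := Re_div_sqr u S u0.
have e3 : Re (w * Cconj u)%C = Re w + M * (Cmod w * Cmod w).
  by rewrite Cmod_sqr /u; case: (w) => x y; rewrite /Re /Im /=; ring.
have := conj_quot u S u0; have := Im_one_plus M w M0; rewrite -/u => Iu.
rewrite -e2 => /Rabs_le_between [_ cq].
have u2 : 0 < Cmod u * Cmod u by nra.
apply: (Rmult_le_reg_l (Cmod u * Cmod u)) => //.
have -> : Cmod u * Cmod u * ((1 - 2 * d) * (H / (Cmod u * Cmod u))) = (1 - 2 * d) * H.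
  by field; lra.
rewrite Rmult_minus_distr_l e1 e3.
have S0 := Cmod_ge_0 S; have wp := Cmod_ge_0 w.
have iu : 2 * Rabs (Im u) / Cmod u <= d.
  apply: (Rmult_le_reg_r (Cmod u)); first by lra.
  rewrite /Rdiv Rmult_assoc Rinv_l; last by lra.
  have : 0 <= d by nra.
  by have := Rabs_pos (Im u); nra.
have : Cmod S * (2 * Rabs (Im u) / Cmod u) <= H * d.
  apply: Rmult_le_compat => //.
  by apply: Rmult_le_pos; [have := Rabs_pos (Im u); lra|apply: Rlt_le; apply: Rinv_0_lt_compat; lra].
have : Cq * (Cmod w * Cmod w) <= M * (Cmod w * Cmod w) by apply: Rmult_le_compat_r; nra.
nra.
Qed.

Lemma Cmod_add_R_sqr z (l : R) :
  Cmod (z + l)%C * Cmod (z + l)%C = Cmod z * Cmod z + 2 * l * Re z + l * l.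
Proof. by rewrite !Cmod_sqr; case: z => x y; rewrite /Re /Im /=; ring. Qed.

(** The conclusion is the bound on the numerator in [ball_map_norm] that puts the image into the
    ball of radius [sqrt (1 + eps)]. Close to [p'], [shear_near] gives
    [H / |u|^2 - Re P <= eps Re P]. Away from [p'], [|P + l|] is bounded below independently of [l],
    while the left side is of order [l]. *)
Lemma upper_estimate (c1 c2 Cq r0 Rb eps d : R) :
  0 < c1 -> 0 < c2 -> 0 <= Cq -> 0 < r0 -> 0 < Rb -> 0 < d ->
  d <= / 4 -> d <= c1 -> 4 * d <= eps ->
  exists M l0, 0 < M /\ 0 < l0 /\ forall (w S : Complex.C) (H l : R),
    0 <= H -> Cmod S <= (1 - c1) * H -> c2 * H <= Re w -> Cmod w <= Rb ->
    (Cmod w < r0 -> (1 - d) * H + Re S - Cq * (Cmod w * Cmod w) <= Re w) ->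
    0 < l < l0 ->
    let u := (1 + M * w)%C in let P := ((w * u - S) / (u * u))%C in
    (P + l)%C <> RtoC 0 /\
    4 * l * (H / (Cmod u * Cmod u) - Re P) <= eps * (Cmod (P + l)%C * Cmod (P + l)%C).
Proof.
move=> c10 c20 Cq0 r00 Rb0 d0 d4 dc1 deps.
pose K := 2 / c2.
have K0 : 0 < K by apply: Rdiv_lt_0_compat; lra.
have Kc : K * c2 = 2 by rewrite /K; field; lra.
pose q := / (2 * (1 + 2 * K)).
have q0 : 0 < q by apply: Rinv_0_lt_compat; lra.
(* The second bound gives the smallness of [Cq * r] required by [shear_lower_bound]; the third makes
   [M = K / r] at least [Cq], as [shear_near] requires. *)
pose r := Rmin r0 (Rmin (q / (Cq + 1)) (K / (Cq + 1))).
have r1 : r <= r0 by exact: Rmin_l.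
have r2 : r <= q / (Cq + 1) by apply: Rle_trans (Rmin_r _ _) (Rmin_l _ _).
have r3 : r <= K / (Cq + 1) by apply: Rle_trans (Rmin_r _ _) (Rmin_r _ _).
have rp : 0 < r by rewrite /r; do !apply: Rmin_glb_lt => //; apply: Rdiv_lt_0_compat; lra.
have Cr : Cq * r <= q.
  have : (Cq + 1) * r <= (Cq + 1) * (q / (Cq + 1)) by apply: Rmult_le_compat_l; lra.
  rewrite (_ : (Cq + 1) * (q / (Cq + 1)) = q); last by field; lra.
  nra.
have CK : (Cq + 1) * r <= K.
  have : (Cq + 1) * r <= (Cq + 1) * (K / (Cq + 1)) by apply: Rmult_le_compat_l; lra.
  by rewrite (_ : (Cq + 1) * (K / (Cq + 1)) = K); last by field; lra.
pose M := K / r.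
have M0 : 0 < M by apply: Rdiv_lt_0_compat.
have Mr : M * r = K by rewrite /M; field; lra.
have CM : Cq <= M by nra.
pose k := Rmin (K / 2) (/ (4 * (1 + 2 * K))).
have k0 : 0 < k by apply: Rmin_glb_lt; [lra|apply: Rinv_0_lt_compat; lra].
pose r' := Rmin r (d / (2 * M)).
have r'0 : 0 < r' by apply: Rmin_glb_lt => //; apply: Rdiv_lt_0_compat; lra.
have r'M : 2 * M * r' <= d.
  have : 2 * M * r' <= 2 * M * (d / (2 * M)).
    by apply: Rmult_le_compat_l; [lra|exact: Rmin_r].
  by rewrite (_ : 2 * M * (d / (2 * M)) = d); last by field; lra.
(* Where [|w| >= r'], [|w u - S| >= k r'] and [|u| <= 1 + M Rb], so [|P| >= 2 m]; half of this is
   kept for [|P + l|] once [l < m]. *)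
pose m := k * r' / ((1 + M * Rb) * (1 + M * Rb)) / 2.
have m0 : 0 < m.
  by apply: Rdiv_lt_0_compat; [apply: Rdiv_lt_0_compat; nra|lra].
(* A bound for [H / |u|^2 - Re P]: the first term is at most [Rb / c2], and
   [|P| <= Rb + Rb / c2]. *)
pose B := Rb / c2 * 2 + Rb.
have Rbc : 0 < Rb / c2 by apply: Rdiv_lt_0_compat.
exists M, (Rmin m (eps * (m * m) / (4 * B))); split=> //; split.
  apply: Rmin_glb_lt => //; apply: Rdiv_lt_0_compat; last by rewrite /B; lra.
  by apply: Rmult_lt_0_compat; [lra|apply: Rmult_lt_0_compat].
move=> w S H l H0 Sc Hw wRb near [l0 ll] u P.
have SH : Cmod S <= H by nra.
have w0 : 0 <= Re w by nra.
have wp := Cmod_ge_0 w.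
have [u1 _] := Cmod_one_plus M w (Rlt_le _ _ M0) w0; rewrite -/u in u1.
have u0 : u <> RtoC 0 by apply/Cmod_gt_0; lra.
have l1 : l < m by have := Rmin_l m (eps * (m * m) / (4 * B)); lra.
have l2 : l < eps * (m * m) / (4 * B).
  by have := Rmin_r m (eps * (m * m) / (4 * B)); lra.
have Hu0 : 0 <= H / (Cmod u * Cmod u).
  by apply: Rmult_le_pos => //; apply: Rlt_le; apply: Rinv_0_lt_compat; nra.
have [wr|wr] := Rlt_or_le (Cmod w) r'.
  have wr0 : Cmod w < r0 by have := Rmin_l r (d / (2 * M)); rewrite -/r'; lra.
  have := shear_near M Cq d H w S (Rlt_le _ _ M0) CM w0 H0 SH.
  rewrite -/u -/P => /(_ _ (near wr0)) => PH.
  have {}PH : (1 - 2 * d) * (H / (Cmod u * Cmod u)) <= Re P by apply: PH; nra.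
  have P0 : 0 <= Re P by nra.
  split; first by apply: Re_ge_neq0; rewrite (_ : Re (P + l)%C = Re P + l) //; lra.
  rewrite Cmod_add_R_sqr.
  (* [4 l Re P <= |P + l|^2], from [(Re P - l)^2 + (Im P)^2 >= 0]. *)
  have : 4 * l * Re P <= Cmod P * Cmod P + 2 * l * Re P + l * l.
    have := Rle_0_sqr (Re P - l); have := Rle_0_sqr (Im P).
    by rewrite Cmod_sqr /Rsqr; lra.
  have : H / (Cmod u * Cmod u) - Re P <= eps * Re P.
    have H2 : H / (Cmod u * Cmod u) <= 2 * Re P by nra.
    have : 0 <= d * (2 * Re P - H / (Cmod u * Cmod u)) by apply: Rmult_le_pos; lra.
    have : 0 <= (eps - 4 * d) * Re P by apply: Rmult_le_pos; lra.
    lra.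
  move=> h2 h1.
  have h3 : 4 * l * (H / (Cmod u * Cmod u) - Re P) <= 4 * l * (eps * Re P).
    by apply: Rmult_le_compat_l; lra.
  have : eps * (4 * l * Re P) <= eps * (Cmod P * Cmod P + 2 * l * Re P + l * l).
    by apply: Rmult_le_compat_l; lra.
  lra.
have Rew := Re_le w.
have Hb : H <= Rb / c2.
  by apply: (Rmult_le_reg_l c2) => //; rewrite (_ : c2 * (Rb / c2) = Rb); [lra|field; lra].
have uM : Cmod u <= 1 + M * Rb.
  have := Cmod_triangle 1%C (M * w)%C; rewrite -/u Cmod_1 Cmod_mult Cmod_R Rabs_right; nra.
have sd : Cmod S <= (1 - d) * H by nra.
have nr : Cmod w < r -> (1 - d) * H + Re S - Cq * (Cmod w * Cmod w) <= Re w.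
  by move=> ?; apply: near; lra.
have := shear_lower_bound c2 Cq r d H M w S erefl c20 Cq0 rp Cr sd SH H0 Hw nr.
rewrite -/K -/k -/u => NL.
have Pm : 2 * m <= Cmod P.
  rewrite /P Cmod_div; last exact: Cmult_neq_0.
  rewrite Cmod_mult /m.
  have -> : 2 * (k * r' / ((1 + M * Rb) * (1 + M * Rb)) / 2) =
    (k * r') * / ((1 + M * Rb) * (1 + M * Rb)) by field; nra.
  apply: Rmult_le_compat; [nra| |nra|].
    by apply: Rlt_le; apply: Rinv_0_lt_compat; nra.
  by apply: Rinv_le_contravar; nra.
have Plm : m <= Cmod (P + l)%C.
  have := Cmod_sub_ge P (- l)%C; rewrite Cmod_opp Cmod_R Rabs_right; last by lra.
  by rewrite (_ : (P - - l = P + l)%C); [lra|cring].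
split; first by apply/Cmod_gt_0; lra.
have PB : Cmod P <= Rb + Rb / c2.
  have -> : P = (w / u - S / (u * u))%C by rewrite /P; field.
  apply: Rle_trans (Cmod_sub_le _ _) _.
  rewrite !Cmod_div ?Cmod_mult //; last exact: Cmult_neq_0.
  have i1 : / Cmod u <= 1 by rewrite -Rinv_1; apply: Rinv_le_contravar; lra.
  have i2 : / (Cmod u * Cmod u) <= 1 by rewrite -Rinv_1; apply: Rinv_le_contravar; nra.
  have := Cmod_ge_0 S; rewrite /Rdiv => S0.
  have : Cmod w * / Cmod u <= Cmod w * 1 by apply: Rmult_le_compat_l.
  have : Cmod S * / (Cmod u * Cmod u) <= Cmod S * 1 by apply: Rmult_le_compat_l.
  rewrite /Rdiv in Hb; lra.
have HuB : H / (Cmod u * Cmod u) <= Rb / c2.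
  have i2 : / (Cmod u * Cmod u) <= 1 by rewrite -Rinv_1; apply: Rinv_le_contravar; nra.
  by have : H * / (Cmod u * Cmod u) <= H * 1 by [apply: Rmult_le_compat_l]; rewrite /Rdiv in Hb *; lra.
have := Re_abs_le P => /Rabs_le_between [RP _].
apply: Rle_trans (_ : 4 * l * B <= _).
  by apply: Rmult_le_compat_l; rewrite /B; lra.
have B0 : 0 < B by rewrite /B; lra.
have : 4 * B * l <= 4 * B * (eps * (m * m) / (4 * B)) by apply: Rmult_le_compat_l; lra.
rewrite (_ : 4 * B * (eps * (m * m) / (4 * B)) = eps * (m * m)); last by field; lra.
have : m * m <= Cmod (P + l)%C * Cmod (P + l)%C by nra.
nra.
Qed.


(** Here [v0], [Sv], [Hv] describe a target point, and [a / g], [Hw] are the values of [w] and [H]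
    at its preimage in [cayley_surj]; the conclusion is the sufficient condition for that preimage
    to lie in the domain. Because [Re ((1 + v0) / t) = (1 - |v0|^2) / |t|^2] and the real parts of
    the [S] terms cancel to first order in [l], the inequality holds with margin at least
    [l * eps / 8] up to errors of order [l^2]. *)
Lemma lower_estimate (eps d M Cq r : R) :
  0 < eps <= 1 -> 0 <= d -> 2 * d <= eps -> 0 <= M -> 0 <= Cq -> 0 < r ->
  exists l0, 0 < l0 /\ forall (v0 Sv : Complex.C) (Hv l : R),
    0 <= Hv -> Cmod Sv <= Hv -> Cmod v0 * Cmod v0 + Hv <= (1 - eps) * (1 - eps) ->
    0 < l < l0 ->
    let t := (1 - v0)%C in
    let a := (l * ((1 + v0) / t + Sv / (t * t)))%C in
    let g := (1 - M * a)%C in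
    let Hw := l * Hv / (Cmod t * Cmod t * (Cmod g * Cmod g)) in
    [/\ t <> RtoC 0, g <> RtoC 0, Cmod (a / g)%C < r, Hw < r &
      (1 + d) * Hw + Re (l * (Sv / (t * t)) / (g * g))%C
        + Cq * (Cmod (a / g)%C * Cmod (a / g)%C) < Re (a / g)%C].
Proof.
move=> [eps0 eps1] d0 deps M0 Cq0 r0.
pose e1 := / eps.
have e10 : 0 < e1 by apply: Rinv_0_lt_compat.
have ee : eps * e1 = 1 by rewrite /e1; field; lra.
pose A0 := 2 * e1 + e1 * e1.
have A00 : 0 < A0 by rewrite /A0; nra.
have MA : 0 <= M * A0 by apply: Rmult_le_pos; lra.
(* The coefficient of [l^2] in the errors: the first summand comes from replacing [1 / g^2] by
   [1 / |g|^2] on [S], the second from [M |a|^2] and [Cq |a|^2]. *)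
pose X := 4 * M * A0 * (e1 * e1) + (M + Cq) * (A0 * A0).
have X0 : 0 <= X.
  by rewrite /X; apply: Rplus_le_le_0_compat; apply: Rmult_le_pos; nra.
(* In turn, these thresholds ensure [|g| >= 1/2], [|a / g| < r], [Hw < r], and that the error
   [l^2 X] stays below the margin. *)
pose la := / (2 * (M * A0) + 2); pose lb := r / (4 * A0).
pose lc := r / (8 * (e1 * e1)); pose ld := eps / (16 * (X + 1)).
have la0 : 0 < la by apply: Rinv_0_lt_compat; lra.
have lb0 : 0 < lb by apply: Rdiv_lt_0_compat; lra.
have lc0 : 0 < lc by apply: Rdiv_lt_0_compat; nra.
have ld0 : 0 < ld by apply: Rdiv_lt_0_compat; lra.
exists (Rmin (Rmin la lb) (Rmin lc ld)); split; first by do !apply: Rmin_glb_lt.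
move=> v0 Sv Hv l Hv0 SH vH [l0 ll] t a g Hw.
have [l1 l2] : l < la /\ l < lb.
  have := Rmin_l (Rmin la lb) (Rmin lc ld).
  by have := Rmin_l la lb; have := Rmin_r la lb; lra.
have [l3 l4] : l < lc /\ l < ld.
  have := Rmin_r (Rmin la lb) (Rmin lc ld).
  by have := Rmin_l lc ld; have := Rmin_r lc ld; lra.
have v00 := Cmod_ge_0 v0.
have v1 : Cmod v0 <= 1 - eps by nra.
have H1 : Hv <= 1 by nra.
have t1 : eps <= Cmod t by have := Cmod_sub_ge 1%C v0; rewrite Cmod_1 -/t; lra.
have t2 : Cmod t <= 2 by have := Cmod_sub_le 1%C v0; rewrite Cmod_1 -/t; lra.
have t0 : t <> RtoC 0 by apply/Cmod_gt_0; lra.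
have tt0 : (t * t)%C <> RtoC 0 by exact: Cmult_neq_0.
have it : / Cmod t <= e1 by apply: Rinv_le_contravar.
have it0 : 0 < / Cmod t by apply: Rinv_0_lt_compat; lra.
set s := (Sv / (t * t))%C in a g Hw *.
have Sv0 := Cmod_ge_0 Sv.
have s1 : Cmod s <= e1 * e1.
  rewrite /s Cmod_div // Cmod_mult /Rdiv Rinv_mult.
  have : / Cmod t * / Cmod t <= e1 * e1 by nra.
  have : 0 <= / Cmod t * / Cmod t by nra.
  nra.
set A := ((1 + v0) / t + s)%C in a g Hw *.
have A1 : Cmod A <= A0.
  apply: Rle_trans (Cmod_triangle _ _) _; rewrite Cmod_div // /Rdiv.
  have : Cmod (1 + v0)%C <= 2 by have := Cmod_triangle 1%C v0; rewrite Cmod_1; lra.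
  have := Cmod_ge_0 (1 + v0)%C; rewrite /A0 => ? ?.
  have : Cmod (1 + v0)%C * / Cmod t <= 2 * e1 by apply: Rmult_le_compat; lra.
  lra.
have a1 : Cmod a <= l * A0.
  by rewrite /a Cmod_mult Cmod_R Rabs_right; [apply: Rmult_le_compat_l; lra|lra].
have a0 := Cmod_ge_0 a.
have lMA : l * (M * A0) <= / 2.
  have h : (2 * (M * A0) + 2) * l < (2 * (M * A0) + 2) * la by apply: Rmult_lt_compat_l; lra.
  by rewrite (_ : (2 * (M * A0) + 2) * la = 1) in h; [lra|rewrite /la; field; lra].
have Ma : M * Cmod a <= l * (M * A0).
  by rewrite (_ : l * (M * A0) = M * (l * A0)); [apply: Rmult_le_compat_l|ring].
have g1 : / 2 <= Cmod g.
  have := Cmod_sub_ge 1%C (M * a)%C; rewrite Cmod_1 Cmod_mult Cmod_R -/g Rabs_right; last by lra.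
  lra.
have g0 : g <> RtoC 0 by apply/Cmod_gt_0; lra.
have gg0 : (g * g)%C <> RtoC 0 by exact: Cmult_neq_0.
have ig : / Cmod g <= 2.
  by rewrite -[2]Rinv_inv; apply: Rinv_le_contravar; lra.
have ig0 : 0 < / Cmod g by apply: Rinv_0_lt_compat; lra.
have ag : Cmod (a / g)%C = Cmod a * / Cmod g by rewrite Cmod_div.
have T0 : 0 < Cmod t * Cmod t by nra.
have T4 : Cmod t * Cmod t <= 4 by nra.
have G0 : 0 < Cmod g * Cmod g by nra.
split=> //.
- rewrite ag.
  have : Cmod a * / Cmod g <= l * A0 * 2 by apply: Rmult_le_compat; lra.
  have h : 4 * A0 * l < 4 * A0 * lb by apply: Rmult_lt_compat_l; lra.
  by rewrite (_ : 4 * A0 * lb = r) in h; [nra|rewrite /lb; field; lra].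
- have -> : Hw = l * (Hv * ((/ Cmod t * / Cmod t) * (/ Cmod g * / Cmod g))).
    by rewrite /Hw; field; split; lra.
  have h1 : / Cmod t * / Cmod t <= e1 * e1 by nra.
  have h2 : / Cmod g * / Cmod g <= 4 by nra.
  have h3 : (/ Cmod t * / Cmod t) * (/ Cmod g * / Cmod g) <= e1 * e1 * 4.
    by apply: Rmult_le_compat; nra.
  have h4 : Hv * ((/ Cmod t * / Cmod t) * (/ Cmod g * / Cmod g)) <= 1 * (e1 * e1 * 4).
    by apply: Rmult_le_compat => //; do !apply: Rmult_le_pos; lra.
  have h5 : l * (Hv * ((/ Cmod t * / Cmod t) * (/ Cmod g * / Cmod g))) <= l * (1 * (e1 * e1 * 4)).
    by apply: Rmult_le_compat_l; lra.
  have h : 8 * (e1 * e1) * l < 8 * (e1 * e1) * lc by apply: Rmult_lt_compat_l; nra.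
  by rewrite (_ : 8 * (e1 * e1) * lc = r) in h; [nra|rewrite /lc; field; lra].
apply: (Rmult_lt_reg_l (Cmod g * Cmod g)) => //.
rewrite (Re_div_mod g) // 2!Rmult_plus_distr_l (Re_div_sqr g) //.
have -> : Re (a * Cconj g)%C = Re a - M * (Cmod a * Cmod a).
  by rewrite Cmod_sqr /g; case: (a) => x y; rewrite /Re /Im /=; ring.
have -> : Cmod g * Cmod g * (Cq * (Cmod (a / g)%C * Cmod (a / g)%C)) =
    Cq * (Cmod a * Cmod a) by rewrite ag; field; lra.
have -> : Cmod g * Cmod g * ((1 + d) * Hw) = (1 + d) * (l * Hv / (Cmod t * Cmod t)).
  by rewrite /Hw; field; split; lra.
have -> : Re a = l * Re ((1 + v0) / t)%C + l * Re s.
  by rewrite /a /A; case: ((1 + v0) / t)%C => ? ?; case: (s) => ? ?; rewrite /Re /=; ring.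
have -> : Re ((1 + v0) / t)%C = (1 - Cmod v0 * Cmod v0) / (Cmod t * Cmod t).
  apply: (Rmult_eq_reg_l (Cmod t * Cmod t)); last by lra.
  rewrite Re_div_mod // (Cmod_sqr v0).
  have -> : Cmod t * Cmod t * ((1 - (Re v0 * Re v0 + Im v0 * Im v0)) / (Cmod t * Cmod t)) =
    1 - (Re v0 * Re v0 + Im v0 * Im v0) by field; lra.
  by rewrite /t; case: (v0) => x y; rewrite /Re /Im /=; ring.
have -> : Re (l * s * (Cconj g / g))%C = l * Re (s * (Cconj g / g))%C.
  by case: (Cconj g / g)%C => ? ?; case: (s) => ? ?; rewrite /Re /=; ring.
have := conj_quot g s g0 => /Rabs_le_between [_ cq].
have Ig : Rabs (Im g) <= M * Cmod a.
  have -> : Im g = - (M * Im a) by rewrite /g; case: (a) => x y; rewrite /Im /=; ring.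
  rewrite Rabs_Ropp Rabs_mult (Rabs_right M); last by lra.
  apply: Rmult_le_compat_l => //.
  have := Cmod_sqr a; have := Rabs_pos (Im a).
  by have := Rsqr_abs (Im a); rewrite /Rsqr; nra.
have Igl : 2 * Rabs (Im g) / Cmod g <= 4 * (l * (M * A0)).
  have Ig0 := Rabs_pos (Im g).
  have : 2 * Rabs (Im g) * / Cmod g <= (2 * (l * (M * A0))) * 2 by apply: Rmult_le_compat; lra.
  by rewrite /Rdiv; lra.
have cq2 : Cmod s * (2 * Rabs (Im g) / Cmod g) <= (e1 * e1) * (4 * (l * (M * A0))).
  apply: Rmult_le_compat => //; first exact: Cmod_ge_0.
  by apply: Rmult_le_pos; [have := Rabs_pos (Im g); lra|lra].
have lcq : l * Re (s * (Cconj g / g))%C <= l * (Re s + (e1 * e1) * (4 * (l * (M * A0)))).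
  by apply: Rmult_le_compat_l; lra.
have aa : (M + Cq) * (Cmod a * Cmod a) <= (M + Cq) * ((l * A0) * (l * A0)).
  by apply: Rmult_le_compat_l; [lra|apply: Rmult_le_compat].
have lX : l * (l * X) < l * (eps / 8).
  apply: Rmult_lt_compat_l => //.
  have h : 16 * (X + 1) * l < 16 * (X + 1) * ld by apply: Rmult_lt_compat_l; lra.
  by rewrite (_ : 16 * (X + 1) * ld = eps) in h; [nra|rewrite /ld; field; lra].
have main : l * (eps / 8) <= l * ((1 - Cmod v0 * Cmod v0) / (Cmod t * Cmod t)) -
    (1 + d) * (l * Hv / (Cmod t * Cmod t)).
  have -> : l * ((1 - Cmod v0 * Cmod v0) / (Cmod t * Cmod t)) -
    (1 + d) * (l * Hv / (Cmod t * Cmod t)) =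
    l * ((1 - Cmod v0 * Cmod v0 - (1 + d) * Hv) * / (Cmod t * Cmod t)) by field; lra.
  apply: Rmult_le_compat_l; first by lra.
  have iT : / 4 <= / (Cmod t * Cmod t) by apply: Rinv_le_contravar.
  have : eps / 2 * / 4 <= (1 - Cmod v0 * Cmod v0 - (1 + d) * Hv) * / (Cmod t * Cmod t).
    apply: Rmult_le_compat => //; first by lra.
      by lra.
    nra.
  lra.
move: lX aa lcq; rewrite /X => lX aa lcq.
nra.
Qed.

End Scalar.

(** * Second-order expansion of the defining function at nearby base points *)

Section Taylor.
Context {n : nat}.
Implicit Types (z w h p : Cn n) (k l : dir n) (U : Cn n -> Prop).

(** The gradient is taken at the moving point [p'] but the Hessian stays at [p]: continuity of the
    second partials makes this cost only [d |h|^2], with one radius [eta] for all [p']. *)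
Lemma C2_taylor U (rho : Cn n -> R) (Drho : dir n -> Cn n -> R)
    (D2 : dir n -> dir n -> Cn n -> R) p d :
  is_open U -> (forall z k, U z -> has_partial rho z k (Drho k z)) ->
  (forall k z l, U z -> has_partial (Drho k) z l (D2 k l z)) ->
  (forall k l, continuous_on U (D2 k l)) -> U p -> 0 < d ->
  exists eta, 0 < eta /\ forall p' h, vnorm (vsub p' p) < eta -> vnorm h < eta ->
    [/\ U p', U (vadd p' h) &
    Rabs (rho (vadd p' h) - rho p' - \big[Rplus/0]_(k : dir n) (Drho k p' * rcoord k h)
      - / 2 * \big[Rplus/0]_(k : dir n) \big[Rplus/0]_(l : dir n)
          (D2 k l p * rcoord k h * rcoord l h)) <= d * (vnorm h * vnorm h)].
Proof.
move=> Uo drho d2 c2 Up d0.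
pose N := INR #|{: dir n}| + 1.
have N0 : 1 <= N by have := pos_INR #|{: dir n}|; rewrite /N; lra.
have nN h : norm1 h <= N * vnorm h.
  by have := norm1_le h; have := vnorm_ge0 h; rewrite /N; nra.
have dN : 0 < d / (N * N) by apply: Rdiv_lt_0_compat; nra.
have cD k : continuous_on U (Drho k).
  by apply: C1_continuous => //; exists (D2 k); split=> // *; exact: d2.
have [r [r0 Ur]] := Uo p Up.
have [e [e0 De]] : exists e, 0 < e /\ forall kl : dir n * dir n, forall w, U w ->
    vnorm (vsub w p) < e -> Rabs (D2 kl.1 kl.2 w - D2 kl.1 kl.2 p) < d / (N * N).
  apply: finite_common_radius => [kl e e' e'e H w Uw wz|kl]; first by apply: H => //; lra.
  by have [e [e0 H]] := c2 kl.1 kl.2 p Up _ dN; exists e.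
have re : 0 < Rmin r e by apply: Rmin_glb_lt.
have rl := Rmin_l r e; have rr := Rmin_r r e.
(* Points used below lie within [|h| + norm1 h <= (1 + N) eta] of [p'], hence within [(2 + N) eta]
   of [p]. *)
pose eta := Rmin r e / (2 + N).
have eta0 : 0 < eta by apply: Rdiv_lt_0_compat; lra.
have etaN : (2 + N) * eta = Rmin r e by rewrite /eta; field; lra.
exists eta; split=> // p' h p'p hh.
have near y : vnorm (vsub y p') <= vnorm h + norm1 h ->
    U y /\ forall k l, Rabs (D2 k l y - D2 k l p) <= d / (N * N).
  move=> yp'; have := vnorm_sub_triangle p' y p => tri.
  have hN := nN h; have : N * vnorm h <= N * eta by apply: Rmult_le_compat_l; lra.
  move=> hN'; have yp : vnorm (vsub y p) < Rmin r e by rewrite -etaN; lra.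
  have Uy : U y by apply: Ur; lra.
  by split=> // k l; apply/Rlt_le/(De (k, l)) => //; lra.
have Uh h' : vnorm h' <= vnorm h -> U (vadd p' h').
  by move=> h'h; apply: (proj1 (near _ _)); rewrite vaddK; have := norm1_ge0 h; lra.
split; [|exact: Uh (Rle_refl _)|].
  rewrite -(vadd0 p') vaddC; apply: Uh; rewrite vnorm0; exact: vnorm_ge0.
set Q := \big[Rplus/0]_(k : dir n) _; set B := \big[Rplus/0]_(k : dir n) _.
(* The remainder is [psi 1 - psi 0]. The derivative of [psi] compares each [Drho k] along the
   segment with its linearization by the Hessian at [p], which is what [partial_increment]
   bounds. *)
pose psi t := rho (vadd p' (vscal t h)) - t * Q - t * t * (/ 2 * B).
pose dpsi t := \big[Rplus/0]_(k : dir n)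
  (Drho k (vadd p' (vscal t h)) * rcoord k h) - Q - t * B.
have th t : Rabs t <= Rabs 1 -> Rabs t * vnorm h <= vnorm h.
  by rewrite Rabs_R1; have := vnorm_ge0 h; have := Rabs_pos t; nra.
have := mvt_linear_bound psi dpsi 1 0 (d / (N * N) * (norm1 h * norm1 h)).
rewrite Rabs_R1 => mvt.
have -> : rho (vadd p' h) - rho p' - Q - / 2 * B = psi 1 - psi 0 - 0 * 1.
  rewrite /psi (_ : vscal 1 h = h); last by rewrite vscalE cscal1.
  rewrite (_ : vadd p' (vscal 0 h) = p'); last by rewrite vscalE cscal0 vaddC vadd0.
  ring.
apply: Rle_trans (mvt _ _) _.
- move=> t t1.
  have Ut : U (vadd p' (vscal t h)).
    by apply: Uh; rewrite vnorm_vscal; apply: th; rewrite Rabs_R1.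
  have dr := C1_line_derivative U rho Drho p' h t Uo (fun y k Uy => drho y k Uy) cD Ut.
  apply: derivable_pt_lim_minus; first apply: derivable_pt_lim_minus => //.
    rewrite -{2}(Rmult_1_l Q) -(Rplus_0_r (1 * Q)) -(Rmult_0_r t).
    apply: (derivable_pt_lim_mult (fun t => t) (fun=> Q)).
      exact: derivable_pt_lim_id.
    exact: derivable_pt_lim_const.
  have -> : t * B = (1 * t + t * 1) * (/ 2 * B) + (t * t) * 0 by field.
  apply: (derivable_pt_lim_mult (fun t => t * t) (fun=> / 2 * B)).
    apply: (derivable_pt_lim_mult (fun t => t) (fun t => t)); exact: derivable_pt_lim_id.
  exact: derivable_pt_lim_const.
- move=> t t1; rewrite Rminus_0_r /dpsi.
  have -> : \big[Rplus/0]_(k : dir n) (Drho k (vadd p' (vscal t h)) * rcoord k h) - Q - t * B =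
      \big[Rplus/0]_(k : dir n) ((Drho k (vadd p' (vscal t h)) - Drho k p' -
        \big[Rplus/0]_(l : dir n) (D2 k l p * rcoord l (vscal t h))) * rcoord k h).
    rewrite /Q /B rsum_mull.
    set X := \big[Rplus/0]_(k : dir n) _; set Y := \big[Rplus/0]_(k : dir n) _.
    set Z := \big[Rplus/0]_(k : dir n) _; set W := \big[Rplus/0]_(k : dir n) _.
    suff -> : X = W + (Y + Z) by ring.
    rewrite /X /W /Y /Z -!rsum_add; apply: eq_bigr => k _.
    have -> : t * \big[Rplus/0]_(l : dir n) (D2 k l p * rcoord k h * rcoord l h) =
      (\big[Rplus/0]_(l : dir n) (D2 k l p * rcoord l (vscal t h))) * rcoord k h.
      rewrite rsum_mull rsum_mulr; apply: eq_bigr => l _; rewrite rcoord_vscal; ring.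
    ring.
  apply: Rle_trans (rsum_abs _ _) _.
  have -> : d / (N * N) * (norm1 h * norm1 h) =
    \big[Rplus/0]_(k : dir n) ((d / (N * N) * norm1 h) * Rabs (rcoord k h)).
    by rewrite -rsum_mull -/(norm1 h); ring.
  apply: rsum_le => k; rewrite Rabs_mult; apply: Rmult_le_compat_r; first exact: Rabs_pos.
  have n1 : norm1 (vscal t h) <= norm1 h.
    by rewrite norm1_vscal; have := norm1_ge0 h; have := Rabs_pos t; nra.
  apply: Rle_trans (_ : d / (N * N) * norm1 (vscal t h) <= _); last first.
    by apply: Rmult_le_compat_l; lra.
  apply: (partial_increment U (Drho k) (D2 k)) => [y l Uy|y yp']; first exact: d2.
  have [] := near y; first by have := vnorm_ge0 h; lra.
  by move=> Uy Hy; split.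
rewrite Rmult_1_r; have hN := nN h; have n0 := norm1_ge0 h.
have -> : d * (vnorm h * vnorm h) = d / (N * N) * ((N * vnorm h) * (N * vnorm h)).
  by field; lra.
apply: Rmult_le_compat_l; [lra|nra].
Qed.

Definition real_quadratic (b : Cn n -> Cn n -> R) :=
  [/\ forall h g w, b (vadd h g) w = b h w + b g w,
      forall t h w, b (vscal t h) w = t * b h w,
      forall h w, b h w = b w h &
      exists K, 0 < K /\ forall h w, Rabs (b h w) <= K * (vnorm h * vnorm w)].

(** One [eta] serves every base point near [p], and [b] does not move with it; the later uniformity
    in [p'] rests on this order of quantifiers. *)
Definition second_order_expansion (U : Cn n -> Prop) (rho : Cn n -> R)
    (L : Cn n -> Cn n -> Complex.C) (b : Cn n -> Cn n -> R) p :=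
  forall d, 0 < d -> exists eta, 0 < eta /\ forall p', vnorm (vsub p' p) < eta ->
    [/\ U p', forall h, Cmod (L p' h - L p h)%C <= d * vnorm h &
      forall h, vnorm h < eta -> U (vadd p' h) /\
        Rabs (rho (vadd p' h) - rho p' + Re (L p' h) - b h h) <= d * (vnorm h * vnorm h)].

(* [L z] is minus the complex gradient, so that [Re (L z h)] is minus the real differential of the defining function. *)
Lemma C2_boundary_expansion (D : Cn n -> Prop) p : C2_boundary_near D p ->
  exists (U : Cn n -> Prop) (rho : Cn n -> R) (L : Cn n -> Cn n -> Complex.C)
    (b : Cn n -> Cn n -> R),
    is_open U /\ U p /\ (forall z, U z -> (D z <-> rho z < 0)) /\
    continuous_on U rho /\ (forall z, linear_form (L z)) /\
    (rho p = 0 -> exists j, L p (ebasis j) <> RtoC 0) /\ real_quadratic b /\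
    second_order_expansion U rho L b p.
Proof.
move=> [U [rho [Drho [Uo [Up [drho [C1D [Drho0 nz]]]]]]]].
have [D2 D2P] : exists D2 : dir n -> dir n -> Cn n -> R, forall k,
    (forall z l, U z -> has_partial (Drho k) z l (D2 k l z)) /\
    (forall l, continuous_on U (D2 k l)).
  by apply: (choice (fun k E => (forall z l, U z -> has_partial (Drho k) z l (E l z)) /\
    (forall l, continuous_on U (E l)))) => k; exact: C1D.
have cD k : continuous_on U (Drho k) by apply: C1_continuous => //; exact: C1D.
(* The sign of the imaginary part follows from [Re ((a + i b) (x + i y)) = a x - b y]. *)
pose c z i : Complex.C := (- Drho (i, true) z, Drho (i, false) z).
pose L z h := \big[Cplus/RtoC 0]_(i < n) Cmult (c z i) (h i).
have Llin z : linear_form (L z).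
  split=> [h w|a h]; rewrite /L.
    by rewrite -big_split; apply: eq_bigr => i _; rewrite vaddE /=; cring.
  rewrite (big_morph (Cmult a) (id1 := RtoC 0) (op1 := Cplus)); last 2 first.
  - by move=> x y; cring.
  - by cring.
  by apply: eq_bigr => i _; rewrite /cscal; cring.
have Lbasis z j : L z (ebasis j) = c z j.
  rewrite /L (bigD1 j) //= big1 => [|i ij]; first by rewrite ebasis_eq; cring.
  by rewrite /ebasis (negbTE ij); cring.
have ReL z h : Re (L z h) = - \big[Rplus/0]_(k : dir n) (Drho k z * rcoord k h).
  rewrite /L (big_morph Re (id1 := 0) (op1 := Rplus)) //.
  rewrite (eq_bigr (fun k => Drho (k.1, k.2) z * rcoord (k.1, k.2) h)); last by case.
  rewrite -(pair_bigA _ (fun i b => Drho (i, b) z * rcoord (i, b) h)) /=.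
  rewrite (big_morph Ropp (id1 := 0) (op1 := Rplus)); last 2 first.
  - by move=> x y; ring.
  - by ring.
  apply: eq_bigr => i _; rewrite big_bool /rcoord /= /c /Re /=; ring.
pose b0 h w := / 2 * \big[Rplus/0]_(k : dir n) \big[Rplus/0]_(l : dir n)
          (D2 k l p * rcoord k h * rcoord l w).
have b0Dl h g w : b0 (vadd h g) w = b0 h w + b0 g w.
  rewrite /b0 -Rmult_plus_distr_l -rsum_add; congr Rmult; apply: eq_bigr => k _.
  by rewrite -rsum_add; apply: eq_bigr => l _; rewrite rcoord_vadd; ring.
have b0Dr h g w : b0 w (vadd h g) = b0 w h + b0 w g.
  rewrite /b0 -Rmult_plus_distr_l -rsum_add; congr Rmult; apply: eq_bigr => k _.
  by rewrite -rsum_add; apply: eq_bigr => l _; rewrite rcoord_vadd; ring.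
have b0Zl t h w : b0 (vscal t h) w = t * b0 h w.
  rewrite /b0 -Rmult_assoc [t * _]Rmult_comm Rmult_assoc; congr Rmult; rewrite rsum_mull.
  apply: eq_bigr => k _; rewrite rsum_mull.
  by apply: eq_bigr => l _; rewrite rcoord_vscal; ring.
have b0Zr t h w : b0 w (vscal t h) = t * b0 w h.
  rewrite /b0 -Rmult_assoc [t * _]Rmult_comm Rmult_assoc; congr Rmult; rewrite rsum_mull.
  apply: eq_bigr => k _; rewrite rsum_mull.
  by apply: eq_bigr => l _; rewrite rcoord_vscal; ring.
(* Symmetrizing leaves the quadratic form unchanged and avoids proving that the mixed second
   partials agree. *)
pose b h w := / 2 * (b0 h w + b0 w h).
have bb h : b h h = b0 h h by rewrite /b; field.
have bq : real_quadratic b.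
  split=> [h g w|t h w|h w|].
  - by rewrite /b b0Dl b0Dr; ring.
  - by rewrite /b b0Zl b0Zr; ring.
  - by rewrite /b; ring.
  pose M := \big[Rplus/0]_(k : dir n) \big[Rplus/0]_(l : dir n) Rabs (D2 k l p).
  have M0 : 0 <= M.
    by apply: rsum_ge0 => k; apply: rsum_ge0 => l; exact: Rabs_pos.
  have b0M h w : Rabs (b0 h w) <= M * (vnorm h * vnorm w).
    have h0 := vnorm_ge0 h; have w0 := vnorm_ge0 w.
    have hw0 : 0 <= M * (vnorm h * vnorm w) by apply: Rmult_le_pos => //; exact: Rmult_le_pos.
    rewrite /b0 Rabs_mult (Rabs_right (/ 2)); last by lra.
    suff : Rabs (\big[Rplus/0]_(k : dir n) \big[Rplus/0]_(l : dir n)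
      (D2 k l p * rcoord k h * rcoord l w)) <= M * (vnorm h * vnorm w) by lra.
    apply: Rle_trans (rsum_abs _ _) _; rewrite /M rsum_mulr; apply: rsum_le => k.
    apply: Rle_trans (rsum_abs _ _) _; rewrite rsum_mulr; apply: rsum_le => l.
    rewrite !Rabs_mult Rmult_assoc; apply: Rmult_le_compat_l; first exact: Rabs_pos.
    by apply: Rmult_le_compat; rewrite ?rcoord_le //; try exact: Rabs_pos; exact: rcoord_le.
  exists (M + 1); split; first by lra.
  move=> h w; have h1 := b0M h w; have h2 := b0M w h.
  have := Rabs_triang (b0 h w) (b0 w h); rewrite /b Rabs_mult (Rabs_right (/ 2)); last by lra.
  have := vnorm_ge0 h; have := vnorm_ge0 w; nra.
exists U, rho, L, b; do 3 (split=> //); split.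
  by apply: C1_continuous => //; exists Drho; split=> // *; exact: drho.
split=> //; split.
  move=> /(nz _ Up) [[j s] Dj]; exists j; rewrite Lbasis /c => -[e1 e2].
  by case: s Dj => Dj; apply: Dj; lra.
split=> // d d0.
have [eta [eta0 T]] := C2_taylor U rho Drho D2 p d Uo drho
  (fun k => proj1 (D2P k)) (fun k => proj2 (D2P k)) Up d0.
pose N := 2 * INR n + 1.
have n0 := pos_INR n.
have dN : 0 < d / N by apply: Rdiv_lt_0_compat; rewrite /N; lra.
have [e [e0 De]] : exists e, 0 < e /\ forall k w, U w ->
    vnorm (vsub w p) < e -> Rabs (Drho k w - Drho k p) < d / N.
  apply: finite_common_radius => [k e e' e'e H w Uw wz|k]; first by apply: H => //; lra.
  by have [e [e0 H]] := cD k p Up _ dN; exists e.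
exists (Rmin eta e); split; first exact: Rmin_glb_lt.
move=> p' p'p.
have p1 := Rmin_l eta e; have p2 := Rmin_r eta e.
have [Up' _ _] := T p' (vzero n) ltac:(lra) ltac:(rewrite vnorm0; lra).
split=> // h; last first.
  move=> hh; have [_ Uh Th] := T p' h ltac:(lra) ltac:(lra); split=> //.
  by rewrite ReL bb /b0; apply: Rle_trans Th; right; congr Rabs; ring.
rewrite /L -(_ : \big[Cplus/RtoC 0]_(i < n) Cmult (c p' i - c p i)%C (h i) =
  (\big[Cplus/RtoC 0]_(i < n) Cmult (c p' i) (h i) -
   \big[Cplus/RtoC 0]_(i < n) Cmult (c p i) (h i))%C); last first.
  set X := \big[Cplus/RtoC 0]_(i < n) _; set Y := \big[Cplus/RtoC 0]_(i < n) _.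
  set Z := \big[Cplus/RtoC 0]_(i < n) _.
  suff -> : Y = Cplus X Z by cring.
  by rewrite /X /Y /Z -big_split; apply: eq_bigr => i _ /=; cring.
apply: Rle_trans (csum_mod _ _) _.
apply: Rle_trans (_ : \big[Rplus/0]_(i < n) (2 * (d / N) * vnorm h) <= _).
  apply: rsum_le => i; rewrite Cmod_mult.
  apply: Rmult_le_compat; try exact: Cmod_ge_0; last exact: Cmod_le_vnorm.
  have := De (i, true) p' Up' ltac:(lra); have := De (i, false) p' Up' ltac:(lra).
  rewrite (_ : (c p' i - c p i)%C = (RtoC (- (Drho (i, true) p' - Drho (i, true) p)) +
    Ci * RtoC (Drho (i, false) p' - Drho (i, false) p))%C); last first.
    by apply: injective_projections => /=; ring.
  move=> ? ?; apply: Rle_trans (Cmod_triangle _ _) _.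
  by rewrite Cmod_mult Cmod_Ci !Cmod_R Rabs_Ropp; lra.
rewrite rsum_const card_ord.
have -> : INR n * (2 * (d / N) * vnorm h) = (2 * INR n) * / N * (d * vnorm h).
  by rewrite /Rdiv; ring.
have : 0 <= d * vnorm h by apply: Rmult_le_pos; [lra|exact: vnorm_ge0].
have : 2 * INR n * / N <= 1.
  have N0 : 0 < N by rewrite /N; lra.
  apply: (Rmult_le_reg_r N) => //; rewrite Rmult_assoc Rinv_l; last by lra.
  by rewrite /N; lra.
nra.
Qed.

End Taylor.

(** * Boundary geometry *)

Section Geometry.
Context {n : nat}.
Implicit Types (z w h p e : Cn n) (D U : Cn n -> Prop) (b : Cn n -> Cn n -> R).

Lemma boundary_value D U (rho : Cn n -> R) p : boundary_pt D p -> is_open U -> U p ->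
  (forall z, U z -> (D z <-> rho z < 0)) -> continuous_on U rho -> rho p = 0.
Proof.
move=> [cl nD] Uo Up Drho crho.
have r0 : 0 <= rho p by case: (Rle_or_lt 0 (rho p)) => // /(Drho p Up).
have [rp|] := Rle_lt_or_eq_dec _ _ r0; last by [].
have [r [rpos Ur]] := Uo p Up; have [d [d0 H]] := crho p Up _ rp.
have [z [Dz zp]] := cl (Rmin r d) (Rmin_glb_lt _ _ _ rpos d0).
have Uz : U z by apply: Ur; have := Rmin_l r d; lra.
have := H z Uz ltac:(have := Rmin_r r d; lra).
by have := proj1 (Drho z Uz) Dz => zn /Rabs_def2; lra.
Qed.

Definition rdot (m h : Cn n) : R :=
  \big[Rplus/0]_(i < n) (fst (h i) * fst (m i) + snd (h i) * snd (m i)).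

Lemma rdotD m h w : rdot m (vadd h w) = rdot m h + rdot m w.
Proof. by rewrite /rdot -rsum_add; apply: eq_bigr => i _ /=; ring. Qed.

Lemma rdotZ m t h : rdot m (vscal t h) = t * rdot m h.
Proof. by rewrite /rdot rsum_mull; apply: eq_bigr => i _ /=; ring. Qed.

Lemma vnorm_sub_sqr h m : vnorm (vsub h m) * vnorm (vsub h m) =
  vnorm h * vnorm h - 2 * rdot m h + vnorm m * vnorm m.
Proof.
rewrite !vnorm_sq.
have -> : forall x y u : R, x - 2 * y + u = x + ((- 2) * y + u) by move=> *; ring.
rewrite /rdot rsum_mull -!rsum_add; apply: eq_bigr => i _.
by rewrite !Cmod_sqr /Re /Im /=; ring.
Qed.

Lemma ReL_vadd (L : Cn n -> Complex.C) h w : linear_form L ->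
  Re (L (vadd h w)) = Re (L h) + Re (L w).
Proof. by case=> LD _; rewrite LD. Qed.

Lemma ReL_vscal (L : Cn n -> Complex.C) t h : linear_form L ->
  Re (L (vscal t h)) = t * Re (L h).
Proof. by case=> _ LZ; rewrite vscalE LZ; case: (L h) => x y; rewrite /Re /=; ring. Qed.

Lemma second_order_upper (U : Cn n -> Prop) rho L b p d :
  second_order_expansion U rho L b p -> rho p = 0 -> 0 < d ->
  exists eta, 0 < eta /\ forall h, vnorm h < eta -> U (vadd p h) /\
    rho (vadd p h) <= - Re (L p h) + b h h + d * (vnorm h * vnorm h).
Proof.
move=> exp rp d0; have [eta [eta0 H]] := exp d d0; exists eta; split=> // h hh.
have [_ _ /(_ h hh) [Uh]] := H p ltac:(rewrite vsub_self vnorm0; lra).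
by move=> /Rabs_le_between; split=> //; lra.
Qed.

(** * Comparison of the domain with the enclosing ball *)

Section Outer.
Variables (D U : Cn n -> Prop) (rho : Cn n -> R) (L : Cn n -> Cn n -> Complex.C)
  (b : Cn n -> Cn n -> R) (p e : Cn n).
Hypothesis Drho : forall z, U z -> (D z <-> rho z < 0).
Hypothesis Llin : forall z, linear_form (L z).
Hypothesis bq : real_quadratic b.
Hypothesis expn : second_order_expansion U rho L b p.
Hypothesis rhop : rho p = 0.
Hypothesis Le : L p e = RtoC 1.

Lemma quadratic_bound : exists K, 0 < K /\ forall h w, Rabs (b h w) <= K * (vnorm h * vnorm w).
Proof. by case: bq. Qed.

Lemma b_vadd_sqr h w : b (vadd h w) (vadd h w) = b h h + 2 * b h w + b w w.
Proof.
have [bD _ bC _] := bq.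
by rewrite bD (bC h (vadd h w)) (bC w (vadd h w)) !bD (bC w h); ring.
Qed.

Lemma b_vscal_sqr t h : b (vscal t h) (vscal t h) = t * t * b h h.
Proof. by have [_ bZ bC _] := bq; rewrite bZ bC bZ; ring. Qed.

Lemma b_vscalr t h w : b w (vscal t h) = t * b w h.
Proof. by have [_ bZ bC _] := bq; rewrite bC bZ bC. Qed.

Lemma inward_direction h : 0 < Re (L p h) ->
  exists t0, 0 < t0 /\ forall t, 0 < t < t0 -> D (vadd p (vscal t h)).
Proof.
move=> Lh; have [K [K0 bK]] := quadratic_bound.
have [eta [eta0 up]] := second_order_upper _ _ _ _ _ 1 expn rhop Rlt_0_1.
pose X := (K + 1) * (vnorm h * vnorm h) + 1.
have h0 := vnorm_ge0 h.
have X0 : 0 < X by rewrite /X; nra.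
exists (Rmin (eta / (vnorm h + 1)) (Re (L p h) / X)); split.
  by apply: Rmin_glb_lt; apply: Rdiv_lt_0_compat; lra.
move=> t [t0 tt].
have t1 : t < eta / (vnorm h + 1) by apply: Rlt_le_trans tt (Rmin_l _ _).
have t2 : t < Re (L p h) / X by apply: Rlt_le_trans tt (Rmin_r _ _).
have t1' : t * (vnorm h + 1) < eta.
  have : t * (vnorm h + 1) < eta / (vnorm h + 1) * (vnorm h + 1).
    by apply: Rmult_lt_compat_r; lra.
  by rewrite (_ : eta / (vnorm h + 1) * (vnorm h + 1) = eta); last by field; lra.
have t2' : t * X < Re (L p h).
  have : t * X < Re (L p h) / X * X by apply: Rmult_lt_compat_r; lra.
  by rewrite (_ : Re (L p h) / X * X = Re (L p h)); last by field; lra.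
have [|Uh] := up (vscal t h); first by rewrite vnorm_vscal Rabs_right; nra.
rewrite ReL_vscal // b_vscal_sqr vnorm_vscal Rabs_right; last by lra.
have := bK h h => /Rabs_le_between [_ bh] ub.
apply/(Drho _ Uh); apply: Rle_lt_trans ub _.
have : t * t * b h h <= t * t * (K * (vnorm h * vnorm h)) by apply: Rmult_le_compat_l; nra.
have : t * (t * X) < t * Re (L p h) by apply: Rmult_lt_compat_l.
rewrite /X; nra.
Qed.

(* The inward half-spaces of [D] and of the ball coincide, so the two real differentials are positively proportional. *)
Lemma outer_at_center (c : Cn n) (Rad : R) :
  (forall z, D z -> ball c Rad z) -> vnorm (vsub p c) = Rad ->
  exists c0, 0 < c0 /\ forall z, D z ->
    c0 * (vnorm (vsub z p) * vnorm (vsub z p)) <= Re (L p (vsub z p)).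
Proof.
move=> Dball pc; pose m := vsub c p.
have mR : vnorm m = Rad by rewrite -pc vnorm_subC.
have inball h : D (vadd p h) -> vnorm h * vnorm h < 2 * rdot m h.
  move=> /Dball; rewrite /ball.
  have -> : vsub (vadd p h) c = vsub h m.
    by rewrite /m; apply: functional_extensionality => i; rewrite !vsubE vaddE; cring.
  move=> hm; have := vnorm_sub_sqr h m; rewrite mR.
  have := vnorm_ge0 (vsub h m); nra.
have pos h : 0 < Re (L p h) -> 0 < rdot m h.
  move=> /inward_direction [t0 [t00 Dt]].
  have := inball _ (Dt (t0 / 2) ltac:(lra)); rewrite rdotZ.
  have := vnorm_ge0 (vscal (t0 / 2) h); nra.
have Le1 : Re (L p e) = 1 by rewrite Le.
have kap : 0 < rdot m e by apply: pos; lra.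
have prop h : rdot m h = Re (L p h) * rdot m e.
  (* Adding a multiple of [e] to [h'] makes [Re (L p)] equal to [t > 0], so [pos] applies. Used for
     [h] and [-h] with [t] tuned to [|x|], it gives [|x| + x > 0] and [|x| - x > 0], which is
     impossible unless [x = 0]. *)
  have half h' t : 0 < t -> 0 < rdot m h' - Re (L p h') * rdot m e + t * rdot m e.
    move=> t0; have := pos (vadd h' (vscal (t - Re (L p h')) e)).
    by rewrite ReL_vadd // ReL_vscal // rdotD rdotZ Le1 => /(_ ltac:(lra)); lra.
  set x := rdot m h - Re (L p h) * rdot m e.
  suff : x = 0 by rewrite /x; lra.
  apply: NNPP => x0; have ax := Rabs_pos_lt _ x0.
  have tp : 0 < Rabs x / rdot m e by apply: Rdiv_lt_0_compat.
  have te : Rabs x / rdot m e * rdot m e = Rabs x by field; lra.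
  have := half h _ tp; have := half (vscal (- 1) h) _ tp.
  rewrite rdotZ ReL_vscal // te => h1 h2.
  have [x1 x2] : 0 < - x + Rabs x /\ 0 < x + Rabs x by rewrite {1 3}/x; lra.
  by move: x1 x2; rewrite /Rabs; case: Rcase_abs; lra.
exists (/ (2 * rdot m e)); split; first by apply: Rinv_0_lt_compat; lra.
move=> z Dz; have := inball (vsub z p); rewrite vsubK => /(_ Dz); rewrite prop => lt.
apply: (Rmult_le_reg_l (2 * rdot m e)); first by lra.
by rewrite -Rmult_assoc Rinv_r; lra.
Qed.

(** * Curvature bounds inherited from the ball *)

Section Curvature.
Variables (c0 : R).
Hypothesis c00 : 0 < c0.
Hypothesis outer : forall z, D z ->
    c0 * (vnorm (vsub z p) * vnorm (vsub z p)) <= Re (L p (vsub z p)).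

(** Otherwise choose [s] strictly between [b h h] and [c0 |h|^2]. The points [p + t h + t^2 s e] lie
    in [D] for small [t], since there [rho] is about [t^2 (b h h - s) < 0]; but their value of
    [Re (L p)] is [t^2 s], too small for [outer]. *)
Lemma tangential_positive h : Re (L p h) = 0 -> c0 * (vnorm h * vnorm h) <= b h h.
Proof.
move=> Lh; case: (Rle_or_lt (c0 * (vnorm h * vnorm h)) (b h h)) => // lt.
have [K [K0 bK]] := quadratic_bound.
have h0 := vnorm_ge0 h; have e0 := vnorm_ge0 e.
pose s := (b h h + c0 * (vnorm h * vnorm h)) / 2.
pose g := (c0 * (vnorm h * vnorm h) - b h h) / 2.
have g0 : 0 < g by rewrite /g; lra.
have sa := Rabs_pos s.
(* For [x = t h + t^2 s e] and [0 < t <= 1]: [|x| <= t X], [b x x <= t^2 (b h h + t Y)] and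
   [c0 |x|^2 >= t^2 (c0 |h|^2 - t Z)]. The choices of [d] and [t] keep the total of these errors
   below the gap [g]. *)
pose X := vnorm h + Rabs s * vnorm e.
have X0 : 0 <= X by rewrite /X; nra.
pose Y := 2 * Rabs s * (K * (vnorm h * vnorm e)) + s * s * (K * (vnorm e * vnorm e)).
have Y0 : 0 <= Y.
  by rewrite /Y; nonneg.
pose Z := 2 * c0 * (vnorm h * (Rabs s * vnorm e)).
have Z0 : 0 <= Z by rewrite /Z; nonneg.
pose d := g / (4 * (X * X + 1)).
have d0 : 0 < d by apply: Rdiv_lt_0_compat; nra.
have dX : d * (X * X) <= g / 4.
  have -> : g / 4 = d * (X * X + 1) by rewrite /d; field; nra.
  by apply: Rmult_le_compat_l; lra.
have [eta [eta0 up]] := second_order_upper _ _ _ _ _ d expn rhop d0.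
pose t := Rmin (Rmin 1 (eta / (2 * (X + 1)))) (g / (4 * (Y + Z + 1))).
have ta := Rmin_l (Rmin 1 (eta / (2 * (X + 1)))) (g / (4 * (Y + Z + 1))).
have tb := Rmin_r (Rmin 1 (eta / (2 * (X + 1)))) (g / (4 * (Y + Z + 1))).
rewrite -/t in ta tb.
have t1 : t <= 1 by have := Rmin_l 1 (eta / (2 * (X + 1))); lra.
have t2 : t <= eta / (2 * (X + 1)).
  by have := Rmin_r 1 (eta / (2 * (X + 1))); lra.
have t0 : 0 < t.
  by apply: Rmin_glb_lt; [apply: Rmin_glb_lt; [lra|]|]; apply: Rdiv_lt_0_compat; lra.
have tX : t * X < eta.
  have : t * (2 * (X + 1)) <= eta / (2 * (X + 1)) * (2 * (X + 1)).
    by apply: Rmult_le_compat_r; lra.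
  by rewrite (_ : eta / (2 * (X + 1)) * (2 * (X + 1)) = eta); [nra|field; lra].
have tYZ : t * (Y + Z) <= g / 4.
  have : t * (4 * (Y + Z + 1)) <= g / (4 * (Y + Z + 1)) * (4 * (Y + Z + 1)).
    by apply: Rmult_le_compat_r; lra.
  by rewrite (_ : g / (4 * (Y + Z + 1)) * (4 * (Y + Z + 1)) = g); [nra|field; lra].
pose x := vadd (vscal t h) (vscal (t * t * s) e).
have tts : Rabs (t * t * s) = t * t * Rabs s by rewrite Rabs_mult Rabs_right; nra.
have tt : t * t <= t by nra.
have xX : vnorm x <= t * X.
  apply: Rle_trans (vnorm_triangle _ _) _; rewrite !vnorm_vscal tts Rabs_right; last by lra.
  have : t * t * (Rabs s * vnorm e) <= t * (Rabs s * vnorm e) by apply: Rmult_le_compat_r; nra.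
  by rewrite /X; nra.
have Lx : Re (L p x) = t * t * s by rewrite ReL_vadd // !ReL_vscal // Lh Le /=; ring.
have [|Ux] := up x; first by lra.
rewrite Lx b_vadd_sqr !b_vscal_sqr b_vscalr (_ : b (vscal t h) e = t * b h e); last by case: bq.
move=> ub.
have bhe := bK h e; have /Rabs_le_between [_ bee] := bK e e.
have sbe : s * b h e <= Rabs s * (K * (vnorm h * vnorm e)).
  apply: Rle_trans (Rle_abs _) _; rewrite Rabs_mult; exact: Rmult_le_compat_l.
have ssee : s * s * b e e <= s * s * (K * (vnorm e * vnorm e)).
  by apply: Rmult_le_compat_l; nra.
have xx : vnorm x * vnorm x <= t * t * (X * X).
  by have := vnorm_ge0 x; nra.
have Dx : D (vadd p x).
  apply/(Drho _ Ux); apply: Rle_lt_trans ub _.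
  have h1 : d * (vnorm x * vnorm x) <= t * t * (d * (X * X)).
    by have -> : t * t * (d * (X * X)) = d * (t * t * (X * X)) by [ring]; apply: Rmult_le_compat_l; lra.
  have h2 : 2 * (t * t * s * (t * b h e)) + t * t * s * (t * t * s) * b e e <= t * t * (t * Y).
    have -> : 2 * (t * t * s * (t * b h e)) + t * t * s * (t * t * s) * b e e =
      t * t * (t * (2 * (s * b h e) + t * (s * s * b e e))) by ring.
    apply: Rmult_le_compat_l; first by nra.
    apply: Rmult_le_compat_l; first by lra.
    have see0 : 0 <= s * s * (K * (vnorm e * vnorm e)).
      by nonneg.
    have : t * (s * s * b e e) <= t * (s * s * (K * (vnorm e * vnorm e))).
      by apply: Rmult_le_compat_l; lra.
    by rewrite /Y; nra.
  have h3 : t * t * (d * (X * X) + t * Y) <= t * t * (g / 2).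
    by apply: Rmult_le_compat_l; [nra|have : 0 <= t * Z by [nra]; nra].
  have h4 : s - b h h = g by rewrite /s /g; field.
  have h5 : 0 < t * t * g by apply: Rmult_lt_0_compat => //; nra.
  nra.
have := outer _ Dx; rewrite vaddK Lx => out.
have xl : t * vnorm h - t * t * (Rabs s * vnorm e) <= vnorm x.
  have := vnorm_triangle x (vscal (- 1) (vscal (t * t * s) e)).
  have -> : vadd x (vscal (-1) (vscal (t * t * s) e)) = vscal t h.
    rewrite /x -vaddA !vscalE cscalA -cscalDl -RtoC_mult -RtoC_plus.
    by rewrite (_ : t * t * s + -1 * (t * t * s) = 0); [rewrite cscal0 vaddC vadd0|ring].
  by rewrite !vnorm_vscal tts Rabs_right ?(Rabs_left (-1)); lra.
have out2 : c0 * (t * t * (vnorm h * vnorm h) - 2 * (t * vnorm h) * (t * t * (Rabs s * vnorm e))) <= t * t * s.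
  apply: Rle_trans out; apply: Rmult_le_compat_l; first by lra.
  have q0 : 0 <= t * t * (Rabs s * vnorm e) by nonneg.
  have th0 : 0 <= t * vnorm h by nra.
  have := vnorm_ge0 x.
  by case: (Rle_or_lt 0 (t * vnorm h - t * t * (Rabs s * vnorm e))) => ?; nra.
have out3 : t * t * (c0 * (vnorm h * vnorm h) - t * Z) <= t * t * s.
  by apply: Rle_trans out2; right; rewrite /Z; ring.
have {}out3 := Rmult_le_reg_l (t * t) _ _ ltac:(nra) out3.
have : t * Z <= g / 4 by have : 0 <= t * Y by [nra]; nra.
move: out3; rewrite /s /g; lra.
Qed.

(** Split [h = h' + y e] with [y = Re (L p h)], so that [tangential_positive] applies to [h']; every
    other term carries a factor [|y|]. *)
Lemma quadratic_lower : exists Y, 0 < Y /\ forall h,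
  c0 * (vnorm h * vnorm h) - Y * (Rabs (Re (L p h)) * vnorm h) <= b h h.
Proof.
have [K [K0 bK]] := quadratic_bound.
have [B [B0 LB]] := linear_form_bound (L p) (Llin p).
have e0 := vnorm_ge0 e.
exists (2 * (K * vnorm e) + B * (K * (vnorm e * vnorm e)) + 2 * c0 * vnorm e + 1); split.
  have : 0 <= B * (K * (vnorm e * vnorm e)) by nonneg.
  nra.
move=> h; have h0 := vnorm_ge0 h; set y := Re (L p h).
have yB : Rabs y <= B * vnorm h by apply: Rle_trans (Re_abs_le _) (LB h).
have y0 := Rabs_pos y.
pose h' := vadd h (vscal (- y) e).
have Lh' : Re (L p h') = 0 by rewrite ReL_vadd // ReL_vscal // Le /= -/y; ring.
have := tangential_positive h' Lh'; rewrite b_vadd_sqr b_vscal_sqr b_vscalr => pos.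
have hl : vnorm h - Rabs y * vnorm e <= vnorm h'.
  have := vnorm_triangle h' (vscal y e).
  have -> : vadd h' (vscal y e) = h.
    rewrite /h' -vaddA !vscalE -cscalDl -RtoC_plus.
    by rewrite (_ : - y + y = 0); [rewrite cscal0 vaddC vadd0|ring].
  by rewrite vnorm_vscal; lra.
have hh : vnorm h * vnorm h - 2 * (vnorm h * (Rabs y * vnorm e)) <= vnorm h' * vnorm h'.
  have q0 : 0 <= Rabs y * vnorm e by apply: Rmult_le_pos.
  have := vnorm_ge0 h'.
  by case: (Rle_or_lt 0 (vnorm h - Rabs y * vnorm e)) => ?; nra.
have chh : c0 * (vnorm h * vnorm h - 2 * (vnorm h * (Rabs y * vnorm e))) <= c0 * (vnorm h' * vnorm h').
  by apply: Rmult_le_compat_l; lra.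
have q1 : y * b h e <= Rabs y * (K * (vnorm h * vnorm e)).
  apply: Rle_trans (Rle_abs _) _; rewrite Rabs_mult; exact: Rmult_le_compat_l.
have /Rabs_le_between [q2 q2'] := bK e e; have /Rabs_le_between [q3 q3'] := bK h e.
have q1' : - (Rabs y * (K * (vnorm h * vnorm e))) <= y * b h e.
  have : - (y * b h e) <= Rabs (y * b h e) by rewrite -Rabs_Ropp; exact: Rle_abs.
  rewrite Rabs_mult => h1.
  have : Rabs y * Rabs (b h e) <= Rabs y * (K * (vnorm h * vnorm e)) by exact: Rmult_le_compat_l.
  lra.
have yy : y * y = Rabs y * Rabs y by have := Rsqr_abs y; rewrite /Rsqr.
have q4 : y * y * b e e <= Rabs y * (B * vnorm h) * (K * (vnorm e * vnorm e)).
  apply: Rle_trans (_ : y * y * (K * (vnorm e * vnorm e)) <= _).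
    by apply: Rmult_le_compat_l; nra.
  apply: Rmult_le_compat_r; first by nonneg.
  by rewrite yy; apply: Rmult_le_compat_l.
have : 0 <= Rabs y * vnorm h by apply: Rmult_le_pos.
nra.
Qed.

(** For [|h| < eta], [rho < 0] and the expansion at [p'] give [c0 / 2 |h|^2 <= x + |x| / 2] with
    [x = Re (L p' h)]. This excludes [x < 0] and yields [x >= c0 / 3 |h|^2]. For larger [h] the
    inequality at [p] has room to spare and is perturbed. *)
Lemma outer_uniform (c : Cn n) (Rad : R) :
  (forall z, D z -> ball c Rad z) -> vnorm (vsub p c) = Rad ->
  exists c1 eta, 0 < c1 /\ 0 < eta /\ forall p', vnorm (vsub p' p) < eta -> rho p' = 0 ->
    forall z, D z -> c1 * (vnorm (vsub z p') * vnorm (vsub z p')) <= Re (L p' (vsub z p')).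
Proof.
move=> Dball pc; have [Y [Y0 bY]] := quadratic_lower.
have [B [B0 LB]] := linear_form_bound (L p) (Llin p).
pose d := c0 / (2 * (1 + Y)).
have d0 : 0 < d by apply: Rdiv_lt_0_compat; lra.
have dY : d * (1 + Y) = c0 / 2 by rewrite /d; field; lra.
have [eta1 [eta10 exp1]] := expn d d0.
pose eta := Rmin eta1 (/ (2 * Y)).
have eta0 : 0 < eta by apply: Rmin_glb_lt => //; apply: Rinv_0_lt_compat; lra.
have etaY : Y * eta <= / 2.
  have : Y * eta <= Y * / (2 * Y) by apply: Rmult_le_compat_l; [lra|exact: Rmin_r].
  by rewrite (_ : Y * / (2 * Y) = / 2); last by field; lra.
have eta1l : eta <= eta1 by exact: Rmin_l.
have R0 : 0 <= Rad by rewrite -pc; exact: vnorm_ge0.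
pose R' := 2 * Rad + 1.
pose m := c0 * (eta * eta) / 16.
have m0 : 0 < m by rewrite /m; apply: Rdiv_lt_0_compat; [apply: Rmult_lt_0_compat => //; nra|lra].
have mR : 0 < m / R' by apply: Rdiv_lt_0_compat; rewrite /R'; lra.
have [eta2 [eta20 exp2]] := expn (m / R') mR.
pose eta' := Rmin (Rmin eta2 eta1) (Rmin (Rmin 1 (eta / 2)) (m / B)).
have eta'0 : 0 < eta'.
  by do !apply: Rmin_glb_lt => //; try lra; apply: Rdiv_lt_0_compat.
(* The second entry is for [|h| >= eta]: there [Re (L p)] is at least [4 m] at [z - p]. Moving the
   base point and replacing [L p] by [L p'] cost at most [m] each, and [|h| <= R']. *)
pose c1 := Rmin (c0 / 3) (2 * m / (R' * R')).
exists c1, eta'; split.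
  by apply: Rmin_glb_lt; [lra|apply: Rdiv_lt_0_compat; rewrite /R'; nra].
split=> // p' p'p rp' z Dz.
have [e1 e2] : eta' <= eta2 /\ eta' <= eta1.
  have := Rmin_l (Rmin eta2 eta1) (Rmin (Rmin 1 (eta / 2)) (m / B)); rewrite -/eta'.
  by have := Rmin_l eta2 eta1; have := Rmin_r eta2 eta1; lra.
have [e3 e4 e5] : [/\ eta' <= 1, eta' <= eta / 2 & eta' <= m / B].
  have := Rmin_r (Rmin eta2 eta1) (Rmin (Rmin 1 (eta / 2)) (m / B)); rewrite -/eta'.
  have := Rmin_l (Rmin 1 (eta / 2)) (m / B); have := Rmin_r (Rmin 1 (eta / 2)) (m / B).
  by have := Rmin_l 1 (eta / 2); have := Rmin_r 1 (eta / 2); split; lra.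
set h := vsub z p'; have h0 := vnorm_ge0 h.
have hh0 : 0 <= vnorm h * vnorm h by nra.
have c1l : c1 <= c0 / 3 by exact: Rmin_l.
have c1r : c1 <= 2 * m / (R' * R') by exact: Rmin_r.
have [Up' dL1 near1] := exp1 p' ltac:(lra).
have [_ dL2 _] := exp2 p' ltac:(lra).
have zh : vadd p' h = z by exact: vsubK.
have Ldiff x : Rabs (Re (L p' x) - Re (L p x)) <= Cmod (L p' x - L p x)%C.
  by apply: Rle_trans (Re_abs_le _); right.
case: (Rlt_or_le (vnorm h) eta) => hh.
  have [Uz] := near1 h ltac:(lra); rewrite zh in Uz *.
  have := proj1 (Drho _ Uz) Dz; rewrite rp' => rz /Rabs_le_between [ub _].
  have := bY h; set x := Re (L p' h) in ub *; set y := Re (L p h) => lb.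
  have := Ldiff h; rewrite -/x -/y => xy.
  have dh := dL1 h.
  have ay : Rabs y <= Rabs x + d * vnorm h.
    have := Rabs_triang x (- (x - y)); rewrite Rabs_Ropp.
    by rewrite (_ : x + - (x - y) = y); [lra|ring].
  have : Y * (Rabs y * vnorm h) <= Y * ((Rabs x + d * vnorm h) * vnorm h).
    by apply: Rmult_le_compat_l; [lra|apply: Rmult_le_compat_r].
  have xY : Rabs x * (Y * vnorm h) <= Rabs x * / 2.
    apply: Rmult_le_compat_l; first exact: Rabs_pos.
    have : Y * vnorm h <= Y * eta by apply: Rmult_le_compat_l; lra.
    lra.
  move=> yY.
  have key : c0 / 2 * (vnorm h * vnorm h) <= x + Rabs x / 2.
    have : d * (1 + Y) * (vnorm h * vnorm h) = c0 / 2 * (vnorm h * vnorm h) by rewrite dY.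
    lra.
  have : c1 * (vnorm h * vnorm h) <= c0 / 3 * (vnorm h * vnorm h) by exact: Rmult_le_compat_r.
  have : 0 <= c0 / 2 * (vnorm h * vnorm h) by apply: Rmult_le_pos; lra.
  by move: key; rewrite /Rabs; case: Rcase_abs; lra.
set h1 := vsub z p.
have zc := Dball z Dz; rewrite /ball in zc.
have h1R : vnorm h1 <= 2 * Rad.
  by have := vnorm_sub_triangle c z p; rewrite -/h1 (vnorm_subC c p) pc; lra.
have hh1 : h = vsub h1 (vsub p' p).
  by rewrite /h /h1; apply: functional_extensionality => i; rewrite !vsubE; cring.
have hR : vnorm h <= R'.
  by have := vnorm_sub_triangle p z p'; rewrite -/h -/h1 (vnorm_subC p p') /R'; lra.
have h1l : eta / 2 <= vnorm h1.
  by have := vnorm_sub_triangle p z p'; rewrite -/h -/h1 (vnorm_subC p p'); lra.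
have out := outer z Dz; rewrite -/h1 in out.
have : c0 * (eta / 2 * (eta / 2)) <= c0 * (vnorm h1 * vnorm h1).
  by apply: Rmult_le_compat_l; [lra|apply: Rmult_le_compat; lra].
rewrite (_ : c0 * (eta / 2 * (eta / 2)) = 4 * m); last by rewrite /m; field.
have Lh : Re (L p h) = Re (L p h1) - Re (L p (vsub p' p)).
  by rewrite hh1 linear_formB.
have Lpp : Re (L p (vsub p' p)) <= m.
  apply: Rle_trans (Re_le _) _; apply: Rle_trans (LB _) _.
  have : B * vnorm (vsub p' p) <= B * (m / B) by apply: Rmult_le_compat_l; lra.
  by rewrite (_ : B * (m / B) = m); last by field; lra.
have dm : m / R' * vnorm h <= m.
  have : m / R' * vnorm h <= m / R' * R' by apply: Rmult_le_compat_l; lra.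
  by rewrite (_ : m / R' * R' = m); last by field; rewrite /R'; lra.
have /Rabs_le_between [lx _] := Rle_trans _ _ _ (Ldiff h) (dL2 h).
move=> m4.
apply: Rle_trans (_ : 2 * m <= _); last by lra.
apply: Rle_trans (_ : 2 * m / (R' * R') * (R' * R') <= _).
  apply: Rmult_le_compat => //; last by apply: Rmult_le_compat.
  by apply: Rmin_glb; [lra|apply/Rlt_le/Rdiv_lt_0_compat; rewrite /R'; nra].
by right; field; rewrite /R'; lra.
Qed.

End Curvature.

(** The projection along [e] onto the complex tangent space at [p]. It does not follow [p'], so that
    the quadratic forms built from it stay fixed. *)
Definition tangent_proj h : Cn n := vsub h (cscal (L p h) e).

(** Write [h = k + (L p h) e], where [L p h] is [L p' h] up to [d' |h|]. The cross terms [|k| |w|]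
    of [b h h] are split into a small multiple of [|k|^2] and a large multiple of [|w|^2]: this is
    where [Cq] comes from and why it depends on [d]. The bound on [|h|] serves later to recover
    [|h| < eta] from bounds on [k] and [w]. *)
Lemma near_expansion d : 0 < d ->
  exists Cq eta, 0 <= Cq /\ 0 < eta /\ forall p', vnorm (vsub p' p) < eta -> rho p' = 0 ->
    forall h, vnorm h < eta ->
    [/\ U (vadd p' h), vnorm h <= 2 * vnorm (tangent_proj h) + 2 * vnorm e * Cmod (L p' h) &
      Rabs (rho (vadd p' h) + Re (L p' h) - b (tangent_proj h) (tangent_proj h)) <=
      d * (vnorm (tangent_proj h) * vnorm (tangent_proj h)) +
      Cq * (Cmod (L p' h) * Cmod (L p' h))].
Proof.
move=> d0; have [K [K0 bK]] := quadratic_bound.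
have [bD bZ bC _] := bq.
pose E := vnorm e + 1.
have e0 := vnorm_ge0 e; have E0 : 0 < E by rewrite /E; lra.
(* The entry [/ (2 * E)] lets [|h|] be absorbed on the left of its own bound; the last two turn the
   [|k|^2] terms of [b h h - b k k] and of the remainder into at most [d / 4 |k|^2] each. *)
pose d' := Rmin (Rmin 1 (/ (2 * E))) (Rmin (d / (24 * (K * E))) (d / 32)).
have KE : 0 < K * E by apply: Rmult_lt_0_compat.
have d'0 : 0 < d'.
  do !apply: Rmin_glb_lt; try lra; first by apply: Rinv_0_lt_compat; lra.
  by apply: Rdiv_lt_0_compat; lra.
have [d1 d2] : d' <= 1 /\ d' <= / (2 * E).
  have := Rmin_l (Rmin 1 (/ (2 * E))) (Rmin (d / (24 * (K * E))) (d / 32)); rewrite -/d'.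
  by have := Rmin_l 1 (/ (2 * E)); have := Rmin_r 1 (/ (2 * E)); lra.
have [d3 d4] : d' <= d / (24 * (K * E)) /\ d' <= d / 32.
  have := Rmin_r (Rmin 1 (/ (2 * E))) (Rmin (d / (24 * (K * E))) (d / 32)); rewrite -/d'.
  by have := Rmin_l (d / (24 * (K * E))) (d / 32); have := Rmin_r (d / (24 * (K * E))) (d / 32); lra.
have d2' : E * d' <= / 2.
  have : E * d' <= E * / (2 * E) by apply: Rmult_le_compat_l; lra.
  by rewrite (_ : E * / (2 * E) = / 2); last by field; lra.
have d3' : 6 * (K * E) * d' <= d / 4.
  have : 6 * (K * E) * d' <= 6 * (K * E) * (d / (24 * (K * E))) by apply: Rmult_le_compat_l; lra.
  by rewrite (_ : 6 * (K * E) * (d / (24 * (K * E))) = d / 4); last by field; lra.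
have [eta [eta0 ex]] := expn d' d'0.
exists (64 * (K * E) * (K * E) / d + 4 * (K * E) * E + 8 * E * E), eta.
split.
  have : 0 <= 64 * (K * E) * (K * E) / d by apply: Rmult_le_pos; [nra|apply/Rlt_le/Rinv_0_lt_compat].
  nra.
split=> // p' p'p rp' h hh.
have [_ dL /(_ h hh) [Uh]] := ex p' p'p; rewrite rp' => Th.
set k := tangent_proj h; set w := Cmod (L p' h).
have w0 : 0 <= w by exact: Cmod_ge_0.
have h0 := vnorm_ge0 h; have k0 := vnorm_ge0 k.
pose x := cscal (L p h) e.
have hkx : h = vadd k x.
  by apply: functional_extensionality => i; rewrite vaddE /k /x /tangent_proj vsubE; cring.
have Lw : Cmod (L p h) <= w + d' * vnorm h.
  have := Cmod_sub_le (L p' h) (L p' h - L p h)%C; have := dL h.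
  by rewrite (_ : (L p' h - (L p' h - L p h))%C = L p h); [rewrite -/w; lra|cring].
have xE : vnorm x <= E * w + E * d' * vnorm h.
  rewrite vnorm_cscal; have := Cmod_ge_0 (L p h).
  have : Cmod (L p h) * vnorm e <= (w + d' * vnorm h) * E.
    by apply: Rmult_le_compat => //; [exact: Cmod_ge_0|rewrite /E; lra].
  nra.
have x0 := vnorm_ge0 x.
have hx : vnorm h <= vnorm k + vnorm x by rewrite {1}hkx; exact: vnorm_triangle.
have hE : vnorm h <= 2 * vnorm k + 2 * E * w.
  have : E * d' * vnorm h <= / 2 * vnorm h by apply: Rmult_le_compat_r.
  lra.
have xe : vnorm x <= vnorm e * w + E * d' * vnorm h.
  rewrite vnorm_cscal; have := Cmod_ge_0 (L p h).
  have : Cmod (L p h) * vnorm e <= (w + d' * vnorm h) * vnorm e.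
    by apply: Rmult_le_compat_r.
  have : d' * vnorm h * vnorm e <= d' * vnorm h * E.
    by apply: Rmult_le_compat_l; [nra|rewrite /E; lra].
  nra.
split=> //.
  have : E * d' * vnorm h <= / 2 * vnorm h by apply: Rmult_le_compat_r.
  nra.
have diff : b h h - b k k = 2 * b k x + b x x.
  by rewrite {1 2}hkx b_vadd_sqr; ring.
have b1 := bK k x; have b2 := bK x x.
have bdiff : Rabs (b h h - b k k) <= K * (vnorm x * (2 * vnorm k + vnorm x)).
  rewrite diff; have := Rabs_triang (2 * b k x) (b x x).
  by rewrite Rabs_mult (Rabs_right 2); lra.
have x2 : vnorm x <= 2 * E * w + 2 * (E * d') * vnorm k.
  have : E * d' * vnorm h <= E * d' * (2 * vnorm k + 2 * E * w).
    by apply: Rmult_le_compat_l; nra.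
  have : E * d' * (2 * E * w) <= / 2 * (2 * E * w) by apply: Rmult_le_compat_r; nra.
  lra.
have x3 : vnorm x <= 2 * E * w + vnorm k.
  have : 2 * (E * d') * vnorm k <= 1 * vnorm k by apply: Rmult_le_compat_r; lra.
  lra.
have prodx : vnorm x * (2 * vnorm k + vnorm x) <=
    (2 * E * w + 2 * (E * d') * vnorm k) * (3 * vnorm k + 2 * E * w).
  by apply: Rmult_le_compat; lra.
have cross : 2 * (E * d') * vnorm k * (2 * E * w) <= 2 * E * w * vnorm k.
  have : 2 * (E * d') * (2 * E * w * vnorm k) <= 1 * (2 * E * w * vnorm k).
    by apply: Rmult_le_compat_r; [nonneg|lra].
  lra.
have Kprod : K * (vnorm x * (2 * vnorm k + vnorm x)) <=
    8 * (K * E) * (w * vnorm k) + 4 * (K * E) * E * (w * w)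
    + 6 * (K * E) * d' * (vnorm k * vnorm k).
  apply: Rle_trans (_ : K * (8 * E * w * vnorm k + 4 * E * E * (w * w)
    + 6 * E * d' * (vnorm k * vnorm k)) <= _); last by right; ring.
  by apply: Rmult_le_compat_l; lra.
(* AM-GM: [8 K E w k <= (d / 4) k^2 + (64 K^2 E^2 / d) w^2] *)
have amgm : 8 * (K * E) * (w * vnorm k) <=
    d / 4 * (vnorm k * vnorm k) + 64 * (K * E) * (K * E) / d * (w * w).
  have sq := Rle_0_sqr (d / 2 * vnorm k - 8 * (K * E) * w).
  have id : 0 < / d by apply: Rinv_0_lt_compat.
  have -> : d / 4 * (vnorm k * vnorm k) + 64 * (K * E) * (K * E) / d * (w * w) =
    8 * (K * E) * (w * vnorm k) + / d * Rsqr (d / 2 * vnorm k - 8 * (K * E) * w).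
    by rewrite /Rsqr; field; lra.
  by have : 0 <= / d * Rsqr (d / 2 * vnorm k - 8 * (K * E) * w) by [apply: Rmult_le_pos; lra]; lra.
have k2 : 6 * (K * E) * d' * (vnorm k * vnorm k) <= d / 4 * (vnorm k * vnorm k).
  by apply: Rmult_le_compat_r; nra.
have hh2 : d' * (vnorm h * vnorm h) <= d / 4 * (vnorm k * vnorm k) + 8 * E * E * (w * w).
  have h3 : vnorm h * vnorm h <= 8 * (vnorm k * vnorm k) + 8 * E * E * (w * w).
    have : vnorm h * vnorm h <= (2 * vnorm k + 2 * E * w) * (2 * vnorm k + 2 * E * w).
      by apply: Rmult_le_compat.
    by have := Rle_0_sqr (2 * vnorm k - 2 * E * w); rewrite /Rsqr; lra.
  have : d' * (vnorm h * vnorm h) <= d' * (8 * (vnorm k * vnorm k) + 8 * E * E * (w * w)).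
    by apply: Rmult_le_compat_l; lra.
  have : d' * (vnorm k * vnorm k) <= d / 32 * (vnorm k * vnorm k) by apply: Rmult_le_compat_r; nra.
  have : d' * (8 * E * E * (w * w)) <= 1 * (8 * E * E * (w * w)).
    by apply: Rmult_le_compat_r => //; nonneg.
  lra.
have := Rabs_triang (rho (vadd p' h) - 0 + Re (L p' h) - b h h) (b h h - b k k).
rewrite (_ : rho (vadd p' h) - 0 + Re (L p' h) - b h h + (b h h - b k k) =
  rho (vadd p' h) + Re (L p' h) - b k k); last by ring.
have : 0 <= d / 4 * (vnorm k * vnorm k) by apply: Rmult_le_pos; nra.
lra.
Qed.

End Outer.
End Geometry.

(** * Hermitian forms *)

Section Hermitian.
Context {n : nat}.
Implicit Types (z w h v x : Cn n) (c : Complex.C) (Phi : Cn n -> Cn n -> Complex.C).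

Definition hermitian_form Phi :=
  [/\ forall h z w, Phi (vadd h z) w = Cplus (Phi h w) (Phi z w),
      forall c h w, Phi (cscal c h) w = Cmult c (Phi h w) &
      forall h w, Phi w h = Cconj (Phi h w)].

Lemma hermitian_linear Phi w : hermitian_form Phi -> linear_form (fun v => Phi v w).
Proof. by case=> PD PZ _; split=> *; rewrite ?PD ?PZ. Qed.

Lemma hermitian_diag Phi h : hermitian_form Phi -> Phi h h = RtoC (Re (Phi h h)).
Proof.
case=> _ _ /(_ h h); case: (Phi h h) => x y [/= e].
by apply: injective_projections => //=; lra.
Qed.

Lemma linear_form_bigsum (m : nat) (L : Cn n -> Complex.C) (F : 'I_m -> Cn n) :
  linear_form L ->
  L (\big[vadd/vzero n]_(i < m) F i) = \big[Cplus/RtoC 0]_(i < m) L (F i).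
Proof.
move=> Ll; apply: (big_morph L (id1 := RtoC 0) (op1 := Cplus)); last exact: linear_form0.
by case: Ll.
Qed.

Lemma vsum_coord (m : nat) (F : 'I_m -> Cn n) j :
  (\big[vadd/vzero n]_(i < m) F i) j = \big[Cplus/RtoC 0]_(i < m) (F i j : Complex.C).
Proof. exact: (big_morph (fun v : Cn n => v j : Complex.C) (id1 := RtoC 0) (op1 := Cplus)). Qed.

Lemma csum_delta (m : nat) (F : 'I_m -> Complex.C) (j : 'I_m) :
  \big[Cplus/RtoC 0]_(i < m) (F i * (if i == j then RtoC 1 else RtoC 0))%C = F j.
Proof.
rewrite (bigD1 j) //= big1 => [|i ij]; first by rewrite eqxx; cring.
by rewrite (negbTE ij); cring.
Qed.

(** The vanishing of later coordinates is carried along to show that the new residual [r] is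
    nonzero: its coordinate [m] is 1. The expansion of the basis vectors records spanning, so no
    dimension count is needed afterwards. *)
Lemma gram_schmidt Phi : hermitian_form Phi ->
  (forall v, v <> vzero n -> 0 < Re (Phi v v)) ->
  forall m : nat, (m <= n)%N -> exists f : nat -> Cn n,
    [/\ forall i j : 'I_m, Phi (f i) (f j) = if i == j then RtoC 1 else RtoC 0,
        forall (i : 'I_m) (j : 'I_n), (m <= j)%N -> f i j = RtoC 0 :> Complex.C &
        forall j : 'I_n, (j < m)%N ->
          ebasis j = \big[vadd/vzero n]_(i < m) cscal (Phi (ebasis j) (f i)) (f i)].
Proof.
move=> Pherm Ppos; have [PD PZ PC] := Pherm.
elim=> [_|m IH mn].
  by exists (fun=> vzero n); split=> // -[].
have [f [fo fz fs]] := IH (ltnW mn).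
pose jm : 'I_n := Ordinal mn.
pose s := \big[vadd/vzero n]_(i < m) cscal (Phi (ebasis jm) (f i)) (f i).
pose r := vsub (ebasis jm) s.
have PB a a' w : Phi (vsub a a') w = (Phi a w - Phi a' w)%C.
  exact: (linear_formB _ _ _ (hermitian_linear Phi w Pherm)).
have Pr i : Phi r (f (nat_of_ord (i : 'I_m))) = RtoC 0.
  rewrite /r PB /s (linear_form_bigsum _ _ _ (hermitian_linear Phi (f i) Pherm)).
  rewrite (eq_bigr (fun j => Cmult (Phi (ebasis jm) (f (nat_of_ord j)))
    (if j == i then RtoC 1 else RtoC 0))); last by move=> j _; rewrite PZ fo.
  by rewrite csum_delta; cring.
have rm : r jm = RtoC 1 :> Complex.C.
  rewrite /r vsubE ebasis_eq /s vsum_coord big1 => [|i _]; first by cring.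
  by rewrite /cscal fz //; cring.
have r0 : r <> vzero n.
  by move=> e; move: rm; rewrite e vzeroE => -[]; lra.
have nu0 := Ppos r r0; set nu := Re (Phi r r) in nu0.
have sn0 : 0 < sqrt nu by exact: sqrt_lt_R0.
have ss : sqrt nu * sqrt nu = nu by apply: sqrt_sqrt; lra.
pose fm := cscal (RtoC (/ sqrt nu)) r.
have PZr c h w : Phi w (cscal c h) = (Cconj c * Phi w h)%C.
  by rewrite PC PZ Cmult_conj -PC.
have cR t : Cconj (RtoC t) = RtoC t.
  by apply: injective_projections => //=; ring.
have Pfm (i : 'I_m) : Phi fm (f i) = RtoC 0 by rewrite /fm PZ Pr; cring.
have Pfm' (i : 'I_m) : Phi (f i) fm = RtoC 0 by rewrite PC Pfm cR.
have Prfm : Phi r fm = RtoC (sqrt nu).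
  rewrite /fm PZr cR (hermitian_diag Phi r Pherm) -/nu -RtoC_mult; congr RtoC.
  by rewrite -{2}ss; field; lra.
have Pmm : Phi fm fm = RtoC 1.
  by rewrite {1}/fm PZ Prfm -RtoC_mult; congr RtoC; field; lra.
have er : ebasis jm = vadd s r by rewrite /r vsubK.
have Pem : Phi (ebasis jm) fm = RtoC (sqrt nu).
  rewrite er PD Prfm /s (linear_form_bigsum _ _ _ (hermitian_linear Phi fm Pherm)).
  rewrite big1 => [|i _]; first by cring.
  by rewrite PZ Pfm'; cring.
pose f' i := if i == m then fm else f i.
have f'l (i : 'I_m) : f' i = f i by rewrite /f' ltn_eqF.
have f'm : f' m = fm by rewrite /f' eqxx.
have f's v : \big[vadd/vzero n]_(i < m.+1) cscal (Phi v (f' i)) (f' i) =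
    vadd (\big[vadd/vzero n]_(i < m) cscal (Phi v (f i)) (f i)) (cscal (Phi v fm) fm).
  rewrite big_ord_recr /= f'm; congr vadd; apply: eq_bigr => i _; by rewrite f'l.
exists f'; split.
- move=> i j; have [im|im] := eqVneq (i : nat) m; have [jm'|jm'] := eqVneq (j : nat) m.
  + by rewrite im jm' f'm Pmm -val_eqE /= im jm' eqxx.
  + have jl : (j < m)%N by rewrite ltn_neqAle jm' -ltnS ltn_ord.
    rewrite im f'm -val_eqE /= im eq_sym (negbTE jm').
    by rewrite -[nat_of_ord j]/(nat_of_ord (Ordinal jl)) f'l Pfm.
  + have il : (i < m)%N by rewrite ltn_neqAle im -ltnS ltn_ord.
    rewrite jm' f'm -val_eqE /= jm' (negbTE im).
    by rewrite -[nat_of_ord i]/(nat_of_ord (Ordinal il)) f'l Pfm'.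
  + have il : (i < m)%N by rewrite ltn_neqAle im -ltnS ltn_ord.
    have jl : (j < m)%N by rewrite ltn_neqAle jm' -ltnS ltn_ord.
    have := fo (Ordinal il) (Ordinal jl).
    by rewrite -[nat_of_ord j]/(nat_of_ord (Ordinal jl)) -[nat_of_ord i]/(nat_of_ord (Ordinal il)) !f'l -!val_eqE.
- move=> i j mj; have [im|im] := eqVneq (i : nat) m.
    rewrite im f'm /fm /cscal /r vsubE /s vsum_coord big1 => [|k _].
      have -> : ebasis jm j = RtoC 0.
        by rewrite /ebasis -val_eqE /= gtn_eqF.
      by cring.
    by rewrite /cscal fz; [cring|exact: ltnW].
  have il : (i < m)%N by rewrite ltn_neqAle im -ltnS ltn_ord.
  by rewrite -[nat_of_ord i]/(nat_of_ord (Ordinal il)) f'l fz //; exact: ltnW.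
- move=> j; rewrite ltnS leq_eqVlt => /orP [/eqP jm'|jl].
    have -> : j = jm by apply: val_inj.
    rewrite f's -/s Pem {1}er; congr vadd; rewrite /fm cscalA -RtoC_mult.
    by rewrite (_ : sqrt nu * / sqrt nu = 1); [rewrite cscal1|field; lra].
  rewrite f's -fs //.
  suff -> : Phi (ebasis j) fm = RtoC 0 by rewrite cscal0 vaddC vadd0.
  rewrite (fs j jl) (linear_form_bigsum _ _ _ (hermitian_linear Phi fm Pherm)).
  by rewrite big1 // => i _; rewrite PZ Pfm'; cring.
Qed.

(** [E] takes coordinates in a [Phi]-orthonormal basis and [F] reassembles the vector:
    orthonormality gives [E (F x) = x], and the expansion of each [ebasis j] gives [F (E v) = v]. *)
Lemma hermitian_diagonalization Phi : hermitian_form Phi ->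
  (forall v, v <> vzero n -> 0 < Re (Phi v v)) ->
  exists E F : Cn n -> Cn n,
    [/\ forall i, linear_form (fun v => E v i), forall x, E (F x) = x,
        forall v, F (E v) = v & forall v, vnorm (E v) * vnorm (E v) = Re (Phi v v)].
Proof.
move=> Pherm Ppos; have [PD PZ PC] := Pherm.
have [f [fo _ fs]] := gram_schmidt Phi Pherm Ppos n (leqnn n).
pose E v : Cn n := fun i => Phi v (f i).
pose F (x : Cn n) := \big[vadd/vzero n]_(i < n) cscal (x i) (f i).
have Elin i : linear_form (fun v => E v i) by exact: hermitian_linear.
have EF x : E (F x) = x.
  apply: functional_extensionality => j.
  rewrite /E /F (linear_form_bigsum _ _ _ (hermitian_linear Phi (f j) Pherm)).
  rewrite (eq_bigr (fun i => Cmult (x i) (if i == j then RtoC 1 else RtoC 0))).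
    exact: csum_delta.
  by move=> i _; rewrite PZ fo.
have FD x y : F (vadd x y) = vadd (F x) (F y).
  by rewrite /F -big_split; apply: eq_bigr => i _; rewrite vaddE cscalDl.
have FZ c x : F (cscal c x) = cscal c (F x).
  rewrite /F (big_morph (cscal c) (id1 := vzero n) (op1 := vadd)); last 2 first.
  - by move=> *; rewrite cscalDr.
  - by rewrite -(cscal0 (vzero n)) cscalA; congr cscal; cring.
  by apply: eq_bigr => i _; rewrite cscalA.
have FE v : F (E v) = v.
  have ED x y : E (vadd x y) = vadd (E x) (E y).
    by apply: functional_extensionality => i; rewrite /E PD.
  have EZ c x : E (cscal c x) = cscal c (E x).
    by apply: functional_extensionality => i; rewrite /E PZ.
  rewrite {1}(vec_decomp v) (big_morph (fun v => F (E v)) (id1 := vzero n) (op1 := vadd)).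
  - rewrite {2}(vec_decomp v); apply: eq_bigr => j _.
    by rewrite EZ FZ; congr cscal; rewrite {2}(fs j (ltn_ord j)).
  - by move=> x y; rewrite ED FD.
  - by rewrite -(cscal0 (vzero n)) EZ FZ !cscal0.
exists E, F; split=> // v.
rewrite vnorm_sq -{3}(FE v) /F (linear_form_bigsum _ _ _ (hermitian_linear Phi v Pherm)).
rewrite (big_morph Re (id1 := 0) (op1 := Rplus)) //; apply: eq_bigr => i _.
rewrite PZ (PC v (f i)) -/(E v i) Cmod_sqr.
by case: (E v i) => a b; rewrite /Re /Im /=; ring.
Qed.

(** * Hermitian and pluriharmonic parts of a real quadratic form *)

Section Polarization.
Variable b : Cn n -> Cn n -> R.
Hypothesis bq : real_quadratic b.

(** The imaginary parts here and in [sym_part] are forced by complex linearity in [h]. When [b] is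
    half the Hessian of a defining function, [herm_part] is its Levi form. *)
Definition herm_part h w : Complex.C :=
  (/ 2 * (b h w + b (cscal Ci h) (cscal Ci w)), / 2 * (b h (cscal Ci w) - b (cscal Ci h) w)).
Definition sym_part h w : Complex.C :=
  (/ 2 * (b h w - b (cscal Ci h) (cscal Ci w)), - (/ 2 * (b h (cscal Ci w) + b (cscal Ci h) w))).

Lemma cscal_real_imag c h :
  cscal c h = vadd (vscal (Re c) h) (vscal (Im c) (cscal Ci h)).
Proof.
rewrite !vscalE cscalA -cscalDl; congr cscal.
by case: c => x y; apply: injective_projections => /=; ring.
Qed.

Lemma cscal_Ci2 h : cscal Ci (cscal Ci h) = vscal (-1) h.
Proof.
rewrite vscalE cscalA; congr cscal.
by apply: injective_projections => /=; ring.
Qed.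

Lemma cscal_vscal c t h : cscal c (vscal t h) = vscal t (cscal c h).
Proof. by rewrite !vscalE !cscalA; congr cscal; cring. Qed.

Lemma herm_part_hermitian : hermitian_form herm_part.
Proof.
have [bD bZ bC _] := bq.
have add h z w : herm_part (vadd h z) w = Cplus (herm_part h w) (herm_part z w).
  by rewrite /herm_part cscalDr !bD; apply: injective_projections => /=; ring.
split=> // [c h w|h w]; last first.
  rewrite /herm_part (bC w h) (bC (cscal Ci w)) (bC w) (bC (cscal Ci w) h).
  by apply: injective_projections => /=; ring.
rewrite cscal_real_imag add /herm_part !cscal_vscal !bZ cscal_Ci2 !bZ.
by case: c => x y; apply: injective_projections; rewrite /Re /Im /=; ring.
Qed.

Lemma sym_part_linear w : linear_form (fun h => sym_part h w).
Proof.
have [bD bZ bC _] := bq.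
have add h z : sym_part (vadd h z) w = Cplus (sym_part h w) (sym_part z w).
  by rewrite /sym_part cscalDr !bD; apply: injective_projections => /=; ring.
split=> // c h.
rewrite cscal_real_imag add /sym_part !cscal_vscal !bZ cscal_Ci2 !bZ.
by case: c => x y; apply: injective_projections; rewrite /Re /Im /=; ring.
Qed.

Lemma sym_partC h w : sym_part h w = sym_part w h.
Proof.
have [_ _ bC _] := bq.
rewrite /sym_part (bC w h) (bC (cscal Ci w)) (bC w) (bC (cscal Ci w) h).
by congr pair; ring.
Qed.

Lemma quadratic_split h : b h h = Re (herm_part h h) + Re (sym_part h h).
Proof. by rewrite /Re /=; field. Qed.

Lemma sym_part_scale c h : sym_part (cscal c h) (cscal c h) = (c * c * sym_part h h)%C.
Proof.
have sZ (d : Complex.C) w g : sym_part (cscal d g) w = (d * sym_part g w)%C.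
  exact: (proj2 (sym_part_linear w)).
by rewrite sZ sym_partC sZ; cring.
Qed.

Lemma herm_part_scale c h :
  Re (herm_part (cscal c h) (cscal c h)) = Cmod c * Cmod c * Re (herm_part h h).
Proof.
have [_ PZ PC] := herm_part_hermitian.
rewrite PZ PC PZ (hermitian_diag _ h herm_part_hermitian) Cmod_sqr.
by case: c => x y; rewrite /Re /Im /=; ring.
Qed.

(** Half-angle formulas; the sign of the imaginary part of [c] selects the sign of the sine. *)
Lemma unit_square_root c : Cmod c = 1 -> exists d, Cmod d = 1 /\ (d * d)%C = c.
Proof.
move=> c1; have := Cmod_sqr c; rewrite c1; case: c {c1} => x y; rewrite /Re /Im /= => e.
have x1 : -1 <= x <= 1 by nra.
pose s := sqrt ((1 + x) / 2); pose t := sqrt ((1 - x) / 2).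
have s2 : s * s = (1 + x) / 2 by apply: sqrt_sqrt; lra.
have t2 : t * t = (1 - x) / 2 by apply: sqrt_sqrt; lra.
have s0 : 0 <= s by exact: sqrt_pos.
have t0 : 0 <= t by exact: sqrt_pos.
have st : Rsqr (2 * (s * t)) = Rsqr y.
  rewrite /Rsqr; have -> : 2 * (s * t) * (2 * (s * t)) = 4 * (s * s) * (t * t) by ring.
  rewrite s2 t2; nra.
have unit u : u * u = t * t -> Cmod (s, u) = 1.
  move=> u2; have := Cmod_sqr (s, u); rewrite /Re /Im /= => e'.
  by have := Cmod_ge_0 (s, u); nra.
case: (Rle_or_lt 0 y) => y0.
  exists (s, t); split; first exact: unit.
  have : 2 * (s * t) = y by apply: Rsqr_inj => //; nonneg.
  by move=> ?; apply: injective_projections => /=; lra.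
exists (s, - t); split; first by apply: unit; ring.
have : 2 * (s * t) = - y by apply: Rsqr_inj; [nonneg|lra|rewrite -Rsqr_neg].
by move=> ?; apply: injective_projections => /=; lra.
Qed.

(* Rotating [h] by a unit [d] multiplies the symmetric part by [d^2] and fixes the Hermitian part. *)
Lemma sym_part_bound h (m : R) : (forall c, Cmod c = 1 -> m <= b (cscal c h) (cscal c h)) ->
  Cmod (sym_part h h) <= Re (herm_part h h) - m.
Proof.
move=> bm; set s := sym_part h h.
have rot d : Cmod d = 1 -> m <= Re (herm_part h h) + Re (d * d * s)%C.
  move=> d1; have := bm d d1; rewrite quadratic_split herm_part_scale sym_part_scale d1.
  by rewrite -/s; lra.
have [s0|s0] := classic (s = RtoC 0).
  by have := rot (RtoC 1) Cmod_1; rewrite s0 Cmod_0 /Re /=; lra.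
have sp := Cmod_pos_neq0 _ s0.
(* The worst rotation: [d^2 s = -|s|]. *)
have [d [d1 dd]] := unit_square_root (- (RtoC (Cmod s) / s))%C ltac:(
  rewrite Cmod_opp Cmod_div // Cmod_R Rabs_right; [field|]; lra).
have := rot d d1; rewrite dd.
have -> : (- (RtoC (Cmod s) / s) * s)%C = RtoC (- Cmod s).
  by rewrite RtoC_opp; field.
by rewrite /Re /=; lra.
Qed.

Lemma herm_part_bound : exists K, 0 < K /\ forall h, Re (herm_part h h) <= K * (vnorm h * vnorm h).
Proof.
have [_ _ _ [K [K0 bK]]] := bq; exists K; split=> // h.
have := bK h h; have := bK (cscal Ci h) (cscal Ci h).
rewrite vnorm_cscal Cmod_Ci => /Rabs_le_between ? /Rabs_le_between ?.
by rewrite /Re /=; lra.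
Qed.

End Polarization.
End Hermitian.

(** * Holomorphic maps *)

Section Holomorphy.
Context {n : nat}.
Implicit Types (z w h : Cn n) (f g : Cn n -> Complex.C).

(** No open set appears: inverses are total, so all maps below are defined everywhere, and a nonzero
    denominator at [z] stays nonzero nearby. *)
Definition complex_diff f z := exists A : Cn n -> Complex.C, linear_form A /\
  forall eps, 0 < eps -> exists d, 0 < d /\ forall h, vnorm h < d ->
    Cmod (f (vadd z h) - f z - A h)%C <= eps * vnorm h.

Lemma complex_diff_increment f z : complex_diff f z -> exists K d, 0 < K /\ 0 < d /\
  forall h, vnorm h < d -> Cmod (f (vadd z h) - f z)%C <= K * vnorm h.
Proof.
move=> [A [Al Ad]]; have [K [K0 AK]] := linear_form_bound A Al.
have [d [d0 H]] := Ad 1 Rlt_0_1; exists (K + 1), d; split; first by lra.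
split=> // h hd; have := H h hd; have := AK h.
have := Cmod_triangle (f (vadd z h) - f z - A h)%C (A h).
rewrite (_ : (f (vadd z h) - f z - A h + A h)%C = (f (vadd z h) - f z)%C); last by ring.
lra.
Qed.

Lemma complex_diff_const (c : Complex.C) z : complex_diff (fun=> c) z.
Proof.
exists (fun=> RtoC 0); split; first by split=> *; ring.
move=> eps e0; exists 1; split; first by lra.
move=> h _; rewrite (_ : (c - c - 0)%C = RtoC 0); last by ring.
by rewrite Cmod_0; have := vnorm_ge0 h; nra.
Qed.

Lemma complex_diff_linear (A : Cn n -> Complex.C) z0 z : linear_form A ->
  complex_diff (fun z => A (vsub z z0)) z.
Proof.
move=> Al; exists A; split=> // eps e0; exists 1; split; first by lra.
move=> h _; rewrite !linear_formB //; case: Al => AD _; rewrite AD.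
rewrite (_ : (A z + A h - A z0 - (A z - A z0) - A h)%C = RtoC 0); last by ring.
by rewrite Cmod_0; have := vnorm_ge0 h; nra.
Qed.

Lemma complex_diff_add f g z : complex_diff f z -> complex_diff g z ->
  complex_diff (fun z => (f z + g z)%C) z.
Proof.
move=> [A [[AD AZ] Ad]] [B [[BD BZ] Bd]]; exists (fun h => (A h + B h)%C); split.
  by split=> [h w|c h]; rewrite ?AD ?BD ?AZ ?BZ; ring.
move=> eps e0; have e2 : 0 < eps / 2 by lra.
have [d1 [d10 H1]] := Ad _ e2; have [d2 [d20 H2]] := Bd _ e2.
exists (Rmin d1 d2); split; first exact: Rmin_glb_lt.
move=> h hd; have l1 := Rmin_l d1 d2; have l2 := Rmin_r d1 d2.
have := H1 h ltac:(lra); have := H2 h ltac:(lra).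
have := Cmod_triangle (f (vadd z h) - f z - A h)%C (g (vadd z h) - g z - B h)%C.
rewrite (_ : (f (vadd z h) - f z - A h + (g (vadd z h) - g z - B h))%C =
  (f (vadd z h) + g (vadd z h) - (f z + g z) - (A h + B h))%C); last by ring.
lra.
Qed.

Lemma complex_diff_mul f g z : complex_diff f z -> complex_diff g z ->
  complex_diff (fun z => (f z * g z)%C) z.
Proof.
move=> df dg; have [K1 [r1 [K10 [r10 I1]]]] := complex_diff_increment f z df.
have [K2 [r2 [K20 [r20 I2]]]] := complex_diff_increment g z dg.
case: df => [A [[AD AZ] Ad]]; case: dg => [B [[BD BZ] Bd]].
exists (fun h => (f z * B h + g z * A h)%C); split.
  by split=> [h w|c h]; rewrite ?AD ?BD ?AZ ?BZ; ring.
move=> eps e0; pose N := Cmod (f z) + Cmod (g z) + 1.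
have f0 := Cmod_ge_0 (f z); have g0 := Cmod_ge_0 (g z).
have N0 : 0 < N by rewrite /N; lra.
have e2 : 0 < eps / (2 * N) by apply: Rdiv_lt_0_compat; lra.
have [d1 [d10 H1]] := Ad _ e2; have [d2 [d20 H2]] := Bd _ e2.
have KK : 0 < K1 * K2 by nra.
have r30 : 0 < eps / (2 * (K1 * K2)) by apply: Rdiv_lt_0_compat; lra.
exists (Rmin (Rmin d1 d2) (Rmin (Rmin r1 r2) (eps / (2 * (K1 * K2))))); split.
  by do !apply: Rmin_glb_lt.
move=> h hd.
have [l1 l2] : vnorm h < d1 /\ vnorm h < d2.
  by have := Rmin_l (Rmin d1 d2) (Rmin (Rmin r1 r2) (eps / (2 * (K1 * K2))));
    have := Rmin_l d1 d2; have := Rmin_r d1 d2; lra.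
have [l3 l4 l5] : [/\ vnorm h < r1, vnorm h < r2 & vnorm h < eps / (2 * (K1 * K2))].
  have := Rmin_r (Rmin d1 d2) (Rmin (Rmin r1 r2) (eps / (2 * (K1 * K2)))).
  have := Rmin_l (Rmin r1 r2) (eps / (2 * (K1 * K2))).
  have := Rmin_r (Rmin r1 r2) (eps / (2 * (K1 * K2))).
  by have := Rmin_l r1 r2; have := Rmin_r r1 r2; split; lra.
have a1 := H1 h l1; have a2 := H2 h l2; have a3 := I1 h l3; have a4 := I2 h l4.
have h0 := vnorm_ge0 h.
set df := (f (vadd z h) - f z)%C in a1 a3; set dg := (g (vadd z h) - g z)%C in a2 a4.
have -> : (f (vadd z h) * g (vadd z h) - f z * g z - (f z * B h + g z * A h))%C =
  (f z * (dg - B h) + g z * (df - A h) + df * dg)%C by rewrite /df /dg; ring.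
apply: Rle_trans (Cmod_triangle _ _) _.
apply: Rle_trans (Rplus_le_compat_r _ _ _ (Cmod_triangle _ _)) _.
rewrite !Cmod_mult.
have b1 : Cmod (f z) * Cmod (dg - B h)%C <= Cmod (f z) * (eps / (2 * N) * vnorm h).
  exact: Rmult_le_compat_l.
have b2 : Cmod (g z) * Cmod (df - A h)%C <= Cmod (g z) * (eps / (2 * N) * vnorm h).
  exact: Rmult_le_compat_l.
have b3 : Cmod df * Cmod dg <= K1 * vnorm h * (K2 * vnorm h).
  by apply: Rmult_le_compat => //; exact: Cmod_ge_0.
have b4 : K1 * vnorm h * (K2 * vnorm h) <= eps / 2 * vnorm h.
  have : K1 * K2 * vnorm h <= K1 * K2 * (eps / (2 * (K1 * K2))).
    by apply: Rmult_le_compat_l; lra.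
  rewrite (_ : K1 * K2 * (eps / (2 * (K1 * K2))) = eps / 2); last by field; lra.
  by move=> ?; have : K1 * K2 * vnorm h * vnorm h <= eps / 2 * vnorm h by [apply: Rmult_le_compat_r]; lra.
have b5 : N * (eps / (2 * N) * vnorm h) = eps / 2 * vnorm h by field; lra.
have q0 : 0 <= eps / (2 * N) * vnorm h by apply: Rmult_le_pos; lra.
set q := eps / (2 * N) * vnorm h in b1 b2 b5 q0.
have : N * q = Cmod (f z) * q + Cmod (g z) * q + q by rewrite /N; ring.
lra.
Qed.

Lemma complex_diff_inv g z : g z <> RtoC 0 -> complex_diff g z ->
  complex_diff (fun z => (/ g z)%C) z.
Proof.
move=> gz dg; have [K [r [K0 [r0 I]]]] := complex_diff_increment g z dg.
case: dg => [B [Bl Bd]]; have [BD BZ] := Bl.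
have [KB [KB0 BK]] := linear_form_bound B Bl.
exists (fun h => (- (B h / (g z * g z)))%C); split.
  by split=> [h w|c h]; rewrite ?BD ?BZ; field.
have m0 := Cmod_pos_neq0 _ gz; set m := Cmod (g z) in m0.
(* The numerator will be at most [2 Q |h|] and the denominator at least [m^3 / 2], giving exactly
   [eps |h|]. *)
move=> eps e0; pose Q := eps * (m * m * m) / 4.
have mm : 0 < m * m by nra.
have Q0 : 0 < Q by apply: Rdiv_lt_0_compat; [do !apply: Rmult_lt_0_compat|lra].
have e2 : 0 < Q / m by apply: Rdiv_lt_0_compat.
have [d [d0 H]] := Bd _ e2.
have KK : 0 < KB * K by nra.
have r30 : 0 < Q / (KB * K) by apply: Rdiv_lt_0_compat; lra.
have r40 : 0 < m / (2 * K) by apply: Rdiv_lt_0_compat; lra.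
exists (Rmin (Rmin d r) (Rmin (Q / (KB * K)) (m / (2 * K)))); split.
  by do !apply: Rmin_glb_lt.
move=> h hd.
have [l1 l2] : vnorm h < d /\ vnorm h < r.
  by have := Rmin_l (Rmin d r) (Rmin (Q / (KB * K)) (m / (2 * K)));
    have := Rmin_l d r; have := Rmin_r d r; lra.
have [l3 l4] : vnorm h < Q / (KB * K) /\ vnorm h < m / (2 * K).
  by have := Rmin_r (Rmin d r) (Rmin (Q / (KB * K)) (m / (2 * K)));
    have := Rmin_l (Q / (KB * K)) (m / (2 * K));
    have := Rmin_r (Q / (KB * K)) (m / (2 * K)); lra.
have a1 := H h l1; have a2 := I h l2; have a3 := BK h; have h0 := vnorm_ge0 h.
set dg := (g (vadd z h) - g z)%C in a1 a2.
have Kh : K * vnorm h <= m / 2.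
  have : K * vnorm h <= K * (m / (2 * K)) by apply: Rmult_le_compat_l; lra.
  by rewrite (_ : K * (m / (2 * K)) = m / 2); last by field; lra.
have gh : m / 2 <= Cmod (g (vadd z h)).
  have := Cmod_sub_ge (g z) (- dg)%C; rewrite Cmod_opp -/m.
  by rewrite (_ : (g z - - dg)%C = g (vadd z h)); [lra|rewrite /dg; ring].
have gz' : g (vadd z h) <> RtoC 0 by apply/Cmod_gt_0; lra.
have -> : (/ g (vadd z h) - / g z - - (B h / (g z * g z)))%C =
  ((- (g z * (dg - B h)) + B h * dg) / (g z * g z * g (vadd z h)))%C.
  by rewrite /dg; field.
rewrite Cmod_div; last by do !apply: Cmult_neq_0.
rewrite !Cmod_mult -/m.
have num : Cmod (- (g z * (dg - B h)) + B h * dg)%C <= 2 * Q * vnorm h.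
  apply: Rle_trans (Cmod_triangle _ _) _; rewrite Cmod_opp !Cmod_mult -/m.
  have b1 : m * Cmod (dg - B h)%C <= m * (Q / m * vnorm h) by apply: Rmult_le_compat_l; lra.
  have b2 : m * (Q / m * vnorm h) = Q * vnorm h by field; lra.
  have b3 : Cmod (B h) * Cmod dg <= KB * vnorm h * (K * vnorm h).
    by apply: Rmult_le_compat => //; exact: Cmod_ge_0.
  have b4 : KB * K * vnorm h <= KB * K * (Q / (KB * K)) by apply: Rmult_le_compat_l; lra.
  rewrite (_ : KB * K * (Q / (KB * K)) = Q) in b4; last by field; lra.
  have : KB * K * vnorm h * vnorm h <= Q * vnorm h by apply: Rmult_le_compat_r.
  lra.
have den : m * m * (m / 2) <= m * m * Cmod (g (vadd z h)) by apply: Rmult_le_compat_l; lra.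
have dpos : 0 < m * m * (m / 2) by apply: Rmult_lt_0_compat; lra.
apply: Rle_trans (_ : 2 * Q * vnorm h * / (m * m * (m / 2)) <= _).
  apply: Rmult_le_compat => //; first exact: Cmod_ge_0.
    by apply/Rlt_le/Rinv_0_lt_compat; lra.
  exact: Rinv_le_contravar.
by right; rewrite /Q; field; lra.
Qed.

Lemma complex_diff_div (f g : Cn n -> Complex.C) z : g z <> RtoC 0 ->
  complex_diff f z -> complex_diff g z -> complex_diff (fun z => (f z / g z)%C) z.
Proof. by move=> g0 df dg; apply: complex_diff_mul => //; exact: complex_diff_inv. Qed.

Lemma complex_diff_sub (f g : Cn n -> Complex.C) z :
  complex_diff f z -> complex_diff g z -> complex_diff (fun z => (f z - g z)%C) z.
Proof.
move=> df dg; have -> : (fun z => (f z - g z)%C) = fun z => (f z + (- (1)) * g z)%C.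
  by apply: functional_extensionality => x; ring.
apply: complex_diff_add => //; apply: complex_diff_mul => //; exact: complex_diff_const.
Qed.

Lemma complex_diff_sum (m : nat) (F : 'I_m -> Cn n -> Complex.C) z :
  (forall i, complex_diff (F i) z) ->
  complex_diff (fun z => \big[Cplus/RtoC 0]_(i < m) F i z) z.
Proof.
move=> dF; elim: (index_enum _) => [|i s IH].
  have -> : (fun z => \big[Cplus/RtoC 0]_(i <- [::]) F i z) = fun=> RtoC 0.
    by apply: functional_extensionality => ?; rewrite big_nil.
  exact: complex_diff_const.
have -> : (fun z => \big[Cplus/RtoC 0]_(j <- i :: s) F j z) =
  (fun z => (F i z + \big[Cplus/RtoC 0]_(j <- s) F j z)%C).
  by apply: functional_extensionality => ?; rewrite big_cons.
exact: complex_diff_add.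
Qed.

Lemma complex_diff_linear_comp (A : Cn n -> Complex.C) (F : Cn n -> Cn n) z :
  linear_form A -> (forall i, complex_diff (fun z => F z i) z) ->
  complex_diff (fun z => A (F z)) z.
Proof.
move=> Al dF.
have -> : (fun z => A (F z)) = fun z => \big[Cplus/RtoC 0]_(i < n) Cmult (A (ebasis i)) (F z i).
  by apply: functional_extensionality => ?; rewrite -linear_formE.
apply: complex_diff_sum => i; apply: complex_diff_mul; last exact: dF.
exact: complex_diff_const.
Qed.

Lemma holomorphic_on_components (U : Cn n -> Prop) (F : Cn n -> Cn n) :
  (forall z i, U z -> complex_diff (fun z => F z i) z) -> holomorphic_on U F.
Proof.
move=> dF z Uz.
have [A AP] := choice (fun i A => linear_form A /\
  forall eps, 0 < eps -> exists d, 0 < d /\ forall h, vnorm h < d ->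
    Cmod ((F (vadd z h) i : Complex.C) - F z i - A h)%C <= eps * vnorm h) (fun i => dF z i Uz).
exists (fun i j => A i (ebasis j)) => eps e0.
have n0 := pos_INR n.
have en : 0 < eps / (INR n + 1) by apply: Rdiv_lt_0_compat; lra.
have [d [d0 H]] : exists d, 0 < d /\ forall i h, vnorm h < d ->
    Cmod ((F (vadd z h) i : Complex.C) - F z i - A i h)%C <= eps / (INR n + 1) * vnorm h.
  apply: finite_common_radius => [i d d' d'd H h hd|i]; first by apply: H; lra.
  exact: (proj2 (AP i)).
exists d; split=> // h hd _.
apply: Rle_trans (vnorm_le_const _ (eps / (INR n + 1) * vnorm h) _) _.
  move=> i; rewrite !vsubE.
  have -> : cmatvec (fun i j => A i (ebasis j)) h i = A i h.
    by rewrite (linear_formE (A i) h (proj1 (AP i))).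
  exact: H.
have h0 := vnorm_ge0 h.
have -> : INR n * (eps / (INR n + 1) * vnorm h) = INR n / (INR n + 1) * (eps * vnorm h).
  by field; lra.
have : INR n / (INR n + 1) <= 1.
  apply: (Rmult_le_reg_r (INR n + 1)); first by lra.
  by rewrite /Rdiv Rmult_assoc Rinv_l; lra.
have : 0 <= eps * vnorm h by nonneg.
nra.
Qed.

End Holomorphy.

(** * The map to the ball *)

Section Model.
Context {n : nat}.
Variables (j0 : 'I_n) (H : Cn n -> R) (S : Cn n -> Complex.C) (E F : Cn n -> Cn n)
  (L : Cn n -> Complex.C) (p : Cn n) (M l : R).
(** Independence of coordinate [j0] makes the shear invertible: [S] and [H] are known from the other
    coordinates before [w] is. *)
Hypothesis Slocal : forall h g, (forall i, i != j0 -> h i = g i) -> S h = S g.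
Hypothesis Hlocal : forall h g, (forall i, i != j0 -> h i = g i) -> H h = H g.
Hypothesis Sscale : forall c h, S (cscal c h) = (c * c * S h)%C.
Hypothesis Hscale : forall c h, H (cscal c h) = Cmod c * Cmod c * H h.
Hypothesis Sdiff : forall z, complex_diff (fun z => S (vsub z p)) z.
Hypothesis Elin : forall i, linear_form (fun v => E v i).
Hypothesis EF : forall x, E (F x) = x.
Hypothesis FE : forall v, F (E v) = v.
Hypothesis Enorm : forall v, vnorm (E v) * vnorm (E v) = H v + Cmod (v j0) * Cmod (v j0).
Hypothesis Llin : linear_form L.
Hypothesis Lj0 : L (ebasis j0) <> RtoC 0.
Hypothesis M0 : 0 < M.
Hypothesis l0 : 0 < l.

Definition denom (z : Cn n) : Complex.C := (1 + M * L (vsub z p))%C.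
(* The first coordinate after the projective map [w / (1 + M w)] and the shear killing the pluriharmonic part of the quadratic form. *)
Definition sheared (z : Cn n) : Complex.C :=
  ((L (vsub z p) * denom z - S (vsub z p)) / (denom z * denom z))%C.
(* The Cayley transform of the anisotropic dilation of parameter [l]. *)
Definition cayley (z : Cn n) : Cn n := fun i =>
  if i == j0 then ((sheared z - l) / (sheared z + l))%C
  else (RtoC (2 * sqrt l) / (denom z * (sheared z + l)) * vsub z p i)%C.
Definition ball_map (z : Cn n) : Cn n := E (cayley z).

Definition regular (z : Cn n) := denom z <> RtoC 0 /\ (sheared z + l)%C <> RtoC 0.

Lemma sqrt_l_sqr : sqrt l * sqrt l = l.
Proof. by apply: sqrt_sqrt; lra. Qed.
Lemma sqrt_l_pos : 0 < sqrt l.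
Proof. exact: sqrt_lt_R0. Qed.

Lemma ball_map_diff z i : regular z -> complex_diff (fun z => ball_map z i) z.
Proof.
move=> [u0 P0].
have dL : complex_diff (fun z => L (vsub z p)) z by exact: complex_diff_linear.
have du : complex_diff denom z.
  by apply: complex_diff_add; [|apply: complex_diff_mul => //]; exact: complex_diff_const.
have dP : complex_diff sheared z.
  apply: complex_diff_div; first exact: Cmult_neq_0.
    by apply: complex_diff_sub => //; apply: complex_diff_mul.
  exact: complex_diff_mul.
have dPl : complex_diff (fun z => (sheared z + l)%C) z.
  by apply: complex_diff_add => //; exact: complex_diff_const.
apply: (complex_diff_linear_comp (fun v => E v i)) => // j.
rewrite /cayley; case: eqP => _.
  apply: complex_diff_div => //; apply: complex_diff_sub => //; exact: complex_diff_const.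
apply: complex_diff_mul.
  apply: complex_diff_div; [exact: Cmult_neq_0|exact: complex_diff_const|].
  exact: complex_diff_mul.
apply: (complex_diff_linear (fun v => v j : Complex.C)).
by split=> *; [rewrite vaddE|rewrite /cscal].
Qed.

(** [|P - l|^2 = |P + l|^2 - 4 l Re P] supplies the [Re P] term, and the factor [2 sqrt l] on the
    other coordinates supplies [4 l H / |u|^2]. *)
Lemma ball_map_norm z : regular z ->
  vnorm (ball_map z) * vnorm (ball_map z) = 1 +
  4 * l * (H (vsub z p) / (Cmod (denom z) * Cmod (denom z)) - Re (sheared z)) /
    (Cmod (sheared z + l)%C * Cmod (sheared z + l)%C).
Proof.
move=> [u0 P0]; rewrite /ball_map Enorm.
rewrite (Hlocal (cayley z) (cscal (RtoC (2 * sqrt l) / (denom z * (sheared z + l)))%C (vsub z p))); last first.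
  by move=> i ij; rewrite /cayley (negbTE ij).
rewrite /cayley eqxx Hscale !Cmod_div //; last exact: Cmult_neq_0.
have up := Cmod_pos_neq0 _ u0; have Pp := Cmod_pos_neq0 _ P0.
rewrite !Cmod_mult Cmod_R Rabs_right; last by have := sqrt_l_pos; lra.
have sub : Cmod (sheared z - l)%C * Cmod (sheared z - l)%C =
    Cmod (sheared z + l)%C * Cmod (sheared z + l)%C - 4 * l * Re (sheared z).
  by rewrite !Cmod_sqr; case: (sheared z) => x y; rewrite /Re /Im /=; ring.
have -> : Cmod (sheared z - l) / Cmod (sheared z + l) * (Cmod (sheared z - l) / Cmod (sheared z + l)) =
  (Cmod (sheared z - l)%C * Cmod (sheared z - l)%C) / (Cmod (sheared z + l)%C * Cmod (sheared z + l)%C).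
  by field; lra.
rewrite sub.
have -> : 2 * sqrt l / (Cmod (denom z) * Cmod (sheared z + l)) *
  (2 * sqrt l / (Cmod (denom z) * Cmod (sheared z + l))) =
  4 * (sqrt l * sqrt l) / (Cmod (denom z) * Cmod (denom z) * (Cmod (sheared z + l) * Cmod (sheared z + l))).
  by field; lra.
by rewrite sqrt_l_sqr; field; lra.
Qed.

(** The data are recovered in order: [P] from the Cayley coordinate, then [h_i / u] for [i != j0],
    then [S / u^2] by homogeneity and locality, [w / u = P + S / u^2], and [u] from
    [1 / u = 1 - M (w / u)]. Finally [w] determines the coordinate [j0], as [L (ebasis j0)] is
    nonzero. *)
Lemma ball_map_inj z z' : regular z -> regular z' -> ball_map z = ball_map z' -> z = z'.
Proof.
move=> [u0 P0] [u0' P0'] ee.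
have {}ee : cayley z = cayley z' by rewrite -(FE (cayley z)) -(FE (cayley z')) -/(ball_map z) ee.
have l00 : RtoC l <> RtoC 0 by case; lra.
have sl0 : RtoC (2 * sqrt l) <> RtoC 0 by case; have := sqrt_l_pos; lra.
have eP : sheared z = sheared z'.
  have := f_equal (fun v : Cn n => v j0 : Complex.C) ee; rewrite /cayley eqxx => e.
  have e2 : ((sheared z - l) * (sheared z' + l) = (sheared z' - l) * (sheared z + l))%C.
    have -> : (sheared z - l)%C = ((sheared z - l) / (sheared z + l) * (sheared z + l))%C by field.
    by rewrite e; field.
  have e3 : (RtoC 2 * RtoC l * (sheared z - sheared z'))%C = RtoC 0.
    have -> : (RtoC 2 * RtoC l * (sheared z - sheared z'))%C =
      ((sheared z - l) * (sheared z' + l) - (sheared z' - l) * (sheared z + l))%C by ring.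
    by rewrite e2; ring.
  apply: NNPP => ne; have := Cmult_neq_0 (RtoC 2 * RtoC l)%C (sheared z - sheared z')%C.
  move=> /(_ _ _ e3); apply; first by apply: Cmult_neq_0 => //; case; lra.
  move=> e4; apply: ne; have -> : sheared z = (sheared z - sheared z' + sheared z')%C by ring.
  by rewrite e4; ring.
have er i : i != j0 -> (vsub z p i / denom z = vsub z' p i / denom z' :> Complex.C)%C.
  move=> ij; have := f_equal (fun v : Cn n => v i : Complex.C) ee; rewrite /cayley (negbTE ij) -eP.
  rewrite -eP in P0' => e.
  have k (a d : Complex.C) : d <> RtoC 0 -> (a / d = (sheared z + l) / RtoC (2 * sqrt l) *
      (RtoC (2 * sqrt l) / (d * (sheared z + l)) * a))%C by move=> d0; field.
  by rewrite (k _ _ u0) (k _ _ u0') e.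
have eS : (S (vsub z p) / (denom z * denom z) = S (vsub z' p) / (denom z' * denom z'))%C.
  have k v d : d <> RtoC 0 -> (S v / (d * d))%C = S (cscal (/ d)%C v).
    by move=> d0; rewrite Sscale; field.
  rewrite (k _ _ u0) (k _ _ u0'); apply: Slocal => i ij.
  have := er i ij; rewrite /cscal /Cdiv => e.
  by change (Cmult (/ denom z) (vsub z p i) = Cmult (/ denom z') (vsub z' p i));
    rewrite Cmult_comm e Cmult_comm.
have ea : (L (vsub z p) / denom z = L (vsub z' p) / denom z')%C.
  have k x : denom x <> RtoC 0 -> (L (vsub x p) / denom x =
      sheared x + S (vsub x p) / (denom x * denom x))%C.
    by move=> d0; rewrite /sheared; field.
  by rewrite !k // eP eS.
have eu : (/ denom z = / denom z')%C.
  have k x : denom x <> RtoC 0 -> (/ denom x = 1 - M * (L (vsub x p) / denom x))%C.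
    move=> d0; have -> : (1 - M * (L (vsub x p) / denom x))%C =
      ((denom x - M * L (vsub x p)) / denom x)%C by field.
    by rewrite {2}/denom; field.
  by rewrite !k // ea.
have ed : denom z = denom z'.
  rewrite -[denom z]Cmult_1_r -(Cinv_l (denom z') u0') -eu.
  by field.
have eL : L (vsub z p) = L (vsub z' p).
  have -> : L (vsub z p) = (L (vsub z p) / denom z * denom z)%C by field.
  by rewrite ea ed; field.
have ei i : i != j0 -> vsub z p i = vsub z' p i.
  move=> ij; have := er i ij; rewrite ed => e.
  have k (a : Complex.C) : a = (a / denom z' * denom z')%C by field.
  by rewrite [LHS](k (vsub z p i)) e -(k (vsub z' p i)).
pose x := vsub z z'.
have xz i : i != j0 -> x i = RtoC 0 :> Complex.C.
  move=> ij; have := ei i ij; rewrite /x !vsubE => e.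
  have -> : (z i - z' i)%C = ((z i - p i) - (z' i - p i))%C :> Complex.C by cring.
  by rewrite e; cring.
have xe : x = cscal (x j0) (ebasis j0).
  apply: functional_extensionality => i; rewrite /cscal /ebasis.
  case: eqP => [->|/eqP ij]; first by cring.
  by rewrite xz //; cring.
have Lx : L x = RtoC 0.
  rewrite /x linear_formB //; have := eL; rewrite !linear_formB // => e.
  have -> : (L z - L z' = (L z - L p) - (L z' - L p))%C by ring.
  by rewrite e; ring.
have x0 : x j0 = RtoC 0 :> Complex.C.
  move: Lx; rewrite {1}xe (proj2 Llin) => e.
  apply: NNPP => ne; exact: (Cmult_neq_0 _ _ ne Lj0 e).
have {}x0 : x = vzero n.
  by rewrite xe x0 cscal0.
by rewrite -(vsubK z z') -/x x0 vaddC vadd0.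
Qed.

(** Solving the equations backwards: [P = l (1 + v j0) / t], and undoing the shear gives
    [a = w / u], so [g = 1 - M a] is [1 / u]. *)
Lemma cayley_surj (v : Cn n) : let t := (1 - v j0)%C in
  let a := (l * ((1 + v j0) / t + S v / (t * t)))%C in let g := (1 - M * a)%C in
  t <> RtoC 0 -> g <> RtoC 0 ->
  exists h, [/\ L h = (a / g)%C, H h = l * H v / (Cmod t * Cmod t * (Cmod g * Cmod g)),
    S h = (l * (S v / (t * t)) / (g * g))%C & cayley (vadd p h) = v].
Proof.
move=> t a g t0 g0.
pose c := (RtoC (sqrt l) / (t * g))%C.
have sl : (RtoC (sqrt l) * RtoC (sqrt l))%C = RtoC l by rewrite -RtoC_mult sqrt_l_sqr.
pose h0 : Cn n := cscal c v.
(* Coordinate [j0] is invisible to [H] and [S], so it is free to be adjusted until [L h] is the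
   required [a / g]. *)
pose h : Cn n := vadd h0 (cscal ((a / g - L h0) / L (ebasis j0))%C (ebasis j0)).
have hi i : i != j0 -> h i = h0 i.
  by move=> ij; rewrite /h vaddE /cscal /ebasis (negbTE ij); cring.
have Lh : L h = (a / g)%C.
  by rewrite /h (proj1 Llin) (proj2 Llin); field.
have Sh : S h = (l * (S v / (t * t)) / (g * g))%C.
  by rewrite (Slocal h h0 hi) /h0 Sscale -sl /c; field.
exists h; split=> //.
  rewrite (Hlocal h h0 hi) /h0 Hscale /c Cmod_div; last exact: Cmult_neq_0.
  have tp := Cmod_pos_neq0 _ t0; have gp := Cmod_pos_neq0 _ g0.
  rewrite Cmod_mult Cmod_R Rabs_right; last by have := sqrt_l_pos; lra.
  by rewrite -{3}sqrt_l_sqr; field; lra.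
have l00 : RtoC l <> RtoC 0 by case; lra.
have s00 : RtoC (sqrt l) <> RtoC 0 by case; have := sqrt_l_pos; lra.
have du : denom (vadd p h) = (/ g)%C.
  by rewrite /denom vaddK Lh /g; field.
have sh : sheared (vadd p h) = (l * ((1 + v j0) / t))%C.
  rewrite /sheared du vaddK Lh Sh /a; field.
  by split=> //; split.
have two : RtoC 2 <> RtoC 0 by case; lra.
have spl : (sheared (vadd p h) + l)%C = (RtoC 2 * l / t)%C.
  by rewrite sh /t; field.
have sml : (sheared (vadd p h) - l)%C = (RtoC 2 * l * v j0 / t)%C.
  by rewrite sh /t; field.
apply: functional_extensionality => i; rewrite /cayley spl sml du vaddK.
case: eqP => [->|/eqP ij].
  by change ((2 * l * v j0 / t / (2 * l / t))%C = v j0 :> Complex.C); field.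
rewrite hi // /h0 /cscal /c RtoC_mult -sl.
change ((RtoC 2 * RtoC (sqrt l) / (/ g * (RtoC 2 * (RtoC (sqrt l) * RtoC (sqrt l)) / t)) *
  (RtoC (sqrt l) / (t * g) * (v i : Complex.C)))%C = v i :> Complex.C).
by field.
Qed.

(** Along [e] both [S] and [H] vanish, and with [k = L e] and [m = M l k] the Cayley coordinate is
    [(k - 1 - m) / (k + 1 + m)], small because [k] is near 1 and [m] near 0. *)
Lemma ball_map_center (eps : R) e : (forall i, i != j0 -> e i = RtoC 0 :> Complex.C) ->
  0 < eps <= 1 -> Cmod (L e - 1)%C <= eps / 8 -> M * l <= eps / 8 ->
  vnorm (ball_map (vadd p (vscal l e))) <= eps.
Proof.
move=> ez [eps0 eps1] kap Ml; set q := vadd p (vscal l e).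
have S0 : S (vsub q p) = RtoC 0.
  rewrite vaddK (Slocal _ (cscal (RtoC 0) e)) ?Sscale; first by ring.
  by move=> i /ez e0; rewrite vscalE /cscal e0; cring.
have Lq : L (vsub q p) = (l * L e)%C by rewrite vaddK vscalE (proj2 Llin).
set k := L e in kap Lq.
have k2 : Cmod k <= 9 / 8.
  have := Cmod_triangle (k - 1)%C 1%C; rewrite Cmod_1 (_ : (k - 1 + 1)%C = k); last by ring.
  lra.
pose m := (M * l * k)%C.
have m1 : Cmod m <= eps / 8 * (9 / 8).
  rewrite /m !Cmod_mult !Cmod_R !Rabs_right; try lra.
  by apply: Rmult_le_compat; [nra|exact: Cmod_ge_0|lra|lra].
have m0 := Cmod_ge_0 m.
have du : denom q = (1 + m)%C by rewrite /denom Lq /m; ring.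
have u0 : (1 + m)%C <> RtoC 0.
  apply/Cmod_gt_0; have := Cmod_sub_ge 1%C (- m)%C.
  by rewrite Cmod_opp Cmod_1 (_ : (1 - - m)%C = (1 + m)%C); [lra|ring].
have sh : sheared q = (l * k / (1 + m))%C.
  by rewrite /sheared S0 du Lq; field.
pose num := (k - 1 - m)%C; pose den := (k + 1 + m)%C.
have nb : Cmod num <= 3 / 10 * eps.
  by have := Cmod_sub_le (k - 1)%C m; rewrite -/num; lra.
have db : 1 <= Cmod den.
  have := Cmod_sub_ge 2%C (- (k - 1) - m)%C; have := Cmod_sub_le (- (k - 1))%C m.
  rewrite Cmod_opp Cmod_R Rabs_right; last by lra.
  by rewrite (_ : (2 - (- (k - 1) - m))%C = den); [lra|rewrite /den; ring].
have den0 : den <> RtoC 0 by apply/Cmod_gt_0; lra.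
have l00 : RtoC l <> RtoC 0 by case; lra.
have cj : cayley q j0 = (num / den)%C :> Complex.C.
  rewrite /cayley eqxx sh /num /den; field; split; [exact: den0|split; [exact: u0|]].
  have := Cmult_neq_0 _ _ l00 den0.
  by rewrite (_ : (l * den)%C = (l * k + l * (1 + m))%C) // /den; ring.
have Hq : H (cayley q) = 0.
  rewrite (Hlocal _ (cscal (RtoC 0) e)) ?Hscale ?Cmod_0; first by ring.
  move=> i ij; rewrite /cayley (negbTE ij) vaddK vscalE /cscal (ez _ ij); cring.
have := Enorm (cayley q); rewrite -/(ball_map q) Hq cj Cmod_div // => nn.
have nd : Cmod num / Cmod den <= eps.
  apply: (Rmult_le_reg_r (Cmod den)); first by lra.
  by rewrite /Rdiv Rmult_assoc Rinv_l; nra.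
have nd0 : 0 <= Cmod num / Cmod den.
  by apply: Rmult_le_pos; [exact: Cmod_ge_0|apply/Rlt_le/Rinv_0_lt_compat; lra].
by have := vnorm_ge0 (ball_map q); nra.
Qed.

End Model.

(** * The boundary model *)

Section TangentProjection.
Context {n : nat}.
Variables (L : Cn n -> Cn n -> Complex.C) (p e : Cn n) (j0 : 'I_n).
Hypothesis Llin : linear_form (L p).
Hypothesis Le : L p e = RtoC 1.
Hypothesis ez : forall i, i != j0 -> e i = RtoC 0 :> Complex.C.
Hypothesis ej0 : e j0 <> RtoC 0 :> Complex.C.
Implicit Types (h g w : Cn n).
Let k := tangent_proj L p e.

Lemma tangent_projD h w : k (vadd h w) = vadd (k h) (k w).
Proof.
rewrite /k /tangent_proj (proj1 Llin); apply: functional_extensionality => i.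
by rewrite !vaddE !vsubE vaddE /cscal; cring.
Qed.

Lemma tangent_projZ c h : k (cscal c h) = cscal c (k h).
Proof.
rewrite /k /tangent_proj (proj2 Llin); apply: functional_extensionality => i.
by rewrite /cscal !vsubE /cscal; cring.
Qed.

Lemma tangent_projZr t h : k (vscal t h) = vscal t (k h).
Proof. by rewrite !vscalE tangent_projZ. Qed.

Lemma tangent_proj_ker h : L p (k h) = RtoC 0.
Proof. by rewrite /k /tangent_proj linear_formB // (proj2 Llin) Le; cring. Qed.

Lemma tangent_proj_coord h i : i != j0 -> k h i = h i.
Proof. by move=> ij; rewrite /k /tangent_proj vsubE /cscal ez //; cring. Qed.

Lemma tangent_proj_local h g : (forall i, i != j0 -> h i = g i) -> k h = k g.
Proof.
move=> hg; pose a := ((h j0 - g j0) / e j0)%C.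
have -> : h = vadd g (cscal a e).
  apply: functional_extensionality => i; rewrite vaddE /cscal.
  have [->|ij] := eqVneq i j0; last by rewrite ez // hg //; cring.
  by rewrite /a; move: ej0; to_complex => ?; to_complex; field.
rewrite tangent_projD tangent_projZ.
have -> : k e = vzero n.
  by apply: functional_extensionality => i; rewrite /k /tangent_proj vsubE Le /cscal vzeroE; cring.
apply: functional_extensionality => i; rewrite vaddE /cscal vzeroE; cring.
Qed.

Lemma tangent_proj_bound : exists K, 0 < K /\ forall h, vnorm (k h) <= K * vnorm h.
Proof.
have [B [B0 LB]] := linear_form_bound (L p) Llin; have e0 := vnorm_ge0 e.
exists (1 + B * vnorm e); split; first by nra.
move=> h; rewrite /k /tangent_proj vsub_add cscalA.
apply: Rle_trans (vnorm_triangle _ _) _; rewrite vnorm_cscal Cmod_mult Cmod_opp Cmod_1.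
have : Cmod (L p h) * vnorm e <= B * vnorm h * vnorm e by apply: Rmult_le_compat_r.
lra.
Qed.

Lemma real_quadratic_proj b : real_quadratic b -> real_quadratic (fun h w => b (k h) (k w)).
Proof.
move=> [bD bZ bC [K [K0 bK]]]; split=> [h g w|t h w|h w|].
- by rewrite tangent_projD bD.
- by rewrite tangent_projZr bZ.
- exact: bC.
have [N [N0 kN]] := tangent_proj_bound.
exists (K * (N * N)); split; first by do !apply: Rmult_lt_0_compat.
move=> h w; apply: Rle_trans (bK _ _) _; rewrite Rmult_assoc.
apply: Rmult_le_compat_l; first by lra.
have -> : N * N * (vnorm h * vnorm w) = (N * vnorm h) * (N * vnorm w) by ring.
by apply: Rmult_le_compat; rewrite ?kN //; exact: vnorm_ge0.
Qed.

End TangentProjection.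

(** Fix a small step [s] with [rho (p - s e) > 0]. By continuity [rho (q - s e) > 0] for [q] near
    [p], while [rho q < 0], so the intermediate value theorem finds a boundary point on the
    segment. *)
Lemma boundary_crossing n (D U : Cn n -> Prop) (rho : Cn n -> R) (p e : Cn n) :
  is_open U -> U p -> (forall z, U z -> (D z <-> rho z < 0)) -> continuous_on U rho ->
  (exists s0, 0 < s0 /\ forall s, 0 < s < s0 -> 0 < rho (vadd p (vscal (- s) e))) ->
  forall r, 0 < r -> exists delta, 0 < delta /\ forall q, D q -> vnorm (vsub q p) < delta ->
    exists p' s, [/\ 0 < s < r, vnorm (vsub p' p) < r, rho p' = 0 & q = vadd p' (vscal s e)].
Proof.
move=> Uo Up Drho crho [s0 [s00 pos]] r r0.
have [r1 [r10 Ur1]] := Uo p Up.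
have e0 := vnorm_ge0 e.
pose m := Rmin r r1.
have m0 : 0 < m by apply: Rmin_glb_lt.
have mr : m <= r by exact: Rmin_l.
have mr1 : m <= r1 by exact: Rmin_r.
pose s := Rmin (s0 / 2) (Rmin (r / 2) (m / (4 * (vnorm e + 1)))).
have s_pos : 0 < s.
  by do !apply: Rmin_glb_lt; try lra; apply: Rdiv_lt_0_compat; lra.
have ss0 : s <= s0 / 2 by exact: Rmin_l.
have sr : s <= r / 2 by apply: Rle_trans (Rmin_r _ _) (Rmin_l _ _).
have sm : s <= m / (4 * (vnorm e + 1)) by apply: Rle_trans (Rmin_r _ _) (Rmin_r _ _).
have sE : s * vnorm e <= m / 4.
  have : s * (4 * (vnorm e + 1)) <= m / (4 * (vnorm e + 1)) * (4 * (vnorm e + 1)).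
    by apply: Rmult_le_compat_r; lra.
  by rewrite (_ : m / (4 * (vnorm e + 1)) * (4 * (vnorm e + 1)) = m); [lra|field; lra].
pose y := vadd p (vscal (- s) e).
have yp : vnorm (vsub y p) <= m / 4.
  by rewrite vaddK vnorm_vscal Rabs_Ropp Rabs_right; lra.
have Uy : U y by apply: Ur1; lra.
have ry : 0 < rho y by apply: pos; lra.
have [d [d0 Hd]] := crho y Uy _ ry.
exists (Rmin d (m / 4)); split; first by apply: Rmin_glb_lt; lra.
move=> q Dq qp.
have qd : vnorm (vsub q p) < d by have := Rmin_l d (m / 4); lra.
have qm : vnorm (vsub q p) < m / 4 by have := Rmin_r d (m / 4); lra.
pose x t := vadd q (vscal (- t) e).
have xp t : 0 <= t <= s -> vnorm (vsub (x t) p) < m / 2.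
  move=> [t0 ts]; have -> : vsub (x t) p = vadd (vsub q p) (vscal (- t) e).
    by rewrite /x; apply: functional_extensionality => i; rewrite vaddE !vsubE vaddE; cring.
  apply: Rle_lt_trans (vnorm_triangle _ _) _; rewrite vnorm_vscal Rabs_Ropp Rabs_right; last by lra.
  have : t * vnorm e <= s * vnorm e by apply: Rmult_le_compat_r.
  lra.
have Ux t : 0 <= t <= s -> U (x t) by move=> /xp h; apply: Ur1; lra.
have x0 : x 0 = q.
  by rewrite /x Ropp_0 vscalE cscal0 vaddC vadd0.
have xc a : 0 <= a <= s -> continuity_pt (fun t => rho (x t)) a.
  move=> as_ eps eps0; have Ua := Ux a as_.
  have [r2 [r20 Ur2]] := Uo _ Ua; have [d2 [d20 Hd2]] := crho _ Ua eps eps0.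
  exists (Rmin r2 d2 / (vnorm e + 1)); split.
    by apply: Rdiv_lt_0_compat; [exact: Rmin_glb_lt|lra].
  move=> t [_]; rewrite /dist /= /Rdist => ta.
  have xx : vnorm (vsub (x t) (x a)) < Rmin r2 d2.
    have -> : vsub (x t) (x a) = vscal (a - t) e.
      rewrite /x; apply: functional_extensionality => i.
      rewrite vsubE !vaddE !vscalE /cscal !RtoC_opp RtoC_minus; cring.
    rewrite vnorm_vscal Rabs_minus_sym.
    have : Rabs (t - a) * (vnorm e + 1) < Rmin r2 d2 / (vnorm e + 1) * (vnorm e + 1).
      by apply: Rmult_lt_compat_r; lra.
    rewrite (_ : Rmin r2 d2 / (vnorm e + 1) * (vnorm e + 1) = Rmin r2 d2); last by field; lra.
    by have := Rabs_pos (t - a); lra.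
  apply: Hd2; last by have := Rmin_r r2 d2; lra.
  by apply: Ur2; have := Rmin_l r2 d2; lra.
have fx0 : rho (x 0) < 0.
  by rewrite x0; apply/Drho => //; rewrite -x0; apply: Ux; lra.
have fxs : 0 < rho (x s).
  have := Hd (x s) (Ux s ltac:(lra)).
  have -> : vsub (x s) y = vsub q p.
    by rewrite /x /y; apply: functional_extensionality => i; rewrite !vsubE !vaddE; cring.
  by move=> /(_ qd) /Rabs_def2; lra.
have [t [ts rt]] := Ranalysis5.IVT_interv (fun t => rho (x t)) 0 s xc s_pos fx0 fxs.
have t0 : t <> 0 by move=> e1; move: rt fx0; rewrite e1; lra.
exists (x t), t; split=> //; try by lra.
  by have := xp t ts; lra.
rewrite /x -vaddA !vscalE -cscalDl -RtoC_plus (_ : - t + t = 0); last by ring.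
by rewrite cscal0 vaddC vadd0.
Qed.

Definition local_at {n} (j0 : 'I_n) {T} (G : Cn n -> T) :=
  forall h g : Cn n, (forall i, i != j0 -> h i = g i) -> G h = G g.

(* [H] and [Re S] are the Hermitian and pluriharmonic parts of the second-order term of the boundary, in coordinates moving with the boundary point [p'] through [L p']. *)
Lemma boundary_model n (D : Cn n -> Prop) (p : Cn n) : spherically_extreme D p ->
  exists (j0 : 'I_n) (e : Cn n) (L : Cn n -> Cn n -> Complex.C) (H : Cn n -> R)
    (S : Cn n -> Complex.C) (E F : Cn n -> Cn n) (bd : Cn n -> Prop) (c1 c2 Rb : R),
  (local_at j0 S /\ local_at j0 H /\ (forall c h, S (cscal c h) = (c * c * S h)%C) /\
   (forall c h, H (cscal c h) = Cmod c * Cmod c * H h) /\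
   (forall z0 z, complex_diff (fun z => S (vsub z z0)) z) /\
   (forall z, linear_form (L z)) /\ (forall i, i != j0 -> e i = RtoC 0 :> Complex.C)) /\
  ((forall i, linear_form (fun v => E v i)) /\ (forall x, E (F x) = x) /\
   (forall v, F (E v) = v) /\
   (forall v, vnorm (E v) * vnorm (E v) = H v + Cmod (v j0) * Cmod (v j0))) /\
  (0 < c1 /\ 0 < c2 /\ 0 < Rb /\ (forall h, 0 <= H h) /\
   (forall h, Cmod (S h) <= (1 - c1) * H h)) /\
  (forall r, 0 < r -> exists delta, 0 < delta /\ forall q, D q -> vnorm (vsub q p) < delta ->
    exists p' s, [/\ 0 < s < r, vnorm (vsub p' p) < r, bd p' & q = vadd p' (vscal s e)]) /\
  (exists eta, 0 < eta /\ forall p', vnorm (vsub p' p) < eta -> bd p' ->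
    L p' (ebasis j0) <> RtoC 0 /\ forall z, D z ->
      c2 * H (vsub z p') <= Re (L p' (vsub z p')) /\ Cmod (L p' (vsub z p')) <= Rb) /\
  (forall eps, 0 < eps -> exists eta, 0 < eta /\ forall p', vnorm (vsub p' p) < eta ->
    Cmod (L p' e - 1)%C <= eps) /\
  (forall d, 0 < d -> exists Cq r, 0 <= Cq /\ 0 < r /\ forall p', vnorm (vsub p' p) < r ->
    bd p' -> (forall z, D z -> Cmod (L p' (vsub z p')) < r ->
      (1 - d) * H (vsub z p') + Re (S (vsub z p'))
        - Cq * (Cmod (L p' (vsub z p')) * Cmod (L p' (vsub z p'))) <= Re (L p' (vsub z p'))) /\
    (forall h, Cmod (L p' h) < r -> H h < r ->
      (1 + d) * H h + Re (S h) + Cq * (Cmod (L p' h) * Cmod (L p' h)) < Re (L p' h) ->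
      D (vadd p' h))).
Proof.
move=> [bdp [C2 [c [Rad [Rad0 [Dball pc]]]]]].
have [U [rho [L [b [Uo [Up [Drho [crho [Llin [nz [bq expn]]]]]]]]]]] :=
  C2_boundary_expansion D p C2.
have rhop := boundary_value D U rho p bdp Uo Up Drho crho.
have [j0 Lj0] := nz rhop.
(* A multiple of a coordinate vector, so that moving along [e] changes only coordinate [j0],
   normalized to [L p e = 1]. *)
pose e := cscal (/ L p (ebasis j0))%C (ebasis j0).
have Le : L p e = RtoC 1 by rewrite /e (proj2 (Llin p)); field.
have ez i : i != j0 -> e i = RtoC 0 :> Complex.C.
  by move=> ij; rewrite /e /cscal /ebasis (negbTE ij); cring.
have ej0 : e j0 <> RtoC 0 :> Complex.C.
  rewrite /e /cscal ebasis_eq => e1.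
  have : (/ L p (ebasis j0) * 1 * L p (ebasis j0))%C = (RtoC 0 * L p (ebasis j0))%C by rewrite e1.
  rewrite (_ : (/ L p (ebasis j0) * 1 * L p (ebasis j0))%C = RtoC 1); last by field.
  by rewrite Cmult_0_l; case; lra.
have [c0 [c00 outer]] := outer_at_center D U rho L b p e Drho Llin bq expn rhop Le c Rad Dball pc.
have tpos := tangential_positive D U rho L b p e Drho Llin bq expn rhop Le c0 c00 outer.
pose k := tangent_proj L p e.
(* [k h] depends only on the coordinates of [h] other than [j0], and [H] and [S] inherit this from
   [bk]. *)
pose bk h w := b (k h) (k w).
have bkq : real_quadratic bk by exact (real_quadratic_proj L p e (Llin p) b bq).
pose H h := Re (herm_part bk h h); pose S h := sym_part bk h h.
have kloc := tangent_proj_local L p e j0 (Llin p) Le ez ej0.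
have locpart h g : (forall i, i != j0 -> h i = g i) ->
    herm_part bk h h = herm_part bk g g /\ sym_part bk h h = sym_part bk g g.
  move=> hg; have e1 := kloc h g hg.
  have e2 : k (cscal Ci h) = k (cscal Ci g).
    by apply: kloc => i ij; rewrite /cscal hg.
  by rewrite /herm_part /sym_part /bk e2 /k e1.
have Sloc : local_at j0 S by move=> h g /locpart [].
have Hloc : local_at j0 H by move=> h g /locpart [+ _]; rewrite /H => ->.
have Sscale a h : S (cscal a h) = (a * a * S h)%C by exact: sym_part_scale.
have Hscale a h : H (cscal a h) = Cmod a * Cmod a * H h by exact: herm_part_scale.
have bpos h : c0 * (vnorm (k h) * vnorm (k h)) <= bk h h.
  by apply: tpos; rewrite (tangent_proj_ker L p e (Llin p) Le).
have SH0 h : Cmod (S h) <= H h - c0 * (vnorm (k h) * vnorm (k h)).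
  apply: sym_part_bound => // a a1; apply: Rle_trans (bpos _).
  by rewrite /k (tangent_projZ L p e (Llin p)) vnorm_cscal a1; right; ring.
have Hk h : c0 * (vnorm (k h) * vnorm (k h)) <= H h.
  by have := SH0 h; have := Cmod_ge_0 (S h); lra.
have H0 h : 0 <= H h by apply: Rle_trans (Hk h); nonneg.
have [KH [KH0 HKH']] := herm_part_bound bk bkq.
have HKH h : H h <= KH * (vnorm (k h) * vnorm (k h)).
  apply: Rle_trans (HKH' (k h)); right.
  by apply: Hloc => i ij; rewrite /k (tangent_proj_coord L p e j0 ez h i ij).
(* The gap [c0 |k h|^2] between [|S|] and [H] becomes a fixed proportion of [H], because
   [H h <= KH |k h|^2]. *)
pose c1 := c0 / KH.
have c10 : 0 < c1 by apply: Rdiv_lt_0_compat.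
have SH h : Cmod (S h) <= (1 - c1) * H h.
  apply: Rle_trans (SH0 h) _.
  have : c1 * H h <= c1 * (KH * (vnorm (k h) * vnorm (k h))) by apply: Rmult_le_compat_l; [lra|exact: HKH].
  rewrite (_ : c1 * (KH * (vnorm (k h) * vnorm (k h))) = c0 * (vnorm (k h) * vnorm (k h))); [lra|].
  by rewrite /c1; field; lra.
have [N [N0 kN]] := tangent_proj_bound L p e (Llin p).
have [ci [eta1 [ci0 [eta10 unif]]]] :=
  outer_uniform D U rho L b p e Drho Llin bq expn rhop Le c0 c00 outer c Rad Dball pc.
have [B [B0 LB]] := linear_form_bound (L p) (Llin p).
pose c2 := ci / (KH * (N * N)).
have KNN : 0 < KH * (N * N) by apply: Rmult_lt_0_compat => //; nra.
have c20 : 0 < c2 by apply: Rdiv_lt_0_compat.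
have c2H h : c2 * H h <= ci * (vnorm h * vnorm h).
  have -> : ci * (vnorm h * vnorm h) = c2 * (KH * (N * N) * (vnorm h * vnorm h)).
    by rewrite /c2; field; lra.
  apply: Rmult_le_compat_l; first by lra.
  apply: Rle_trans (HKH h) _; rewrite Rmult_assoc; apply: Rmult_le_compat_l; first by lra.
  have -> : N * N * (vnorm h * vnorm h) = (N * vnorm h) * (N * vnorm h) by ring.
  by have := kN h; have := vnorm_ge0 (k h); move=> ? ?; apply: Rmult_le_compat.
pose Rb := (B + 1) * (2 * Rad + 1).
have Rb0 : 0 < Rb by rewrite /Rb; apply: Rmult_lt_0_compat; lra.
(* [Phi] is the Hermitian form [H] completed by the normal coordinate. *)
pose Phi h w := (herm_part bk h w + h j0 * Cconj (w j0))%C.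
have Pherm : hermitian_form Phi.
  have [PD PZ PC] := herm_part_hermitian bk bkq.
  split=> [h z w|a h w|h w]; rewrite /Phi.
  - by rewrite PD vaddE; cring.
  - by rewrite PZ /cscal; cring.
  - by rewrite PC Cplus_conj Cmult_conj Cconj_conj; cring.
have RePhi v : Re (Phi v v) = H v + Cmod (v j0) * Cmod (v j0).
  by rewrite /Phi Cmod_sqr /H; case: (v j0) => x y; rewrite /Re /Im /=; ring.
have Ppos v : v <> vzero n -> 0 < Re (Phi v v).
  move=> v0; rewrite RePhi.
  have a0 := Cmod_ge_0 (v j0); have h0 := H0 v.
  case: (classic (v j0 = RtoC 0 :> Complex.C)) => vj; last first.
    by have := Cmod_pos_neq0 _ vj; nra.
  suff kv : 0 < vnorm (k v) by have := Hk v; have : 0 < c0 * (vnorm (k v) * vnorm (k v)) by [apply: Rmult_lt_0_compat => //; nra]; nra.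
  have [//|kv0] := Rle_lt_or_eq_dec _ _ (vnorm_ge0 (k v)).
  exfalso; apply: v0; apply: functional_extensionality => i; rewrite vzeroE.
  have [->|ij] := eqVneq i j0; first exact: vj.
  rewrite -(tangent_proj_coord L p e j0 ez v i ij).
  by rewrite -/(k v) (vnorm_eq0 _ (esym kv0)).
have [E [F [Elin EF FE Enorm]]] := hermitian_diagonalization Phi Pherm Ppos.
exists j0, e, L, H, S, E, F, (fun z => rho z = 0), c1, c2, Rb.
split; [|split; [|split; [|split; [|split; [|split]]]]].
- do 4 (split=> //); split=> // z0 z.
  have sl w := sym_part_linear bk bkq w.
  have -> : (fun z => S (vsub z z0)) = fun z => \big[Cplus/RtoC 0]_(i < n)
      (\big[Cplus/RtoC 0]_(j < n) (sym_part bk (ebasis j) (ebasis i) * vsub z z0 j)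
        * vsub z z0 i)%C.
    apply: functional_extensionality => x; rewrite /S.
    rewrite (linear_formE (fun h => sym_part bk h (vsub x z0))) //.
    apply: eq_bigr => i _; congr Cmult; rewrite sym_partC //.
    by rewrite (linear_formE (fun h => sym_part bk h (ebasis i))).
  have dcoord i : complex_diff (fun z => vsub z z0 i : Complex.C) z.
    apply: (complex_diff_linear (fun v => v i : Complex.C)).
    by split=> *; [rewrite vaddE|rewrite /cscal].
  apply: complex_diff_sum => i; apply: complex_diff_mul => //.
  by apply: complex_diff_sum => j; apply: complex_diff_mul => //; exact: complex_diff_const.
- by do 3 (split=> //); move=> v; rewrite Enorm RePhi.
- by do 4 (split=> //).
- apply: boundary_crossing Uo Up Drho crho _.
  have [_ _ _ [K [K0 bK]]] := bq.
  have [eta [eta0 ex]] := expn 1 Rlt_0_1.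
  have e0 := vnorm_ge0 e.
  pose X := (K + 1) * (vnorm e * vnorm e) + 1.
  have X0 : 0 < X by rewrite /X; nra.
  exists (Rmin (eta / (vnorm e + 1)) (/ X)); split.
    by apply: Rmin_glb_lt; [apply: Rdiv_lt_0_compat; lra|exact: Rinv_0_lt_compat].
  move=> s [s0 sm].
  have s1 : s < eta / (vnorm e + 1) by apply: Rlt_le_trans sm (Rmin_l _ _).
  have s2 : s < / X by apply: Rlt_le_trans sm (Rmin_r _ _).
  have s1' : s * (vnorm e + 1) < eta.
    have : s * (vnorm e + 1) < eta / (vnorm e + 1) * (vnorm e + 1).
      by apply: Rmult_lt_compat_r; lra.
    by rewrite (_ : eta / (vnorm e + 1) * (vnorm e + 1) = eta); last by field; lra.
  have s2' : s * X < 1.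
    have : s * X < / X * X by apply: Rmult_lt_compat_r.
    by rewrite Rinv_l; lra.
  have [_ _ /(_ (vscal (- s) e))] := ex p ltac:(rewrite vsub_self vnorm0; lra).
  rewrite vnorm_vscal Rabs_Ropp Rabs_right; last by lra.
  move=> /(_ ltac:(lra)) [_] /Rabs_le_between [+ _].
  rewrite rhop ReL_vscal // (b_vscal_sqr b bq) Le.
  have /Rabs_le_between [_ +] := bK e e; rewrite /Re /= => bb lb.
  have /Rabs_le_between [bl _] := bK e e.
  have : s * s * - (K * (vnorm e * vnorm e)) <= s * s * b e e by apply: Rmult_le_compat_l; nra.
  have : s * (s * X) < s * 1 by apply: Rmult_lt_compat_l.
  rewrite /X; nra.
- have lp0 : 0 < Cmod (L p (ebasis j0)) by exact: Cmod_pos_neq0.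
  have d0 : 0 < Rmin 1 (Cmod (L p (ebasis j0)) / 2) by apply: Rmin_glb_lt; lra.
  have [eta [eta0 ex]] := expn _ d0.
  have dl := Rmin_l 1 (Cmod (L p (ebasis j0)) / 2); have dr := Rmin_r 1 (Cmod (L p (ebasis j0)) / 2).
  exists (Rmin (Rmin eta eta1) (/ 2)); split; first by do !apply: Rmin_glb_lt; lra.
  move=> p' p'p rp'.
  have [t1 t2] : vnorm (vsub p' p) < Rmin eta eta1 /\ vnorm (vsub p' p) < / 2.
    by have := Rmin_l (Rmin eta eta1) (/ 2); have := Rmin_r (Rmin eta eta1) (/ 2); lra.
  have [t3 t4] : vnorm (vsub p' p) < eta /\ vnorm (vsub p' p) < eta1.
    by have := Rmin_l eta eta1; have := Rmin_r eta eta1; lra.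
  have [_ dL _] := ex p' t3.
  split.
    have := dL (ebasis j0); rewrite vnorm_ebasis => dj.
    apply/Cmod_gt_0; have := Cmod_sub_ge (L p (ebasis j0)) (- (L p' (ebasis j0) - L p (ebasis j0)))%C.
    rewrite Cmod_opp (_ : (L p (ebasis j0) - - (L p' (ebasis j0) - L p (ebasis j0)))%C = L p' (ebasis j0)); last by cring.
    lra.
  move=> z Dz; split; first exact: Rle_trans (c2H _) (unif p' t4 rp' z Dz).
  have hR : vnorm (vsub z p') <= 2 * Rad + 1.
    have := vnorm_sub_triangle p z p'; have := vnorm_sub_triangle c z p.
    by rewrite (vnorm_subC c p) pc (vnorm_subC p p'); have := Dball z Dz; rewrite /ball; lra.
  have h0 := vnorm_ge0 (vsub z p').
  have := Cmod_triangle (L p' (vsub z p') - L p (vsub z p'))%C (L p (vsub z p')).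
  rewrite (_ : (L p' (vsub z p') - L p (vsub z p') + L p (vsub z p'))%C = L p' (vsub z p')); last by cring.
  have d1 := dL (vsub z p'); have d2 := LB (vsub z p').
  have : Rmin 1 (Cmod (L p (ebasis j0)) / 2) * vnorm (vsub z p') <= 1 * vnorm (vsub z p').
    by apply: Rmult_le_compat_r.
  have : (B + 1) * vnorm (vsub z p') <= Rb by apply: Rmult_le_compat_l; lra.
  lra.
- move=> eps eps0; have e0 := vnorm_ge0 e.
  have [eta [eta0 ex]] := expn (eps / (vnorm e + 1)) ltac:(apply: Rdiv_lt_0_compat; lra).
  exists eta; split=> // p' /ex [_ /(_ e) + _]; rewrite Le => de.
  apply: Rle_trans de _.
  have : eps / (vnorm e + 1) * vnorm e <= eps / (vnorm e + 1) * (vnorm e + 1).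
    by apply: Rmult_le_compat_l; [apply/Rlt_le/Rdiv_lt_0_compat; lra|lra].
  by rewrite (_ : eps / (vnorm e + 1) * (vnorm e + 1) = eps); last by field; lra.
move=> d d0.
(* The factor [c0] turns the error [d c0 |k h|^2] into at most [d H h]. *)
have [Cq [eta [Cq0 [eta0 near]]]] := near_expansion U rho L b p e bq expn (d * c0) ltac:(nra).
have e0 := vnorm_ge0 e.
(* The bound [ci eta^2 / 2] forces [|h| < eta] for points of [D] with [|w| < r]; the last two bounds
   do so for an arbitrary [h] with [|w| < r] and [H h < r], by making [|k h|] and [|e| |w|] small
   compared with [eta]. *)
pose r := Rmin (Rmin (Rmin eta eta1) (ci * (eta * eta) / 2))
  (Rmin (c0 * (eta * eta) / 64) (eta / (8 * (vnorm e + 1)))).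
have ee : 0 < eta * eta by nra.
have r0 : 0 < r.
  do !apply: Rmin_glb_lt => //; apply: Rdiv_lt_0_compat; try lra.
    exact: Rmult_lt_0_compat.
  exact: Rmult_lt_0_compat.
have [r1 r2] : r <= Rmin eta eta1 /\ r <= ci * (eta * eta) / 2.
  have := Rmin_l (Rmin (Rmin eta eta1) (ci * (eta * eta) / 2))
    (Rmin (c0 * (eta * eta) / 64) (eta / (8 * (vnorm e + 1)))); rewrite -/r.
  by have := Rmin_l (Rmin eta eta1) (ci * (eta * eta) / 2);
    have := Rmin_r (Rmin eta eta1) (ci * (eta * eta) / 2); lra.
have [r3 r4] : r <= c0 * (eta * eta) / 64 /\ r <= eta / (8 * (vnorm e + 1)).
  have := Rmin_r (Rmin (Rmin eta eta1) (ci * (eta * eta) / 2))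
    (Rmin (c0 * (eta * eta) / 64) (eta / (8 * (vnorm e + 1)))); rewrite -/r.
  by have := Rmin_l (c0 * (eta * eta) / 64) (eta / (8 * (vnorm e + 1)));
    have := Rmin_r (c0 * (eta * eta) / 64) (eta / (8 * (vnorm e + 1))); lra.
have r4' : 8 * (vnorm e * r) <= eta.
  have : (8 * (vnorm e + 1)) * r <= (8 * (vnorm e + 1)) * (eta / (8 * (vnorm e + 1))).
    by apply: Rmult_le_compat_l; lra.
  by rewrite (_ : (8 * (vnorm e + 1)) * (eta / (8 * (vnorm e + 1))) = eta); [lra|field; lra].
have rl := Rmin_l eta eta1; have rr := Rmin_r eta eta1.
exists Cq, r; do 2 (split=> //); move=> p' p'p rp'.
have nearH h : vnorm h < eta -> U (vadd p' h) /\
    Rabs (rho (vadd p' h) + Re (L p' h) - (H h + Re (S h))) <=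
      d * H h + Cq * (Cmod (L p' h) * Cmod (L p' h)).
  move=> hh; have [Uh _ ineq] := near p' ltac:(lra) rp' h hh; split=> //.
  rewrite -(quadratic_split bk h); apply: Rle_trans ineq _.
  have := Hk h; rewrite -/k => Hkh.
  by have : d * (c0 * (vnorm (k h) * vnorm (k h))) <= d * H h by [apply: Rmult_le_compat_l; lra]; lra.
split.
  move=> z Dz; set h := vsub z p' => wr.
  have hh : vnorm h < eta.
    have := unif p' ltac:(lra) rp' z Dz; rewrite -/h => ul.
    have := Re_le (L p' h); have := vnorm_ge0 h => h0 Rw.
    case: (Rlt_or_le (vnorm h) eta) => // eh.
    have : ci * (eta * eta) <= ci * (vnorm h * vnorm h) by apply: Rmult_le_compat_l; nra.
    have : 0 < ci * (eta * eta) by apply: Rmult_lt_0_compat.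
    lra.
  have [Uz /Rabs_le_between [lb _]] := nearH h hh.
  rewrite vsubK in Uz lb; have := proj1 (Drho z Uz) Dz; lra.
move=> h wr Hr ineq.
have k0 := vnorm_ge0 (k h).
have kh : vnorm (k h) < eta / 8.
  case: (Rlt_or_le (vnorm (k h)) (eta / 8)) => // ek.
  have := Hk h; have : c0 * (eta / 8 * (eta / 8)) <= c0 * (vnorm (k h) * vnorm (k h)).
    by apply: Rmult_le_compat_l; [lra|apply: Rmult_le_compat; lra].
  lra.
(* The bound of [|h|] by [k h] and [w] is only available for short vectors. If [|h| >= eta], it is
   applied to the multiple of [h] of norm [eta / 2], where it gives less than [eta / 2]. *)
have hh : vnorm h < eta.
  have := near p' ltac:(lra) rp'.
  case: (Rlt_or_le (vnorm h) eta) => // eh nearp.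
  have hp : 0 < vnorm h by lra.
  pose t := eta / (2 * vnorm h).
  have t0 : 0 < t by apply: Rdiv_lt_0_compat; lra.
  have t1 : t <= 1.
    apply: (Rmult_le_reg_r (2 * vnorm h)); first by lra.
    by rewrite /t (_ : eta / (2 * vnorm h) * (2 * vnorm h) = eta); [lra|field; lra].
  have th : t * vnorm h = eta / 2 by rewrite /t; field; lra.
  have [|_ + _] := nearp (vscal t h); first by rewrite vnorm_vscal Rabs_right; lra.
  rewrite vnorm_vscal (tangent_projZr L p e (Llin p)) vnorm_vscal vscalE (proj2 (Llin p')).
  rewrite Cmod_mult Cmod_R Rabs_right -/k; last by lra.
  have : t * vnorm (k h) <= 1 * vnorm (k h) by apply: Rmult_le_compat_r.
  have w0 := Cmod_ge_0 (L p' h).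
  have : t * Cmod (L p' h) <= 1 * Cmod (L p' h) by apply: Rmult_le_compat_r.
  move=> h1 h2.
  have : vnorm e * (t * Cmod (L p' h)) <= vnorm e * r by apply: Rmult_le_compat_l; lra.
  lra.
have [Uh /Rabs_le_between [_ ub]] := nearH h hh.
apply/(Drho _ Uh); lra.
Qed.

(** * From maps to the squeezing function *)

(** The upper bound uses a unit vector [ebasis j], hence a dimension of at least 1: an image inside
    the open unit ball cannot contain it. Existence of the least upper bound is what gives meaning
    to the [epsilon] in [Rsup]. *)
Lemma squeezing_bounds n (D : Cn n -> Prop) (q : Cn n) (j : 'I_n) r :
  squeeze_radii D q r -> r <= squeezing D q <= 1.
Proof.
move=> Dr.
have ub1 : is_upper_bound (squeeze_radii D q) 1.
  move=> s [s0 [f [[_ [fb _]] fs]]]; case: (Rle_or_lt s 1) => // s1.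
  have [|z [Dz fz]] := fs (ebasis j).
    by rewrite /ball vsub0 vnorm_ebasis.
  by have := fb z Dz; rewrite /ball fz vsub0 vnorm_ebasis; lra.
have [s slub] := completeness (squeeze_radii D q) (ex_intro _ 1 ub1) (ex_intro _ r Dr).
have [ub least] := epsilon_spec (inhabits 0) (fun s => is_lub (squeeze_radii D q) s)
  (ex_intro _ s slub).
by split; [exact: ub|exact: least].
Qed.

(** Translate by [T q] and divide by [1 + 2 eps]. The image then has norm below 1, since
    [sqrt (1 + eps) + eps < 1 + 2 eps]; and before division it contains the ball of radius
    [1 - 2 eps], since recentring costs at most [eps]. *)
Lemma squeeze_radius_of_map n (D : Cn n -> Prop) (q : Cn n) (T : Cn n -> Cn n) eps :
  0 < eps < / 2 -> D q ->
  (forall z i, D z -> complex_diff (fun z => T z i) z) ->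
  (forall z, D z -> vnorm (T z) * vnorm (T z) <= 1 + eps) ->
  (forall z z', D z -> D z' -> T z = T z' -> z = z') ->
  vnorm (T q) <= eps ->
  (forall x, vnorm x <= 1 - eps -> exists z, D z /\ T z = x) ->
  squeeze_radii D q ((1 - 2 * eps) / (1 + 2 * eps)).
Proof.
move=> [eps0 eps2] Dq Td Tn Ti Tq Ts.
pose c := / (1 + 2 * eps).
have c0 : 0 < c by apply: Rinv_0_lt_compat; lra.
have c1 : c * (1 + 2 * eps) = 1 by rewrite /c; field; lra.
have cC : RtoC c <> RtoC 0 by case; lra.
split; first by apply: Rdiv_lt_0_compat; lra.
exists (fun z => cscal (RtoC c) (vsub (T z) (T q))); split; [split; [|split; [|split]]|].
- apply: holomorphic_on_components => z i Dz.
  apply: complex_diff_mul; first exact: complex_diff_const.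
  by apply: complex_diff_sub; [exact: Td|exact: complex_diff_const].
- move=> z Dz; rewrite /ball vsub0 vnorm_cscal Cmod_R Rabs_right; last by lra.
  have Tz : vnorm (T z) <= 1 + eps / 2.
    by have := Tn z Dz; have := vnorm_ge0 (T z); nra.
  have := vnorm_sub_triangle (vzero n) (T z) (T q); rewrite vsub0 (vnorm_subC (vzero n)) vsub0 => tri.
  rewrite -c1; apply: Rmult_lt_compat_l => //; lra.
- move=> z w Dz Dw e; apply: Ti => //.
  have {}e : vsub (T z) (T q) = vsub (T w) (T q).
    have inv (v : Cn n) : v = cscal (/ RtoC c)%C (cscal (RtoC c) v).
      by rewrite cscalA (_ : (/ RtoC c * RtoC c)%C = RtoC 1) ?cscal1 //; field.
    by rewrite (inv (vsub (T z) (T q))) e -inv.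
  by rewrite -(vsubK (T z) (T q)) e vsubK.
- rewrite vsub_self -(cscal0 (vzero n)) cscalA.
  by rewrite (_ : (RtoC c * 0)%C = RtoC 0) //; cring.
move=> w; rewrite /ball vsub0 => wr.
have wr' : (1 + 2 * eps) * vnorm w <= 1 - 2 * eps.
  have : (1 + 2 * eps) * vnorm w <= (1 + 2 * eps) * ((1 - 2 * eps) / (1 + 2 * eps)).
    by apply: Rmult_le_compat_l; lra.
  by rewrite (_ : (1 + 2 * eps) * ((1 - 2 * eps) / (1 + 2 * eps)) = 1 - 2 * eps); last by field; lra.
have [|z [Dz Tz]] := Ts (vadd (cscal (RtoC (1 + 2 * eps)) w) (T q)).
  apply: Rle_trans (vnorm_triangle _ _) _.
  by rewrite vnorm_cscal Cmod_R Rabs_right; lra.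
exists z; split=> //; rewrite Tz vaddC vaddK cscalA -RtoC_mult c1.
exact: cscal1.
Qed.

(** The index [j] is exported to witness that the dimension is positive: it is the coordinate in
    which the gradient at [p] does not vanish. *)
Lemma squeeze_radii_near n (D : Cn n -> Prop) (p : Cn n) eps :
  spherically_extreme D p -> 0 < eps < / 2 ->
  exists (j : 'I_n) delta, 0 < delta /\ forall q, D q -> vnorm (vsub q p) < delta ->
    squeeze_radii D q ((1 - 2 * eps) / (1 + 2 * eps)).
Proof.
move=> /boundary_model [j0 [e [L [H [S [E [F [bd [c1 [c2 [Rb [A1 [A2 [A3 [cross [unif [kappa near]]]]]]]]]]]]]]]]].
move=> [eps0 eps2].
have [Sloc [Hloc [Sscale [Hscale [Sdiff [Llin ez]]]]]] := A1.
have [Elin [EF [FE Enorm]]] := A2.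
have [c10 [c20 [Rb0 [H0 SH]]]] := A3.
pose d := Rmin (Rmin (/ 4) c1) (eps / 4).
have d0 : 0 < d by do !apply: Rmin_glb_lt; lra.
have [d1 d2] : d <= / 4 /\ d <= c1.
  by have := Rmin_l (Rmin (/ 4) c1) (eps / 4); have := Rmin_l (/ 4) c1;
    have := Rmin_r (/ 4) c1; rewrite -/d; lra.
have d3 : d <= eps / 4 by exact: Rmin_r.
have [Cq [r [Cq0 [r0 nearr]]]] := near d d0.
have [M [la [M0 [la0 upper]]]] := upper_estimate c1 c2 Cq r Rb eps d c10 c20 Cq0 r0 Rb0 d0 d1 d2 ltac:(lra).
have [lb [lb0 lower]] := lower_estimate eps d M Cq r ltac:(lra) ltac:(lra) ltac:(lra) ltac:(lra) Cq0 r0.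
have [eta1 [eta10 unif1]] := unif.
have [eta2 [eta20 kap]] := kappa (eps / 8) ltac:(lra).
pose m := Rmin (Rmin la lb) (Rmin (eps / (8 * M)) (Rmin r (Rmin eta1 eta2))).
have m0 : 0 < m by do !apply: Rmin_glb_lt => //; apply: Rdiv_lt_0_compat; lra.
have [m1 m2] : m <= la /\ m <= lb.
  by have := Rmin_l (Rmin la lb) (Rmin (eps / (8 * M)) (Rmin r (Rmin eta1 eta2)));
    have := Rmin_l la lb; have := Rmin_r la lb; rewrite -/m; lra.
have mr := Rmin_r (Rmin la lb) (Rmin (eps / (8 * M)) (Rmin r (Rmin eta1 eta2))).
rewrite -/m in mr.
have m3 : m <= eps / (8 * M) by apply: Rle_trans mr (Rmin_l _ _).
have {}mr : m <= Rmin r (Rmin eta1 eta2) by apply: Rle_trans mr (Rmin_r _ _).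
have m4 : m <= r by apply: Rle_trans mr (Rmin_l _ _).
have {}mr : m <= Rmin eta1 eta2 by apply: Rle_trans mr (Rmin_r _ _).
have m5 : m <= eta1 by apply: Rle_trans mr (Rmin_l _ _).
have m6 : m <= eta2 by apply: Rle_trans mr (Rmin_r _ _).
have [delta [delta0 cr]] := cross m m0.
exists j0, delta; split=> // q Dq qp.
(* The parameter of the Cayley transform is imposed by [q]: with this [l] the point [q] is sent near
   the centre. *)
have [p' [l [[l0 lm] p'p bdp' qe]]] := cr q Dq qp.
have [Lj0 unifz] := unif1 p' ltac:(lra) bdp'.
have [inner outer] := nearr p' ltac:(lra) bdp'.
have Ll := Llin p'.
have up z : D z -> regular S (L p') p' M l z /\
    4 * l * (H (vsub z p') / (Cmod (denom (L p') p' M z) * Cmod (denom (L p') p' M z))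
      - Re (sheared S (L p') p' M z)) <=
    eps * (Cmod (sheared S (L p') p' M z + l)%C * Cmod (sheared S (L p') p' M z + l)%C).
  move=> Dz; have [Hw wRb] := unifz z Dz.
  have := upper (L p' (vsub z p')) (S (vsub z p')) (H (vsub z p')) l
    (H0 _) (SH _) Hw wRb (inner z Dz) ltac:(lra).
  move=> [P0 ineq]; split=> //; split=> //.
  have w0 : 0 <= Re (L p' (vsub z p')) by have := H0 (vsub z p'); nra.
  have [u1 _] := Cmod_one_plus M _ (Rlt_le _ _ M0) w0.
  by apply/Cmod_gt_0; rewrite /denom; lra.
pose T := ball_map j0 S E (L p') p' M l.
apply: (squeeze_radius_of_map n D q T eps) => //.
- by move=> z i Dz; apply: ball_map_diff => //; case: (up z Dz).
- move=> z Dz; have [reg ineq] := up z Dz.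
  rewrite /T (ball_map_norm j0 H) //.
  have Pp : 0 < Cmod (sheared S (L p') p' M z + l)%C by apply: Cmod_pos_neq0; case: reg.
  apply: Rplus_le_compat_l; apply: (Rmult_le_reg_r (Cmod (sheared S (L p') p' M z + l)%C * Cmod (sheared S (L p') p' M z + l)%C)).
    exact: Rmult_lt_0_compat.
  by rewrite /Rdiv Rmult_assoc Rinv_l ?Rmult_1_r //; nra.
- move=> z z' /up [rz _] /up [rz' _]; exact: (ball_map_inj j0 S E F (L p')).
- rewrite qe; apply: (ball_map_center j0 H S E (L p')) => //; first by lra.
    by apply: kap; lra.
  have : M * l <= M * (eps / (8 * M)) by apply: Rmult_le_compat_l; lra.
  by rewrite (_ : M * (eps / (8 * M)) = eps / 8); last by field; lra.
move=> x xn; pose v := F x.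
have vn : H v + Cmod (v j0) * Cmod (v j0) <= (1 - eps) * (1 - eps).
  by rewrite -Enorm /v EF; have := vnorm_ge0 x; nra.
have SHv : Cmod (S v) <= H v by have := SH v; have := H0 v; nra.
have [t0 g0 wr Hr ineq] := lower (v j0) (S v) (H v) l (H0 v) SHv ltac:(lra) ltac:(lra).
have [h [Lh Hh Sh ch]] := cayley_surj j0 H S (L p') p' M l Sloc Hloc Sscale Hscale Ll Lj0 l0 v t0 g0.
exists (vadd p' h); split; last by rewrite /T /ball_map ch /v EF.
by apply: outer; rewrite ?Lh ?Hh ?Sh.
Qed.

Theorem theorem3p1 (n : nat) (D : Cn n -> Prop) (p : Cn n) :
  is_domain D -> spherically_extreme D p ->
  forall eps, eps > 0 -> exists delta, delta > 0 /\
    forall q, D q -> vnorm (vsub q p) < delta -> Rabs (squeezing D q - 1) < eps.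
Proof.
move=> _ ext eps eps0.
(* The radius [(1 - 2 x) / (1 + 2 x)] is at least [1 - 4 x], and [4 x <= eps / 2]. *)
pose x := Rmin (eps / 8) (/ 8).
have x0 : 0 < x by apply: Rmin_glb_lt; lra.
have x1 : x <= eps / 8 by exact: Rmin_l.
have x2 : x <= / 8 by exact: Rmin_r.
have [j [delta [delta0 H]]] := squeeze_radii_near n D p x ext ltac:(lra).
exists delta; split=> // q Dq qp.
have := squeezing_bounds n D q j _ (H q Dq qp).
have : 1 - 4 * x <= (1 - 2 * x) / (1 + 2 * x).
  apply: (Rmult_le_reg_r (1 + 2 * x)); first by lra.
  by rewrite /Rdiv Rmult_assoc Rinv_l; nra.
by move=> h1 h2; rewrite Rabs_left1; lra.
Qed.
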